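(* Let $\Omega\subset\mathbb{R}^3$ be a smooth bounded domain and let $u$ be the global strong solution of the problem $$\begin{cases} u_{tt}-\Delta u+u^5+E(t)u_t=0 & \text{in }(0,\infty)\times\Omega,\\ u=0 & \text{on }(0,\infty)\times\partial\Omega,\\ (u(0),u_t(0))=(u_0,u_1),\end{cases}$$ with initial energy $E_0=E(0)>0$. Then there exist positive constants $C_0$ and $t_0$ such that $$E(t)\le\frac{C_0}{t}\qquad\text{for all }t\ge t_0.$$
   Context: All functions are real-valued. The coefficient $E(t)$ is the energy of the solution: $E(t)=\frac12(\|\nabla u(t)\|_{L^2(\Omega)}^2+\|u_t(t)\|_{L^2(\Omega)}^2)+\frac16\|u(t)\|_{L^6(\Omega)}^6$. A Shatah--Struwe solution on $[0,T]$ is a function $u$ with $(u,u_t)\in C([0,T];H_0^1(\Omega)\times L^2(\Omega))$, $u\in L^5(0,T;L^{10}(\Omega))\cap L^4(0,T;L^{12}(\Omega))$, which solves the problem in the sense of distributions. A global strong solution is a function which, for every $T>0$, is a Shatah--Struwe solution on $[0,T]$ and satisfies $(u,u_t)\in C([0,T];(H^2(\Omega)\cap H_0^1(\Omega))\times H_0^1(\Omega))$ (so that the initial data belong to $(H^2(\Omega)\cap H_0^1(\Omega))\times H_0^1(\Omega)$). *)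

(* Defs.v *)
From HB Require Import structures.
From mathcomp Require Import all_boot all_order all_algebra.
From mathcomp Require Import all_classical all_reals all_analysis.
From mathcomp Require Import measurable_realfun.

Set Implicit Arguments.
Unset Strict Implicit.
Unset Printing Implicit Defensive.

Import Order.TTheory GRing.Theory Num.Theory.
Import numFieldNormedType.Exports.

Local Open Scope classical_set_scope.
Local Open Scope ring_scope.

Section smooth_functions.
Context {R : realType} {V : normedModType R}.
Implicit Types (f : V -> R) (A : set V).

(* Class C^k through iterated directional derivatives: on a finite-dimensional
   V this is the usual notion. *)
Fixpoint is_Ck (k : nat) f : Prop :=
  continuous f /\
  if k is k'.+1 then
    forall v : V, (forall x, derivable f x v) /\ is_Ck k' ('D_v f)
  else True.

Definition smooth f : Prop := forall k, is_Ck k f.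

Definition tsupport f : set V := closure [set x | f x != 0].

Definition test_function A f : Prop :=
  [/\ smooth f, compact (tsupport f) & tsupport f `<=` A].

End smooth_functions.

(* R^3 is R * R * R rather than 'rV[R]_3, because the library puts Lebesgue
   (product) measure on products only.  Its library norm is the sup norm, equivalent
   to the Euclidean one; it only serves for topology and boundedness. *)
Notation R3 R := (R * R * R)%type.
Notation lebesgue3 R :=
  ((@lebesgue_measure R \x @lebesgue_measure R) \x @lebesgue_measure R)%E.

Section domains.
Context {R : realType}.

Definition basis3 (i : 'I_3) : R3 R :=
  ((val i == 0%N)%:R, (val i == 1%N)%:R, (val i == 2%N)%:R).

Definition coord3 (i : 'I_3) (x : R3 R) : R :=
  match val i with 0 => x.1.1 | 1 => x.1.2 | _ => x.2 end.

Definition other_coords3 (i : 'I_3) (x : R3 R) : R * R :=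
  match val i with
  | 0 => (x.1.2, x.2) | 1 => (x.1.1, x.2) | _ => (x.1.1, x.1.2)
  end.

(* Near each boundary point, up to relabelling (i) and reorienting (s) the axes,
   the set is the region strictly above the graph of a smooth function. *)
Definition smooth_boundary (Omega : set (R3 R)) : Prop :=
  forall p, (closure Omega `\` interior Omega) p ->
  exists (r : R) (i : 'I_3) (s : bool) (gamma : R * R -> R),
    [/\ 0 < r, smooth gamma &
     forall x, ball p r x ->
       (Omega x <-> gamma (other_coords3 i x) < (-1) ^+ s * coord3 i x)].

Definition smooth_bounded_domain (Omega : set (R3 R)) : Prop :=
  [/\ open Omega, connected Omega, Omega !=set0, bounded_set Omega
    & smooth_boundary Omega].

End domains.

Section sobolev.
Context {R : realType} (Omega : set (R3 R)).
Local Notation mu := (lebesgue3 R).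
Implicit Types f g : R3 R -> R.

(* Elements of the function spaces on Omega are represented by functions on R^3
   whose values outside Omega are irrelevant; f \_ Omega is extension by 0. *)
Definition Lp (p : R) : set (R3 R -> R) :=
  [set f | f \_ Omega \in Lfun mu p%:E].

Definition eLpnorm (p : R) f : \bar R := 'N[mu]_(p%:E)[EFin \o (f \_ Omega)].

Definition Lpnorm (p : R) f : R := fine (eLpnorm p f).

Definition loc_integrable f : Prop :=
  measurable_fun Omega f /\
  forall K : set (R3 R), compact K -> K `<=` Omega ->
    mu.-integrable K (EFin \o f).

Definition is_weak_deriv (i : 'I_3) f g : Prop :=
  [/\ loc_integrable f, loc_integrable g &
   forall phi, test_function Omega phi ->
     \int[mu]_(x in Omega) (f x * 'D_(basis3 i) phi x) =
     - \int[mu]_(x in Omega) (g x * phi x)].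

(* A representative of the i-th weak partial derivative, which is unique almost
   everywhere on Omega; the junk value 0 is taken if there is none. *)
Definition wderiv (i : 'I_3) f : R3 R -> R :=
  xget (fun=> 0) [set g | is_weak_deriv i f g].

Definition H1 : set (R3 R -> R) :=
  [set f | Lp 2 f /\ forall i, exists2 g, is_weak_deriv i f g & Lp 2 g].

Definition H1norm f : R :=
  Num.sqrt (Lpnorm 2 f ^+ 2 + \sum_(i < 3) Lpnorm 2 (wderiv i f) ^+ 2).

Definition H10 : set (R3 R -> R) :=
  [set f | H1 f /\ forall eps : R, 0 < eps ->
    exists2 phi, test_function Omega phi & H1norm (f \- phi) < eps].

Definition H2 : set (R3 R -> R) :=
  [set f | H1 f /\ forall i, H1 (wderiv i f)].

Definition H2norm f : R :=
  Num.sqrt (H1norm f ^+ 2 +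
    \sum_(i < 3) \sum_(j < 3) Lpnorm 2 (wderiv j (wderiv i f)) ^+ 2).

End sobolev.

Section evolution.
Context {R : realType} (Omega : set (R3 R)).
Local Notation mu := (lebesgue3 R).
Local Notation leb := (@lebesgue_measure R).

(* w belongs to C([0,T]; X), the topology of X being given by the norm N. *)
Definition cont_into (T : R) (X : set (R3 R -> R)) (N : (R3 R -> R) -> R)
    (w : R -> R3 R -> R) : Prop :=
  forall t, t \in `[0, T] ->
    X (w t) /\ N (w s \- w t) @[s --> within `[0, T] (nbhs t)] --> (0 : R).

(* w belongs to L^p(0,T; L^q(Omega)).  Only measurability of the norm is
   required: this is applied to w in C([0,T]; L^2(Omega)), for which strong
   measurability into L^q(Omega) follows. *)
Definition LpLq (T p q : R) (w : R -> R3 R -> R) : Prop :=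
  measurable_fun `]0, T[ (fun t => eLpnorm Omega q (w t)) /\
  ('N[leb]_(p%:E)[(fun t => eLpnorm Omega q (w t)) \_ `]0%R, T[] < +oo)%E.

Definition grad_sqnorm (f : R3 R -> R) : R :=
  \sum_(i < 3) Lpnorm Omega 2 (wderiv Omega i f) ^+ 2.

Definition energy (u ut : R -> R3 R -> R) (t : R) : R :=
  2^-1 * (grad_sqnorm (u t) + Lpnorm Omega 2 (ut t) ^+ 2)
  + 6^-1 * Lpnorm Omega 6 (u t) ^+ 6.

Definition dt (psi : R * R3 R -> R) : R * R3 R -> R := 'D_(1, 0) psi.

Definition laplacian (psi : R * R3 R -> R) (z : R * R3 R) : R :=
  \sum_(i < 3) 'D_(0, basis3 i) ('D_(0, basis3 i) psi) z.

(* Space-time pairings are iterated integrals, as u t and ut t are classes of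
   functions of x with no prescribed joint measurability in (t, x). *)
Definition is_time_derivative (T : R) (u ut : R -> R3 R -> R) : Prop :=
  forall psi, test_function (`]0, T[ `*` Omega) psi ->
    \int[leb]_(t in `]0, T[) \int[mu]_(x in Omega) (u t x * dt psi (t, x)) =
    - \int[leb]_(t in `]0, T[) \int[mu]_(x in Omega) (ut t x * psi (t, x)).

(* u_tt - Delta u + u^5 + E(t) u_t = 0 in the sense of distributions on
   (0,T) x Omega. *)
Definition solves_equation (T : R) (u ut : R -> R3 R -> R) : Prop :=
  forall psi, test_function (`]0, T[ `*` Omega) psi ->
    \int[leb]_(t in `]0, T[) \int[mu]_(x in Omega)
      (u t x * dt (dt psi) (t, x) - u t x * laplacian psi (t, x)
       + u t x ^+ 5 * psi (t, x) + energy u ut t * ut t x * psi (t, x)) = 0.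

(* A solution is carried together with ut, the (unique) representative of its
   distributional time derivative that is continuous in time. *)
Definition shatah_struwe_solution (T : R) (u ut : R -> R3 R -> R)
    (u0 u1 : R3 R -> R) : Prop :=
  [/\ is_time_derivative T u ut,
      cont_into T (H10 Omega) (H1norm Omega) u /\
      cont_into T (Lp Omega 2) (Lpnorm Omega 2) ut,
      LpLq T 5 10 u /\ LpLq T 4 12 u,
      solves_equation T u ut
    & {ae mu, forall x, Omega x -> u 0 x = u0 x} /\
      {ae mu, forall x, Omega x -> ut 0 x = u1 x}].

Definition global_strong_solution (u ut : R -> R3 R -> R)
    (u0 u1 : R3 R -> R) : Prop :=
  forall T : R, 0 < T ->
    [/\ shatah_struwe_solution T u ut u0 u1,
        cont_into T (H2 Omega `&` H10 Omega) (H2norm Omega) u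
      & cont_into T (H10 Omega) (H1norm Omega) ut].

End evolution.

(* Main.v *)
Require Import Defs.
From HB Require Import structures.
From mathcomp Require Import all_boot all_order all_algebra.
From mathcomp Require Import all_classical all_reals all_analysis.
From mathcomp Require Import measurable_realfun ring lra.
Set Implicit Arguments.
Unset Strict Implicit.
Unset Printing Implicit Defensive.
Import Order.TTheory GRing.Theory Num.Theory.
Import numFieldNormedType.Exports.
Local Open Scope classical_set_scope.
Local Open Scope ring_scope.

(** Multiplying the equation by u_t gives E' = - E V with V = |u_t|^2: the
    damping coefficient is the energy itself, so the damping weakens as
    the energy decays.  Multiplying by u gives the virial identity
    P' = V - |grad u|^2 - |u|_6^6 - E P for P = (u, u_t), whose right-hand side
    is at most 2 V - 2 E - E P.  By the Poincare inequality |P| is dominated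
    by E, so for a small constant eps the functional G = E + eps E P is
    comparable to E, and the multiples of E V in the derivative of eps E P are
    absorbed by - E V.  What remains is G' <= - eps E^2 <= - c G^2, and integrating the
    derivative of 1/G gives E <= C / t (decay_rate).

    The two identities have to be extracted from the distributional
    formulation.  Put v = u_t.  Testing with products eta(t) phi(x) and using
    that a continuous function with a continuous distributional derivative is
    of class C^1 (weak_is_derive) yields (u, phi)' = (v, phi) and
    (v, phi)' = A_t(phi), where A_t(phi) is minus the sum of the Dirichlet form
    of u and phi, the integral of u^5 phi, and E (v, phi) (u_derive, v_derive).
    One may not take phi = v or phi = u here, because these move with t.
    However A_t depends continuously on t, uniformly over phi in a bounded set
    of H^1_0, so the mean value theorem gives
    v(s) - v(t) = (s - t) A_t + o(s - t) uniformly over such phi, first for test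
    functions and then by density on H^1_0 (v_increment).  Testing against
    Laplacians of test functions shows in the same way that u is differentiable
    in t with values in H^1_0, with derivative v (u_increment).  These
    expansions are inserted into the quadratic and sextic terms of E and into P
    (energy_derive, virial_derive).

    The quintic term makes sense on H^1_0 by the Sobolev embedding into L^6 in
    dimension three.  For test functions it is Gagliardo's inequality applied
    to phi^4 (sobolev_test); it extends to H^1_0 by truncation (sobolev_H10),
    and as the domain has finite measure it implies the Poincare inequality
    (poincare_H10).  That weak derivatives are determined almost everywhere,
    which makes the Dirichlet form bilinear, rests on the fundamental lemma of
    the calculus of variations (fundamental_lemma). *)

(** * Smooth functions and test functions *)

Section smooth_calculus.
Context {R : realType}.
Implicit Types (V W : normedModType R).

Lemma is_Ck_continuous V k (f : V -> R) : is_Ck k f -> continuous f.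
Proof. by case: k => [|k] []. Qed.

Lemma is_Ck_succ V k (f : V -> R) : is_Ck k.+1 f -> is_Ck k f.
Proof.
elim: k f => [|k IH] f [cf Hf]; first by split.
by split=> // v; have [df H] := Hf v; split=> //; exact: IH.
Qed.

Lemma is_Ck_cst V k (c : R) : is_Ck k (fun _ : V => c).
Proof.
elim: k c => [|k IH] c; split=> //; try exact: cst_continuous.
move=> v; split; first by move=> x; exact: derivable_cst.
rewrite (_ : 'D_v _ = fun=> 0); first exact: IH.
by apply/funext => x; exact: derive_cst.
Qed.

Lemma is_CkD V k (f g : V -> R) : is_Ck k f -> is_Ck k g -> is_Ck k (f \+ g).
Proof.
elim: k f g => [|k IH] f g [cf Hf] [cg Hg]; split=> //;
  try by move=> x; apply: continuousD; [exact: cf|exact: cg].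
move=> v; have [df Df] := Hf v; have [dg Dg] := Hg v; split.
  by move=> x; exact: derivableD.
rewrite (_ : 'D_v _ = 'D_v f \+ 'D_v g); first exact: IH.
by apply/funext => x; rewrite deriveD.
Qed.

Lemma is_CkM V k (f g : V -> R) : is_Ck k f -> is_Ck k g -> is_Ck k (f \* g).
Proof.
elim: k f g => [|k IH] f g Cf Cg.
  split=> // x; apply: continuousM; exact: (@is_Ck_continuous _ 0).
have [cf Hf] := Cf; have [cg Hg] := Cg.
split; first by move=> x; apply: continuousM; [exact: cf|exact: cg].
move=> v; have [df Df] := Hf v; have [dg Dg] := Hg v; split.
  by move=> x; exact: derivableM.
rewrite (_ : 'D_v _ = (f \* 'D_v g) \+ (g \* 'D_v f)).
  by apply: is_CkD; apply: IH => //; exact: is_Ck_succ.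
by apply/funext => x; rewrite deriveM.
Qed.

Lemma derivable_comp_affine V W (L M : W -> V) (f : V -> R) (x v : W) :
  (forall h a b, L (h *: a + b) = h *: M a + L b) ->
  derivable f (L x) (M v) -> derivable (f \o L) x v.
Proof.
move=> LL; rewrite /derivable (_ : (fun h => _ *: (f _ - _)) =
  (fun h => h^-1 *: ((((f \o L) \o shift x) (h *: v)) - (f \o L) x)))//.
by apply/funext => h /=; rewrite LL.
Qed.

(** L is affine with linear part M, expressed without bundled linear maps so
    that projections, slices and scalings of the line all qualify. *)
Lemma derive_comp_affine V W (L M : W -> V) (f : V -> R) (v : W) :
  (forall h a b, L (h *: a + b) = h *: M a + L b) ->
  'D_v (f \o L) = 'D_(M v) f \o L.
Proof.
move=> LL; apply/funext => x /=; rewrite /derive.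
rewrite (_ : (fun h => h^-1 *: ((f \o shift (L x)) (h *: M v) - f (L x))) =
  (fun h => h^-1 *: ((((f \o L) \o shift x) (h *: v)) - (f \o L) x)))//.
by apply/funext => h /=; rewrite LL.
Qed.

Lemma is_Ck_comp_affine V W (L M : W -> V) k (f : V -> R) :
  continuous L -> (forall h a b, L (h *: a + b) = h *: M a + L b) ->
  is_Ck k f -> is_Ck k (f \o L).
Proof.
move=> cL LL; elim: k f => [|k IH] f [cf Hf]; split=> //;
  try by move=> x; apply: continuous_comp; [exact: cL|exact: cf].
move=> v; have [df Df] := Hf (M v); split.
  by move=> x; exact: (derivable_comp_affine LL).
by rewrite (derive_comp_affine _ _ LL); exact: IH.
Qed.

Lemma smooth_continuous V (f : V -> R) : smooth f -> continuous f.
Proof. by move=> /(_ 0%N) /is_Ck_continuous. Qed.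

Lemma smooth_cst V (c : R) : smooth (fun _ : V => c).
Proof. by move=> k; exact: is_Ck_cst. Qed.

Lemma smoothD V (f g : V -> R) : smooth f -> smooth g -> smooth (f \+ g).
Proof. by move=> sf sg k; exact: is_CkD. Qed.

Lemma smoothM V (f g : V -> R) : smooth f -> smooth g -> smooth (f \* g).
Proof. by move=> sf sg k; exact: is_CkM. Qed.

Lemma smoothX V (f : V -> R) n : smooth f -> smooth (fun x => f x ^+ n).
Proof.
move=> sf; elim: n => [|n IH]; first exact: smooth_cst.
rewrite (_ : (fun x => _) = f \* (fun x => f x ^+ n)); first exact: smoothM.
by apply/funext => x; rewrite exprS.
Qed.

Lemma smooth_derivable V (f : V -> R) x v : smooth f -> derivable f x v.
Proof. by move=> /(_ 1%N) [_ /(_ v) []]. Qed.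

Lemma smooth_derive V (f : V -> R) v : smooth f -> smooth ('D_v f).
Proof. by move=> sf k; have [_ /(_ v) []] := sf k.+1. Qed.

Lemma smooth_comp_affine V W (L M : W -> V) (f : V -> R) :
  continuous L -> (forall h a b, L (h *: a + b) = h *: M a + L b) ->
  smooth f -> smooth (f \o L).
Proof. by move=> cL LL sf k; exact: (is_Ck_comp_affine cL LL). Qed.

Lemma tsupport_out V (f : V -> R) x : ~ tsupport f x -> f x = 0.
Proof.
by move=> nx; apply: contra_notP nx => /eqP fx; exact: subset_closure.
Qed.

Lemma tsupport_sub V (f g : V -> R) : (forall x, f x = 0 -> g x = 0) ->
  tsupport g `<=` tsupport f.
Proof.
move=> fg; apply: closure_subset => x /=; apply: contra_neq; exact: fg.
Qed.

Lemma derive_out V (f : V -> R) v x : ~ tsupport f x -> 'D_v f x = 0.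
Proof.
move=> nx; have o : nbhs x (~` tsupport f).
  by apply: open_nbhs_nbhs; split=> //; apply: closed_openC; exact: closed_closure.
rewrite -(@derive_cst _ V _ 0 x v); apply: near_eq_derive.
near=> y; apply: tsupport_out.
by near: y.
Unshelve. all: by end_near. Qed.

Lemma tsupport_derive V (f : V -> R) v : tsupport ('D_v f) `<=` tsupport f.
Proof.
rewrite [X in _ `<=` X](closure_id _).1; last exact: closed_closure.
apply: closure_subset => x /= /eqP Dfx; apply: contrapT => nx.
by apply: Dfx; exact: derive_out.
Qed.

Lemma test_function_sub V (A : set V) (f g : V -> R) : test_function A f ->
  smooth g -> tsupport g `<=` tsupport f -> test_function A g.
Proof.
move=> [sf cf fA] sg gf; split => //.
  by apply: subclosed_compact cf gf; exact: closed_closure.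
exact: subset_trans fA.
Qed.

Lemma test_function_derive V (A : set V) (f : V -> R) v :
  test_function A f -> test_function A ('D_v f).
Proof.
move=> tf; apply: (test_function_sub tf); last exact: tsupport_derive.
by apply: smooth_derive; case: tf.
Qed.

Lemma test_functionMl V (A : set V) (f g : V -> R) :
  test_function A f -> smooth g -> test_function A (f \* g).
Proof.
move=> tf sg; apply: (test_function_sub tf).
  by apply: smoothM => //; case: tf.
by apply: tsupport_sub => x /= ->; rewrite mul0r.
Qed.

Lemma test_functionX V (A : set V) (f : V -> R) n :
  test_function A f -> test_function A (fun x => f x ^+ n.+1).
Proof.
move=> tf; apply: (test_function_sub tf).
  by apply: smoothX => //; case: tf.
by apply: tsupport_sub => x /= ->; rewrite expr0n.
Qed.

Lemma tsupport_closed V (f : V -> R) (K : set V) : closed K ->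
  (forall x, ~ K x -> f x = 0) -> tsupport f `<=` K.
Proof.
move=> cK fK; rewrite [X in _ `<=` X](closure_id _).1//.
apply: closure_subset => x /= /eqP fx.
by apply: contrapT => /fK.
Qed.

Lemma test_functionD V (A : set V) (f g : V -> R) :
  test_function A f -> test_function A g -> test_function A (f \+ g).
Proof.
move=> [sf cf fA] [sg cg gA]; have s : tsupport (f \+ g) `<=` tsupport f `|` tsupport g.
  apply: tsupport_closed; first by apply: closedU; exact: closed_closure.
  move=> x /not_orP[nf ng] /=.
  by rewrite (tsupport_out nf) (tsupport_out ng) addr0.
split; first exact: smoothD.
  apply: subclosed_compact s; first exact: closed_closure.
  exact: compactU.
by apply: subset_trans s _ => x [/fA|/gA].
Qed.

(** These products are the only space-time test functions against which the
    equation is tested. *)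
Lemma test_function_tensor V W (A : set V) (B : set W) (f : V -> R) (g : W -> R) :
  test_function A f -> test_function B g ->
  test_function (A `*` B) (fun z => f z.1 * g z.2).
Proof.
move=> [sf cf fA] [sg cg gB].
have s : tsupport (fun z : V * W => f z.1 * g z.2) `<=` tsupport f `*` tsupport g.
  apply: tsupport_closed.
    rewrite (_ : _ `*` _ = (fst @^-1` tsupport f) `&` (snd @^-1` tsupport g))//.
    by apply: closedI; apply: closed_comp; try exact: closed_closure;
      move=> ? _; [exact: cvg_fst|exact: cvg_snd].
  move=> [x y] /= /not_andP[] n; rewrite (tsupport_out n) ?mul0r ?mulr0//.
split.
- apply: (@smoothM _ (f \o fst) (g \o snd)).
  + by apply: (@smooth_comp_affine _ _ _ fst) => //; move=> ?; exact: cvg_fst.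
  + by apply: (@smooth_comp_affine _ _ _ snd) => //; move=> ?; exact: cvg_snd.
- by apply: subclosed_compact s; [exact: closed_closure|exact: compact_setX].
- by apply: subset_trans s _ => -[x y] [] /= /fA ? /gB.
Qed.

End smooth_calculus.

(** * Bump functions on the line *)

Section bump.
Context {R : realType}.

(** Expansions with an error e |x - a| are the form in which the energy and the
    virial are differentiated. *)
Lemma is_derive_eps (f : R -> R) (a l : R) :
  (forall e, 0 < e -> \forall x \near a, `|f x - f a - (x - a) * l| <= e * `|x - a|) ->
  is_derive a 1 f l.
Proof.
move=> H.
have cv : h^-1 *: ((f \o shift a) (h *: 1) - f a) @[h --> 0^'] --> l.
  apply/cvgrPdist_le => e e0.
  have := H _ e0; rewrite (near_shift 0) subr0 => H0.
  rewrite /dnbhs /within /=.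
  have : \forall h \near (0 : R), h != 0 -> `|l - h^-1 *: (f (h *: 1 + a) - f a)| <= e.
    apply: filterS H0 => h /= Hh h0.
    have hh : h *: (1 : R) = h by rewrite /GRing.scale /= mulr1.
    rewrite hh; move: Hh; rewrite addrK => Hh.
    rewrite /GRing.scale /= -[l](mulKf h0) -mulrBr normrM normfV.
    by rewrite mulrC ler_pdivrMr ?normr_gt0// distrC.
  exact.
apply: DeriveDef; first by apply/cvg_ex; exists l.
exact: cvg_lim.
Qed.

Lemma derive_scale (f : R -> R) (x v : R) : derivable f x 1 ->
  derivable f x v /\ 'D_v f x = v * 'D_1 f x.
Proof.
move=> /derivable1_diffP df; split; first exact: diff_derivable.
by rewrite !deriveE// -[v in LHS]mulr1 linearZ.
Qed.

(** For n = 0 this is the classical flat function exp(-1/x).  The negative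
    powers are included so that the family is stable under differentiation up
    to linear combinations. *)
Definition flat (n : nat) (x : R) : R :=
  if 0 < x then x^-1 ^+ n * expR (- x^-1) else 0.

Lemma flat_le0 n x : x <= 0 -> flat n x = 0.
Proof. by rewrite /flat; case: ltP. Qed.

(** exp(1/x) dominates (1/x)^(n+2) / (n+2)!; the spare factor x^2 makes flat
    differentiable at 0. *)
Lemma flat_bound n x : `|flat n x| <= n.+2`!%:R * x ^+ 2.
Proof.
rewrite /flat; case: ltP => x0; last by rewrite normr0 mulr_ge0// sqr_ge0.
have y0 : 0 < x^-1 by rewrite invr_gt0.
have := expR_ge1Dxn n.+1 (ltW y0).
rewrite ger0_norm ?mulr_ge0 ?expR_ge0 ?exprn_ge0 ?(ltW y0)//.
rewrite expRN => H; rewrite ler_pdivrMr ?expR_gt0//.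
have {}H : x^-1 ^+ n.+2 <= n.+2`!%:R * expR x^-1.
  rewrite mulrC -ler_pdivrMr ?ltr0n ?fact_gt0//.
  by apply: le_trans H; rewrite lerDr.
have -> : x^-1 ^+ n = x^-1 ^+ n.+2 * x ^+ 2.
  by rewrite -addn2 exprD -mulrA -exprMn mulVf ?gt_eqF// expr1n mulr1.
by rewrite [leRHS]mulrAC ler_wpM2r ?sqr_ge0.
Qed.

Lemma is_derive_flat n (x : R) :
  is_derive x 1 (flat n) (flat n.+2 x - n%:R * flat n.+1 x).
Proof.
case: (ltrgtP x 0) => x0.
- rewrite !flat_le0 ?ltW// mulr0 subr0.
  have e : {near x, cst 0 =1 flat n}.
    near=> y; rewrite flat_le0//; apply: ltW; near: y; exact: lt_nbhsl.
  by apply: near_eq_is_derive e _; exact: is_derive_cst.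
- have e : {near x, (fun y => y^-1 ^+ n * expR (- y^-1)) =1 flat n}.
    near=> y; rewrite /flat ifT//; near: y; exact: lt_nbhsr.
  apply: near_eq_is_derive e _.
  rewrite /flat x0.
  have xn0 : x != 0 by rewrite gt_eqF.
  have dV : is_derive x 1 (fun y : R => y^-1) (- x ^- 2).
    by apply: is_derive_eq; first exact: is_deriveV; rewrite scaler1.
  have dE : is_derive x 1 (fun y : R => expR (- y^-1)) (expR (- x^-1) * x ^- 2).
    have dN : is_derive x 1 (fun y : R => - y^-1) (x ^- 2).
      have -> : x ^- 2 = - (- x ^- 2) by rewrite opprK.
      exact: is_deriveN.
    exact: (@is_derive1_comp R expR (fun y => - y^-1) x _ _ (is_derive_expR _) dN).
  have dX : is_derive x 1 (fun y : R => y^-1 ^+ n) (n%:R * x^-1 ^+ n.-1 * - x ^- 2).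
    by have := is_deriveX n dV; rewrite exprfctE.
  apply: is_derive_eq (is_deriveM dX dE) _.
  rewrite /GRing.scale/= -exprVn; case: (n) => [|m] /=.
    by rewrite !mul0r !mulr0 addr0 subr0 !expr0 !mul1r mulrC.
  rewrite !exprS; ring.
- rewrite x0 !flat_le0// mulr0 subr0.
  apply: is_derive_eps => e e0.
  have C0 : 0 < n.+2`!%:R :> R by rewrite ltr0n fact_gt0.
  have P : \forall y \near (0 : R), `|y| <= e / n.+2`!%:R.
    by apply: nbhs0_le; rewrite divr_gt0.
  near=> y.
  rewrite (flat_le0 _ (lexx 0)) mulr0 !subr0 (le_trans (flat_bound _ _))//.
  rewrite -(real_normK (num_real y)) expr2 mulrA ler_wpM2r// mulrC -ler_pdivlMr//.
  near: y; exact: P.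
Unshelve. all: by end_near. Qed.

Lemma is_Ck_flat k n : is_Ck k (flat n).
Proof.
have dflat m (x : R) := @ex_derive _ _ _ _ _ _ _ (is_derive_flat m x).
have cflat m : continuous (flat m).
  by move=> x; apply: differentiable_continuous; apply/derivable1_diffP.
elim: k n => [|k IH] n; split=> // v; split.
  by move=> x; apply: (derive_scale v _).1.
rewrite (_ : 'D_v _ = (fun=> v) \* (flat n.+2 \+ ((fun=> - n%:R) \* flat n.+1))).
  by apply: is_CkM; [exact: is_Ck_cst|apply: is_CkD => //; apply: is_CkM => //; exact: is_Ck_cst].
apply/funext => x /=; rewrite (derive_scale v _).2//.
by rewrite (@derive_val _ _ _ _ _ _ _ (is_derive_flat n x)) mulNr.
Qed.

Lemma flat0_ge0 x : 0 <= flat 0 x.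
Proof. by rewrite /flat; case: ifP => // _; rewrite expr0 mul1r expR_ge0. Qed.
Lemma flat0_le1 x : flat 0 x <= 1.
Proof.
rewrite /flat; case: ifP => // x0.
by rewrite expr0 mul1r expR_le1 oppr_le0 invr_ge0 ltW.
Qed.
Lemma flat0_gt0 x : 0 < x -> 0 < flat 0 x.
Proof. by rewrite /flat => ->; rewrite expr0 mul1r expR_gt0. Qed.

Lemma flat0_cvg x : 0 < x -> flat 0 (k.+1%:R * x) @[k --> \oo] --> (1 : R).
Proof.
move=> x0.
rewrite (_ : (fun k => _) = fun k => expR (- (k.+1%:R^-1 * x^-1))).
  rewrite -[X in _ --> X]expR0; apply: continuous_cvg; first exact: continuous_expR.
  rewrite -[X in _ --> X]oppr0; apply: cvgN.
  rewrite -[X in _ --> X](mul0r x^-1); apply: cvgM; last exact: cvg_cst.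
  exact: cvg_harmonic.
apply/funext => k; rewrite /flat ifT ?mulr_gt0//.
by rewrite expr0 mul1r invfM.
Qed.

(** Smooth, supported in [a, b], positive inside, and converging to the
    indicator of ]a, b[ as k grows. *)
Definition bump (a b : R) (k : nat) (x : R) : R :=
  flat 0 (k.+1%:R * (x - a)) * flat 0 (k.+1%:R * (b - x)).

Lemma smooth_affine (c d : R) n : smooth (fun x : R => flat n (c * x + d)).
Proof.
move=> k; apply: (@is_Ck_comp_affine _ _ _ (fun x => c * x + d) (fun x => c * x)).
- by move=> x; apply: cvgD; [apply: cvgM; [exact: cvg_cst|exact: cvg_id]|exact: cvg_cst].
- by move=> h u w; rewrite /GRing.scale /= mulrDr mulrCA addrA.
- exact: is_Ck_flat.
Qed.

Lemma smooth_bump a b k : smooth (bump a b k).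
Proof.
have -> : bump a b k = (fun x => flat 0 (k.+1%:R * x + (- k.+1%:R * a))) \*
    (fun x => flat 0 ((- k.+1%:R) * x + k.+1%:R * b)).
  apply/funext => x; rewrite /bump /=; congr (flat _ _ * flat _ _); ring.
by apply: smoothM; exact: smooth_affine.
Qed.

Lemma bump_ge0 a b k x : 0 <= bump a b k x.
Proof. by rewrite mulr_ge0// flat0_ge0. Qed.
Lemma bump_le1 a b k x : bump a b k x <= 1.
Proof. by rewrite mulr_ile1// ?flat0_ge0 ?flat0_le1. Qed.
Lemma bump_out a b k x : x \notin `]a, b[ -> bump a b k x = 0.
Proof.
rewrite in_itv /= negb_and -!leNgt => /orP[] h; rewrite /bump.
  by rewrite flat_le0 ?mul0r// pmulr_rle0// subr_le0.
by rewrite [X in _ * X]flat_le0 ?mulr0// pmulr_rle0// subr_le0.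
Qed.
Lemma bump_gt0 a b k x : x \in `]a, b[ -> 0 < bump a b k x.
Proof.
rewrite in_itv /= => /andP[ax xb].
by rewrite mulr_gt0// flat0_gt0// mulr_gt0// subr_gt0.
Qed.
Lemma bump_cvg a b x : bump a b k x @[k --> \oo] --> ((x \in `]a, b[)%:R : R).
Proof.
have [xab|xab] := boolP (x \in _).
  move: xab; rewrite in_itv /= => /andP[ax xb].
  rewrite -[X in _ --> X]mulr1; apply: cvgM; apply: flat0_cvg; by rewrite subr_gt0.
rewrite (_ : (fun k => _) = fun=> 0); first exact: cvg_cst.
by apply/funext => k; rewrite bump_out.
Qed.
Lemma tsupport_bump a b k : tsupport (bump a b k) `<=` `[a, b].
Proof.
apply: tsupport_closed => [|x /negP xab]; first exact: itv_closed.
apply: bump_out; apply: contra xab; exact: subset_itv_oo_cc.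
Qed.
Lemma test_function_bump (A : set R) a b k : `[a, b] `<=` A -> test_function A (bump a b k).
Proof.
move=> abA; split; first exact: smooth_bump.
  apply: subclosed_compact (@tsupport_bump _ _ _); first exact: closed_closure.
  exact: segment_compact.
by apply: subset_trans abA; exact: tsupport_bump.
Qed.

End bump.

(** * Distributional derivatives on an interval *)

Section dubois.
Context {R : realType}.
Local Notation mu := (@lebesgue_measure R).

Lemma compact_in_itv (A B : R) (K : set R) : A < B -> compact K -> K `<=` `]A, B[ ->
  exists a b, [/\ A < a, a < b, b < B & K `<=` `]a, b[].
Proof.
move=> AB cK KAB.
have [->|K0] := eqVneq K set0.
  exists (A + (B - A) / 3), (A + (B - A) / 3 * 2); split; try lra.
  exact: sub0set.
have {}K0 : K !=set0 by apply/set0P.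
have cid : {within K, continuous (@id R)} by apply: continuous_subspaceT => x; exact: cvg_id.
have [M /set_mem KM hM] := compact_EVT_max K0 cK cid.
have [m /set_mem Km hm] := compact_EVT_min K0 cK cid.
have := KAB _ KM; have := KAB _ Km; rewrite /= !in_itv /= => /andP[Am mB] /andP[AM MB].
have mM : m <= M by apply: hM; rewrite inE.
exists ((A + m) / 2), ((M + B) / 2); split; try lra.
move=> x Kx /=; rewrite in_itv /=.
have := hM x; have := hm x; rewrite inE => /(_ Kx) h1 /(_ Kx) h2.
apply/andP; split; lra.
Qed.

Lemma Rintegral_support d (T : measurableType d) (m : {measure set T -> \bar R})
    (D K : set T) (f : T -> R) :
  K `<=` D -> (forall x, D x -> ~ K x -> f x = 0) ->
  \int[m]_(x in D) f x = \int[m]_(x in K) f x.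
Proof.
move=> KD f0; rewrite Rintegral_mkcond [RHS]Rintegral_mkcond.
congr Rintegral; apply/funext => x; rewrite /patch.
case: ifPn => [|]; rewrite ?inE ?notin_setE => Dx.
  by case: ifPn => //; rewrite notin_setE => nK; exact: f0.
by rewrite ifF//; apply/negbTE; rewrite notin_setE => /KD.
Qed.

Lemma cont_itv_integrable (a b : R) (f : R -> R) :
  {in `[a, b], continuous f} -> mu.-integrable `[a, b] (EFin \o f).
Proof.
move=> cf; apply: continuous_compact_integrable; first exact: segment_compact.
apply: continuous_in_subspaceT => x; rewrite inE => xab; exact: cf.
Qed.

Lemma primitive_is_derive (a b x : R) (f : R -> R) : {in `[a, b], continuous f} ->
  x \in `]a, b[ -> is_derive x 1 (fun y => \int[mu]_(t in `[a, y]) f t) (f x).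
Proof.
move=> cf; rewrite in_itv /= => /andP[ax xb].
have [] := @continuous_FTC1_closed R f a x b xb (cont_itv_integrable cf) ax.
  by apply: cf; rewrite in_itv /= !ltW.
by move=> d1; rewrite derive1E => d2; exact: DeriveDef d1 d2.
Qed.

Lemma near_radius (s : R) (P : R -> Prop) : (\forall x \near s, P x) ->
  exists d, 0 < d /\ forall x, `|x - s| < d -> P x.
Proof.
move=> /nbhs_ballP[d d0 H]; exists d; split=> // x xs; apply: H.
by rewrite /ball /= distrC.
Qed.

Lemma Rint_gt0 (a b x : R) (f : R -> R) : {in `[a, b], continuous f} ->
  (forall y, y \in `[a, b] -> 0 <= f y) -> x \in `]a, b[ -> 0 < f x ->
  0 < \int[mu]_(t in `[a, b]) f t.
Proof.
move=> cf f0 xab fx.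
have xab' := subset_itv_oo_cc xab.
have fx2 : f x / 2 < f x by lra.
have [d [d0 h]] := near_radius (cvgr_gt _ (cf x xab') _ fx2).
move: xab; rewrite in_itv /= => /andP[ax xb].
pose c := Num.max a (x - d / 2).
have cx : c < x by rewrite /c gt_max ax; lra.
have ac : a <= c by rewrite /c le_max lexx.
have cd : x - d / 2 <= c by rewrite /c le_max lexx orbT.
have sub : `[c, x] `<=` `[a, b].
  by move=> y /=; rewrite !in_itv /= => /andP[? ?]; apply/andP; split; lra.
have fi := cont_itv_integrable cf.
apply: (@lt_le_trans _ _ (\int[mu]_(t in `[c, x]) (cst (f x / 2) t))).
  rewrite Rintegral_cst//= lebesgue_measure_itv /= lte_fin cx /=.
  by apply: mulr_gt0; lra.
apply: (@le_trans _ _ (\int[mu]_(t in `[c, x]) f t)).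
  apply: le_Rintegral => //.
  - by apply: cont_itv_integrable => y _; exact: cvg_cst.
  - by apply: integrableS fi.
  - move=> y; rewrite /= in_itv /= => /andP[h1 h2]; apply/ltW/h.
    by rewrite ler0_norm; lra.
rewrite /Rintegral fine_le//.
- by apply: integrable_fin_num => //; apply: integrableS fi.
- exact: integrable_fin_num.
apply: ge0_subset_integral => //.
by case/integrableP: fi.
Qed.

(** The primitive from the left end is constant beyond the support of w, and
    the mean-value condition makes this constant zero. *)
Lemma zero_mean_primitive (A B a b : R) (w : R -> R) : A < a -> a < b -> b < B ->
  smooth w -> (forall x, x \notin `[a, b] -> w x = 0) ->
  \int[mu]_(t in `[a, b]) w t = 0 ->
  exists2 eta, test_function (`]A, B[) eta & forall x, 'D_1 eta x = w x.
Proof.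
move=> Aa ab bB sw w0 iw.
pose eta x := \int[mu]_(t in `[A, x]) w t.
have cw : continuous w by exact: smooth_continuous.
have eta_lt x : x < a -> eta x = 0.
  move=> xa; rewrite /eta (@eq_Rintegral _ _ _ mu _ (cst 0)) ?Rintegral_cst//; last first.
    move=> t /set_mem /=; rewrite in_itv /= => /andP[_ tx]; apply: w0.
    by rewrite in_itv /= negb_and -!ltNge (le_lt_trans tx xa).
  by rewrite mul0r.
have eta_gt x : b < x -> eta x = 0.
  move=> bx; rewrite /eta (@Rintegral_support _ _ mu _ `[a, b])//.
    by move=> t /=; rewrite !in_itv /= => /andP[h1 h2]; apply/andP; split; lra.
  by move=> t _ /negP; exact: w0.
have deta (x : R) : is_derive x 1 eta (w x).
  have [xa|ax] := ltP x a.
    rewrite w0; last by rewrite in_itv /= negb_and -!ltNge xa.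
    apply: (@near_eq_is_derive _ _ _ (cst 0)).
    near=> y; rewrite eta_lt//; near: y; exact: lt_nbhsl.
  apply: (@primitive_is_derive A (x + 1)) => [y _|]; first exact: cw.
  by rewrite in_itv /= (lt_le_trans Aa ax) ltrDl/= ltr01.
have seta : smooth eta.
  move=> k; have ceta : continuous eta.
    move=> x; apply: differentiable_continuous; apply/derivable1_diffP.
    exact: ex_derive.
  case: k => [|k]; split=> // v; split.
    by move=> x; apply: (derive_scale v _).1; exact: ex_derive.
  rewrite (_ : 'D_v _ = (fun=> v) \* w).
    by apply: is_CkM; [exact: is_Ck_cst|exact: sw].
  apply/funext => x /=; rewrite (derive_scale v _).2//.
    by rewrite derive_val.
exists eta; last by move=> x; rewrite derive_val.
have s : tsupport eta `<=` `[a, b].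
  apply: tsupport_closed; first exact: itv_closed.
  move=> x /negP; rewrite in_itv /= negb_and -!ltNge => /orP[|]; [exact: eta_lt|exact: eta_gt].
split=> //.
  by apply: subclosed_compact s; [exact: closed_closure|exact: segment_compact].
by apply: subset_trans s _ => t /=; rewrite !in_itv /= => /andP[? ?]; apply/andP; split; lra.
Unshelve. all: by end_near. Qed.

(** If h s > h r, weigh a bump near s against a bump near r so that the
    difference has zero mean.  It is then the derivative of a test function,
    but its integral against h is positive.  The roles of s and r are
    symmetric, so h is constant. *)
Lemma weak_derivative0_cst (A B : R) (h : R -> R) : {in `]A, B[, continuous h} ->
  (forall eta, test_function (`]A, B[) eta ->
     \int[mu]_(t in `]A, B[) (h t * 'D_1 eta t) = 0) ->
  {in `]A, B[ &, forall s r, h s <= h r}.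
Proof.
move=> ch H s r; rewrite !in_itv /= => /andP[As sB] /andP[Ar rB].
rewrite leNgt; apply/negP => hrs.
(* Two levels separating h r < h s; h stays above c1 near s and below c2 near
   r. *)
pose c1 := (2 * h s + h r) / 3; pose c2 := (h s + 2 * h r) / 3.
have c12 : c2 < c1 by rewrite /c1 /c2; lra.
have [d [d0 ds dr hs hr]] : exists d, [/\ 0 < d, A < s - d /\ s + d < B,
    A < r - d /\ r + d < B, (forall x, x \in `[s - d, s + d] -> c1 < h x)
    & (forall x, x \in `[r - d, r + d] -> h x < c2)].
  have c1s : c1 < h s by rewrite /c1; lra.
  have c2r : h r < c2 by rewrite /c2; lra.
  have sAB : s \in `]A, B[ by rewrite in_itv /= As.
  have rAB : r \in `]A, B[ by rewrite in_itv /= Ar.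
  have [d1 [d10 h1]] := near_radius (cvgr_gt _ (ch s sAB) _ c1s).
  have [d2 [d20 h2]] := near_radius (cvgr_lt _ (ch r rAB) _ c2r).
  pose d := Num.min (Num.min d1 d2) (Num.min (Num.min (s - A) (B - s)) (Num.min (r - A) (B - r))).
  have d0 : 0 < d by rewrite /d !lt_min d10 d20 !subr_gt0 As sB Ar rB.
  have : d <= d by [].
  rewrite {2}/d !le_min => /andP[/andP[dd1 dd2] /andP[/andP[? ?] /andP[? ?]]].
  exists (d / 2); split; [lra|split; lra|split; lra| |] => x; rewrite in_itv /= => /andP[? ?].
    by apply: h1; rewrite ltr_norml; apply/andP; split; lra.
  by apply: h2; rewrite ltr_norml; apply/andP; split; lra.
pose ps := bump (s - d) (s + d) 0; pose pr := bump (r - d) (r + d) 0.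
pose a := Num.min (s - d) (r - d); pose b := Num.max (s + d) (r + d).
have Aa : A < a by rewrite /a lt_min ds.1 dr.1.
have bB : b < B by rewrite /b gt_max ds.2 dr.2.
have ab : a < b by rewrite /a /b gt_min lt_max; apply/orP; left; apply/orP; left; lra.
have sub_s : `[s - d, s + d] `<=` `[a, b].
  move=> x /=; rewrite !in_itv /= => /andP[h1 h2].
  by rewrite /a /b ge_min le_max h1 h2.
have sub_r : `[r - d, r + d] `<=` `[a, b].
  move=> x /=; rewrite !in_itv /= => /andP[h1 h2].
  by rewrite /a /b ge_min le_max h1 h2 !orbT.
have ps0 x : x \notin `[s - d, s + d] -> ps x = 0.
  move=> xab; apply: bump_out; apply: contra xab; exact: subset_itv_oo_cc.
have pr0 x : x \notin `[r - d, r + d] -> pr x = 0.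
  move=> xab; apply: bump_out; apply: contra xab; exact: subset_itv_oo_cc.
have sps : smooth ps by exact: smooth_bump.
have spr : smooth pr by exact: smooth_bump.
have cps := smooth_continuous sps; have cpr := smooth_continuous spr.
pose Is := \int[mu]_(t in `[a, b]) ps t; pose Ir := \int[mu]_(t in `[a, b]) pr t.
have abAB x : x \in `[a, b] -> x \in `]A, B[.
  by rewrite !in_itv /= => /andP[? ?]; apply/andP; split; lra.
have ch' : {in `[a, b], continuous h} by move=> x /abAB; exact: ch.
have int_c (f : R -> R) : continuous f -> mu.-integrable `[a, b] (EFin \o f).
  by move=> cf; apply: cont_itv_integrable => x _; exact: cf.
have int_hc (f : R -> R) : continuous f -> mu.-integrable `[a, b] (EFin \o (h \* f)).
  move=> cf; apply: cont_itv_integrable => x /ch' chx.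
  by apply: continuousM => //; exact: cf.
have Is0 : 0 < Is.
  rewrite /Is; apply: (@Rint_gt0 a b s) => [x _|x _||].
  - exact: cps.
  - exact: bump_ge0.
  - rewrite in_itv /= /a /b gt_min lt_max; apply/andP; split; apply/orP; left; lra.
  - by apply: bump_gt0; rewrite in_itv /=; apply/andP; split; lra.
have Ir0 : 0 < Ir.
  rewrite /Ir; apply: (@Rint_gt0 a b r) => [x _|x _||].
  - exact: cpr.
  - exact: bump_ge0.
  - rewrite in_itv /= /a /b gt_min lt_max; apply/andP; split; apply/orP; right; lra.
  - by apply: bump_gt0; rewrite in_itv /=; apply/andP; split; lra.
have cstc (k : R) : continuous (fun _ : R => k) by move=> ?; exact: cvg_cst.
have cM (f g : R -> R) : continuous f -> continuous g -> continuous (f \* g).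
  by move=> cf cg x; apply: continuousM; [exact: cf|exact: cg].
(* Cross-weighting by the masses makes the difference of the two bumps
   mean-free. *)
pose w := (fun x => Ir * ps x - Is * pr x).
have sw : smooth w.
  have -> : w = ((fun=> Ir) \* ps) \+ ((fun=> - Is) \* pr).
    by apply/funext => x; rewrite /w /= mulNr.
  by apply: smoothD; apply: smoothM => //; exact: smooth_cst.
have [||eta teta Deta] := @zero_mean_primitive A B a b w Aa ab bB sw.
- move=> x xab; rewrite /w ps0 ?pr0 ?mulr0 ?subr0//.
  + by apply: contra xab; exact: sub_r.
  + by apply: contra xab; exact: sub_s.
- rewrite RintegralB//; [|exact: (int_c ((fun=> Ir) \* ps) (cM _ _ (cstc _) cps))
    |exact: (int_c ((fun=> Is) \* pr) (cM _ _ (cstc _) cpr))].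
  rewrite !RintegralZl//; [|exact: int_c|exact: int_c].
  by rewrite -/Is -/Ir mulrC subrr.
have := H _ teta.
rewrite (@Rintegral_support _ _ mu _ `[a, b]); last 2 first.
- by move=> x /= /abAB.
- move=> x _ /negP xab; rewrite Deta /w ps0 ?pr0 ?mulr0 ?subr0 ?mulr0//.
  + by apply: contra xab; exact: sub_r.
  + by apply: contra xab; exact: sub_s.
have -> : \int[mu]_(x in `[a, b]) (h x * 'D_1 eta x) =
   Ir * \int[mu]_(x in `[a, b]) (h x * ps x) - Is * \int[mu]_(x in `[a, b]) (h x * pr x).
  rewrite -!RintegralZl//; [|exact: int_hc|exact: int_hc].
  rewrite -RintegralB//; last 2 first.
  - rewrite (_ : _ \o _ = EFin \o (h \* ((fun=> Ir) \* ps))).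
      by apply: int_hc; exact: cM.
    by apply/funext => x /=; rewrite mulrCA.
  - rewrite (_ : _ \o _ = EFin \o (h \* ((fun=> Is) \* pr))).
      by apply: int_hc; exact: cM.
    by apply/funext => x /=; rewrite mulrCA.
  by apply: eq_Rintegral => x _; rewrite Deta /w; ring.
apply/eqP; rewrite gt_eqF// subr_gt0.
apply: (@le_lt_trans _ _ (Is * (c2 * Ir))).
  rewrite ler_pM2l// /Ir -RintegralZl//; last exact: int_c.
  apply: le_Rintegral => //; first exact: int_hc.
    exact: (int_c ((fun=> c2) \* pr) (cM _ _ (cstc _) cpr)).
  move=> x _; have [xr|xr] := boolP (x \in `[r - d, r + d]).
    by rewrite ler_wpM2r// ?bump_ge0// ltW// hr.
  by rewrite pr0 ?mulr0.
apply: (@lt_le_trans _ _ (Ir * (c1 * Is))).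
  by rewrite [Is * (c2 * _)]mulrCA [Ir * (c1 * _)]mulrCA [Ir * Is]mulrC (ltr_pM2r (mulr_gt0 Is0 Ir0)).
rewrite ler_pM2l// /Is -RintegralZl//; last exact: int_c.
apply: le_Rintegral => //; last 2 first.
- exact: int_hc.
- move=> x _; have [xr|xr] := boolP (x \in `[s - d, s + d]).
    by rewrite ler_wpM2r// ?bump_ge0// ltW// hs.
  by rewrite ps0 ?mulr0.
exact: (int_c ((fun=> c1) \* ps) (cM _ _ (cstc _) cps)).
Qed.

(** Subtracting the primitive of g leaves a function with zero distributional
    derivative, which is constant. *)
Lemma weak_is_derive (T : R) (f g : R -> R) : {in `]0, T[, continuous f} ->
  {in `]0, T[, continuous g} ->
  (forall eta, test_function (`]0, T[) eta ->
     \int[mu]_(t in `]0, T[) (f t * 'D_1 eta t) =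
     - \int[mu]_(t in `]0, T[) (g t * eta t)) ->
  forall t, t \in `]0, T[ -> is_derive t 1 f (g t).
Proof.
move=> cf cg H t; rewrite in_itv /= => /andP[t0 tT].
(* G needs a base point A inside ]0, T[; f is compared with it on ]A', B[, well
   inside ]A, B[ where G is differentiable. *)
pose A := t / 3; pose A' := 2 * t / 3; pose B := (t + T) / 2.
pose G x := \int[mu]_(y in `[A, x]) g y.
have cgAB : {in `[A, B], continuous g}.
  move=> x; rewrite in_itv /= /A /B => /andP[h1 h2]; apply: cg; rewrite in_itv /=.
  apply/andP; split; lra.
have dG x : x \in `]A, B[ -> is_derive x 1 G (g x).
  by move=> xAB; exact: (@primitive_is_derive A B).
have cG : {in `]A, B[, continuous G}.
  move=> x /dG dGx; apply: differentiable_continuous; apply/derivable1_diffP.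
  exact: ex_derive.
have sub x : x \in `]A', B[ -> x \in `]A, B[.
  by rewrite !in_itv /= /A /A' => /andP[? ?]; apply/andP; split; lra.
have sub2 x : x \in `]A, B[ -> x \in `]0, T[.
  by rewrite !in_itv /= /A /B => /andP[? ?]; apply/andP; split; lra.
have tA'B : t \in `]A', B[ by rewrite in_itv /= /A' /B; apply/andP; split; lra.
have cst : {in `]A', B[ &, forall s r, f s - G s <= f r - G r}.
  apply: (@weak_derivative0_cst A' B (fun x => f x - G x)).
    move=> x xAB; apply: continuousB; [exact/cf/sub2/sub|exact/cG/sub].
  move=> eta [seta ceta etaAB].
  have AB' : A' < B by rewrite /A' /B; lra.
  have [a [b [Aa ab bB Kab]]] := compact_in_itv AB' ceta etaAB.
  have abAB x : x \in `[a, b] -> x \in `]A', B[.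
    by rewrite /= !in_itv /= => /andP[? ?]; apply/andP; split; lra.
  have eta0 x : ~ x \in `]a, b[ -> eta x = 0 /\ 'D_1 eta x = 0.
    by move=> nx; split; [apply: tsupport_out|apply: derive_out] => /Kab.
  have cc x : ~ x \in `[a, b] -> ~ x \in `]a, b[.
    by apply: contra_not; exact: subset_itv_oo_cc.
  have ceta' := smooth_continuous seta.
  have cdeta : continuous ('D_1 eta) by apply/smooth_continuous/smooth_derive.
  rewrite (@Rintegral_support _ _ mu _ `[a, b]); last 2 first.
  - by move=> x /abAB.
  - by move=> x _ /cc /eta0[_ ->]; rewrite mulr0.
  have T1 : test_function (`]0, T[) eta.
    by split=> // x /etaAB /sub /sub2.
  have := H _ T1.
  rewrite (@Rintegral_support _ _ mu _ `[a, b]); last 2 first.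
  - by move=> x /abAB /sub /sub2.
  - by move=> x _ /cc /eta0[_ ->]; rewrite mulr0.
  rewrite [in X in _ = X -> _](@Rintegral_support _ _ mu _ `[a, b]); last 2 first.
  - by move=> x /abAB /sub /sub2.
  - by move=> x _ /cc /eta0[-> _]; rewrite mulr0.
  have fab : {in `[a, b], continuous f} by move=> x /abAB /sub /sub2 /cf.
  have gab : {in `[a, b], continuous g} by move=> x /abAB /sub /sub2 /cg.
  have Gab : {in `[a, b], continuous G} by move=> x /abAB /sub /cG.
  have ea : eta a = 0 by apply: (eta0 a _).1; rewrite /= in_itv /= ltxx.
  have eb : eta b = 0 by apply: (eta0 b _).1; rewrite /= in_itv /= ltxx andbF.
  have IBP : \int[mu]_(x in `[a, b]) (G x * 'D_1 eta x) = - \int[mu]_(x in `[a, b]) (g x * eta x).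
    rewrite (@Rintegration_by_parts R G eta g ('D_1 eta) a b ab).
    - by rewrite ea eb !mulr0 subr0 sub0r.
    - apply: continuous_in_subspaceT => x; rewrite inE; exact: gab.
    - split.
      + by move=> x /subset_itv_oo_cc xab; have /dG dGx := sub _ (abAB _ xab); exact: ex_derive.
      + apply: cvg_at_right_filter; apply: Gab; rewrite in_itv /= lexx ltW//.
      + apply: cvg_at_left_filter; apply: Gab; rewrite in_itv /= lexx ltW//.
    - move=> x /subset_itv_oo_cc xab; have /dG dGx := sub _ (abAB _ xab).
      by rewrite derive1E derive_val.
    - by apply: continuous_subspaceT.
    - split=> [x _||]; first exact: smooth_derivable.
      + exact/cvg_at_right_filter/ceta'.
      + exact/cvg_at_left_filter/ceta'.
    - by move=> x _; rewrite derive1E.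
  move=> e1.
  rewrite (@eq_Rintegral _ _ _ mu _ (fun x => f x * 'D_1 eta x - G x * 'D_1 eta x)); last first.
    by move=> x _; rewrite mulrBl.
  rewrite RintegralB//.
  - by rewrite e1 IBP subrr.
  - apply: (@cont_itv_integrable a b (f \* 'D_1 eta)) => x xab.
    by apply: continuousM; [exact: fab|exact: cdeta].
  - apply: (@cont_itv_integrable a b (G \* 'D_1 eta)) => x xab.
    by apply: continuousM; [exact: Gab|exact: cdeta].
apply: (@near_eq_is_derive _ _ _ (fun x => G x + (f t - G t))).
  near=> x.
  have xAB : x \in `]A', B[.
    by near: x; apply: near_in_itvoo.
  have : f x - G x = f t - G t by apply/eqP; rewrite eq_le !cst.
  lra.
have dGt := dG _ (sub _ tA'B).
have := is_deriveD dGt (is_derive_cst (f t - G t) t 1).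
by rewrite addr0.
Unshelve. all: by end_near. Qed.
End dubois.

(** * Measurability in space and the fundamental lemma *)

Section boxes.
Context {R : realType}.
Local Notation mu := (lebesgue3 R).

Definition box (a b : R3 R) : set (R3 R) :=
  (`]a.1.1, b.1.1[ `*` `]a.1.2, b.1.2[) `*` `]a.2, b.2[.

Definition cbox (a b : R3 R) : set (R3 R) :=
  (`[a.1.1, b.1.1] `*` `[a.1.2, b.1.2]) `*` `[a.2, b.2].

Lemma measurable_box a b : measurable (box a b).
Proof. by apply: measurableX; [apply: measurableX|]; exact: measurable_itv. Qed.

Lemma measurable_cbox a b : measurable (cbox a b).
Proof. by apply: measurableX; [apply: measurableX|]; exact: measurable_itv. Qed.

Lemma compact_cbox a b : compact (cbox a b).
Proof. by apply: compact_setX; [apply: compact_setX|]; exact: segment_compact. Qed.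

Lemma box_cbox a b : box a b `<=` cbox a b.
Proof. by move=> x [[h1 h2] h3]; split; [split|]; exact: subset_itv_oo_cc. Qed.

Lemma cbox_fin a b : (mu (cbox a b) < +oo)%E.
Proof.
rewrite /cbox product_measure1E//=; last exact: measurableX.
rewrite product_measure1E//= !lebesgue_measure_itv.
by do 3! case: ifP => _; rewrite ?mule0 ?mul0e ?ltry //= -?EFinD -?EFinM ltry.
Qed.

Lemma box_ball (c : R3 R) (r : R) :
  ball c r = box (c.1.1 - r, c.1.2 - r, c.2 - r) (c.1.1 + r, c.1.2 + r, c.2 + r).
Proof. by rewrite /box /= -!ball_itv. Qed.

Definition rat_center (q : rat * rat * rat) : R3 R := (ratr q.1.1, ratr q.1.2, ratr q.2).

Lemma rat_ball (U : set (R3 R)) (x : R3 R) : open U -> U x ->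
  exists i : (rat * rat * rat) * nat,
    ball (rat_center i.1) (i.2.+1%:R^-1) x /\
    ball (rat_center i.1) (2 * i.2.+1%:R^-1) `<=` U.
Proof.
move=> oU Ux; have /nbhs_ballP[e /= e0 eU] : nbhs x U by exact: open_nbhs_nbhs.
(* Radius 1/(n+1) around a rational point within 1/(n+1) of x, so the doubled
   ball lies within 3/(n+1) of x. *)
have [n ne] : exists n : nat, 3 * n.+1%:R^-1 < e.
  exists (Num.truncn (3 / e)); rewrite ltr_pdivrMr// mulrC -ltr_pdivrMr//.
  by rewrite truncnS_gt.
set r := n.+1%:R^-1 in ne; have r0 : 0 < r by rewrite invr_gt0.
have app (y : R) : exists q : rat, `|ratr q - y| < r.
  have yr : y - r < y + r by lra.
  have [q] := rat_in_itvoo yr; rewrite in_itv /= => /andP[h1 h2].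
  by exists q; rewrite ltr_norml; apply/andP; split; lra.
have [q1 h1] := app x.1.1; have [q2 h2] := app x.1.2; have [q3 h3] := app x.2.
exists ((q1, q2, q3), n); split; first by split; [split|].
move=> y [[/= y1 y2] y3]; apply: eU; rewrite /ball /= in y1 y2 y3.
have tri (a b c : R) : `|b - a| < r -> `|b - c| < 2 * r -> `|a - c| < e.
  rewrite !ltr_norml => /andP[? ?] /andP[? ?]; apply/andP; split; lra.
split; [split|]; rewrite /ball /=; [exact: tri h1 y1|exact: tri h2 y2|exact: tri h3 y3].
Qed.

(** Measurable sets of the product are generated by rectangles, so an open set
    is written as a countable union of rational balls, which are boxes for the
    sup norm. *)
Lemma open_measurable3 (U : set (R3 R)) : open U -> measurable U.
Proof.
move=> oU.
pose F (i : (rat * rat * rat) * nat) : set (R3 R) :=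
  if pselect (ball (rat_center i.1) (2 * i.2.+1%:R^-1) `<=` U)
  then ball (rat_center i.1) (i.2.+1%:R^-1) else set0.
have -> : U = \bigcup_i F i.
  rewrite eqEsubset; split=> [x Ux|x [i _]].
    have [i [xi iU]] := rat_ball oU Ux.
    by exists i => //; rewrite /F; case: pselect.
  rewrite /F; case: pselect => //= iU xi; apply: iU.
  by apply: le_ball xi; rewrite ler_peMl// ler1n.
apply: countable_bigcupT_measurable; first exact: countableP.
by move=> i; rewrite /F; case: (pselect _) => [?|?] //=; rewrite box_ball; exact: measurable_box.
Qed.

Lemma continuous_measurable3 (f : R3 R -> R) : continuous f -> measurable_fun setT f.
Proof.
move=> /continuousP cf.
apply: (measurability _ (RGenOpens.measurableE R)) => _ [_ [a [b ->] <-]].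
rewrite setTI; apply: open_measurable3; apply: cf; exact: itv_open.
Qed.

(** Stated as a generation by one family, closed under intersection, as
    Dynkin's lemma requires. *)
Lemma measurable3_boxes :
  measurable = <<s [set A : set (R3 R) | exists a b, A = box a b] >>.
Proof.
set G := [set A | _].
rewrite eqEsubset; split; last first.
  apply: smallest_sub; first exact: sigma_algebra_measurable.
  by move=> _ [a [b ->]]; exact: measurable_box.
have cov (x y : R) : exists n : nat, (x \in `](- n%:R), n%:R[) /\ (y \in `](- n%:R), n%:R[).
  exists (Num.truncn (`|x| + `|y|)).+1; rewrite !in_itv /= -!ltr_norml.
  have h := truncnS_gt (`|x| + `|y|).
  by split; apply: le_lt_trans h; rewrite ?lerDl ?lerDr.
have sigU (F : nat -> set (R3 R)) : (forall n, G (F n)) -> <<s G >> (\bigcup_n F n).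
  by move=> GF; apply: sigma_algebra_bigcup => n; apply: sub_sigma_algebra.
have m1 : measurable_fun setT (fun x : g_sigma_algebraType G => x.1.1 : R).
  apply: (measurability _ (RGenOpens.measurableE R)) => _ [_ [a [b ->] <-]].
  rewrite setTI.
  rewrite (_ : _ @^-1` _ = \bigcup_n box (a, - n%:R, - n%:R) (b, n%:R, n%:R)).
    by apply: sigU => n; exists (a, - n%:R, - n%:R), (b, n%:R, n%:R).
  rewrite eqEsubset; split=> [x xab|x [n _] [[? _] _] //].
  by have [n [h1 h2]] := cov x.1.2 x.2; exists n.
have m2 : measurable_fun setT (fun x : g_sigma_algebraType G => x.1.2 : R).
  apply: (measurability _ (RGenOpens.measurableE R)) => _ [_ [a [b ->] <-]].
  rewrite setTI.
  rewrite (_ : _ @^-1` _ = \bigcup_n box (- n%:R, a, - n%:R) (n%:R, b, n%:R)).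
    by apply: sigU => n; exists (- n%:R, a, - n%:R), (n%:R, b, n%:R).
  rewrite eqEsubset; split=> [x xab|x [n _] [[_ ?] _] //].
  by have [n [h1 h2]] := cov x.1.1 x.2; exists n.
have m3 : measurable_fun setT (fun x : g_sigma_algebraType G => x.2 : R).
  apply: (measurability _ (RGenOpens.measurableE R)) => _ [_ [a [b ->] <-]].
  rewrite setTI.
  rewrite (_ : _ @^-1` _ = \bigcup_n box (- n%:R, - n%:R, a) (n%:R, n%:R, b)).
    by apply: sigU => n; exists (- n%:R, - n%:R, a), (n%:R, n%:R, b).
  rewrite eqEsubset; split=> [x xab|x [n _] [[_ _] ?] //].
  by have [n [h1 h2]] := cov x.1.1 x.1.2; exists n.
have mid : measurable_fun setT (fun x : g_sigma_algebraType G => x : R3 R).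
  apply/measurable_fun_pairP; split => //.
  by apply/measurable_fun_pairP; split.
move=> A mA; have := mid measurableT _ mA.
by rewrite setTI.
Qed.

Lemma box_setI a b a' b' : box a b `&` box a' b' =
  box (Num.max a.1.1 a'.1.1, Num.max a.1.2 a'.1.2, Num.max a.2 a'.2)
      (Num.min b.1.1 b'.1.1, Num.min b.1.2 b'.1.2, Num.min b.2 b'.2).
Proof.
rewrite eqEsubset; split => x.
  move=> [[[/= + +] +] [[/= + +] +]]; rewrite !in_itv /=.
  move=> /andP[h1 h2] /andP[h3 h4] /andP[h5 h6] /andP[h7 h8] /andP[h9 h10] /andP[h11 h12].
  by split; [split|] => /=; rewrite in_itv /= gt_max lt_min; apply/andP; split; apply/andP.
move=> [[/=]]; rewrite !in_itv /= !gt_max !lt_min.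
move=> /andP[/andP[? ?] /andP[? ?]] /andP[/andP[? ?] /andP[? ?]] /andP[/andP[? ?] /andP[? ?]].
by split; (split; [split|]) => /=; rewrite in_itv /=; apply/andP.
Qed.

(** Testing with products of bumps converging to the indicator of a box shows
    that d integrates to zero over every box inside Omega, hence by Dynkin's
    lemma over every measurable part of such a box, so d vanishes almost
    everywhere there; countably many of these boxes cover Omega. *)
Lemma fundamental_lemma (Omega : set (R3 R)) (d : R3 R -> R) : open Omega ->
  loc_integrable Omega d ->
  (forall phi, test_function Omega phi -> \int[mu]_(x in Omega) (d x * phi x) = 0) ->
  {ae mu, forall x, Omega x -> d x = 0}.
Proof.
move=> oO [md id] H.
have boxint c e : cbox c e `<=` Omega -> (\int[mu]_(x in box c e) (d x)%:E = 0)%E.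
  move=> ceO.
  have mce := measurable_cbox c e; have mbe := measurable_box c e.
  have ic : mu.-integrable (cbox c e) (EFin \o d) by apply: id => //; exact: compact_cbox.
  pose phi k (x : R3 R) : R := (bump c.1.1 e.1.1 k x.1.1 * bump c.1.2 e.1.2 k x.1.2) * bump c.2 e.2 k x.2.
  have tphi k : test_function (cbox c e) (phi k).
    apply: (@test_function_tensor _ _ _ _ _ (fun z => bump c.1.1 e.1.1 k z.1 * bump c.1.2 e.1.2 k z.2)).
      by apply: test_function_tensor; exact: test_function_bump.
    exact: test_function_bump.
  have tphiO k : test_function Omega (phi k).
    by have [? ? s] := tphi k; split => //; exact: subset_trans ceO.
  pose ind (x : R3 R) : R := ((x.1.1 \in `]c.1.1, e.1.1[)%:R * (x.1.2 \in `]c.1.2, e.1.2[)%:R) * (x.2 \in `]c.2, e.2[)%:R.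
  have ind1 x : box c e x -> ind x = 1.
    by move=> [[h1 h2] h3]; rewrite /ind; rewrite /= in h1 h2 h3; rewrite h1 h2 h3 !mulr1.
  have ind0 x : ~ box c e x -> ind x = 0.
    rewrite /box /= => /not_andP[/not_andP[]|] /negP/negbTE h; by rewrite /ind h ?mul0r ?mulr0 ?mul0r.
  have mdc : measurable_fun (cbox c e) d by apply: measurable_funS md => //; exact: open_measurable3.
  have mphi k : measurable_fun (cbox c e) (phi k).
    apply: measurable_funTS; apply: continuous_measurable3; apply: smooth_continuous.
    by case: (tphi k).
  have mind : measurable_fun (cbox c e) ind.
    apply: (measurable_fun_cvg mphi) => x _.
    by apply: cvgM; [apply: cvgM|]; exact: bump_cvg.
  have phik x k : 0 <= phi k x <= 1.
    by apply/andP; split; [apply: mulr_ge0; first apply: mulr_ge0|apply: mulr_ile1; last 2 first; [apply: mulr_ile1| |apply: mulr_ge0|]]; rewrite ?bump_ge0 ?bump_le1.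
  (* The products of bumps are at most 1 and converge to the indicator of the
     box. *)
  have [] := @dominated_convergence _ _ _ mu _ mce (fun k x => (d x * phi k x)%:E)
     (fun x => (d x * ind x)%:E) (fun x => `|(d x)%:E|%E).
  - by move=> k; exact: ((measurable_EFinP _ _).2 (measurable_funM mdc (mphi k))).
  - exact: ((measurable_EFinP _ _).2 (measurable_funM mdc mind)).
  - apply: aeW => x _; apply: cvg_EFin; first by near=> k.
    apply: cvgM; first exact: cvg_cst.
    by apply: cvgM; [apply: cvgM|]; exact: bump_cvg.
  - exact: integrable_abse.
  - apply: aeW => x k _; rewrite abse_EFin lee_fin normrM.
    by have /andP[p0 p1] := phik x k; rewrite ler_piMr// ger0_norm.
  move=> _ _; rewrite (_ : (fun k => _) = fun=> 0%E); last first.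
    apply/funext => k; have := H _ (tphiO k).
    rewrite (@Rintegral_support _ _ _ mu _ (cbox c e)) //.
      rewrite /Rintegral => h; rewrite -[LHS]fineK ?h//.
      apply: integrable_fin_num => //; apply: le_integrable (integrable_abse ic) => //.
        exact: ((measurable_EFinP _ _).2 (measurable_funM mdc (mphi k))).
      move=> x _; rewrite !abse_EFin /= normr_id lee_fin normrM.
      by have /andP[p0 p1] := phik x k; rewrite ler_piMr// ger0_norm.
    move=> x _ nx; have [_ _ s] := tphi k.
    by rewrite [phi k x]tsupport_out ?mulr0// => /s.
  move=> /(cvg_lim (@ereal_hausdorff R)); rewrite lim_cst// => /esym h.
  have h' : (\int[mu]_(x in cbox c e) (d x * ind x)%:E = 0)%E by [].
  rewrite -[RHS]h' integral_mkcond [RHS]integral_mkcond; apply: eq_integral => x _.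
  rewrite /patch; case: ifPn => xb.
    by rewrite (mem_set (box_cbox (set_mem xb))) ind1 ?mulr1//; exact: set_mem.
  by case: ifP => // _; rewrite ind0 ?mulr0//; move: xb; rewrite notin_setE.
have main (a b : R3 R) : cbox a b `<=` Omega -> mu.-negligible (box a b `&` [set x | d x != 0]).
  move=> abO.
  have ic : mu.-integrable (cbox a b) (EFin \o d) by apply: id => //; exact: compact_cbox.
  have ib : mu.-integrable (box a b) (EFin \o d).
    by apply: integrableS ic; [exact: measurable_cbox|exact: measurable_box|exact: box_cbox].
  have box0 (a' b' : R3 R) : (\int[mu]_(x in box a b `&` box a' b') (d x)%:E = 0)%E.
    rewrite box_setI; apply: boxint; apply: subset_trans abO.
    move=> x [[/=]]; rewrite !in_itv /= !ge_max !le_min.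
    move=> /andP[/andP[? _] /andP[? _]] /andP[/andP[? _] /andP[? _]] /andP[/andP[? _] /andP[? _]].
    by split; [split|] => /=; rewrite in_itv /=; apply/andP.
  have all0 A : measurable A -> (\int[mu]_(x in box a b `&` A) (d x)%:E = 0)%E.
    move=> mA.
    (* Boxes form a pi-system generating the Borel sets. *)
    apply: (@dynkin_induction _ _ _ (fun A => (\int[mu]_(x in box a b `&` A) (d x)%:E = 0)%E) measurable3_boxes).
    - move=> _ _ [a1 [b1 ->]] [a2 [b2 ->]]; rewrite box_setI.
      by eexists; eexists; reflexivity.
    - by rewrite setIT; have := box0 a b; rewrite setIid.
    - by move=> _ [a' [b' ->]]; exact: box0.
    - move=> S mS S0.
      have mB := measurable_box a b.
      have := @integral_setU_EFin _ _ _ mu _ _ d (measurableI _ _ mB mS) (measurableI _ _ mB (measurableC mS)).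
      rewrite -setIUr setUv setIT S0 add0e => <-.
      + by have := box0 a b; rewrite setIid.
      + by case/integrableP: ib => /measurable_EFinP.
      + by apply/disj_setPS => x [[_ ?] [_]].
    - move=> F mF tF F0; rewrite setI_bigcupr integral_bigcup.
      + by rewrite eseries0// => n _ _; exact: F0.
      + exact: trivIset_setIl.
      + by move=> n; exact: (measurableI _ _ (measurable_box a b) (mF n)).
      + apply: integrableS ib; [exact: measurable_box| |by move=> x [n _] []].
        by apply: bigcup_measurable => n _; exact: (measurableI _ _ (measurable_box a b) (mF n)).
    - by rewrite -measurable3_boxes.
  have := @integral_ae_eq _ _ _ mu _ (measurable_box a b) (cst 0%E) (EFin \o d) ib.
  move=> /(_ (measurable_cst _)) h; apply: negligibleS (h _).
    move=> x [xb /= /eqP dx] /(_ xb) [].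
    exact: dx.
  move=> E Eab mE; rewrite integral0.
  by have := all0 _ mE; rewrite setIidr.
pose G (i : (rat * rat * rat) * nat) : set (R3 R) :=
  if pselect (ball (rat_center i.1) (2 * i.2.+1%:R^-1) `<=` Omega)
  then ball (rat_center i.1) (i.2.+1%:R^-1) `&` [set x | d x != 0] else set0.
have GP i x : ball (rat_center i.1) (2 * i.2.+1%:R^-1) `<=` Omega ->
    ball (rat_center i.1) (i.2.+1%:R^-1) x -> d x != 0 -> G i x.
  by move=> iO xi dx; rewrite /G; case: (pselect _) => [?|/(_ iO)] //=.
have nG : mu.-negligible (\bigcup_n oapp G set0 (unpickle n)).
  apply: negligible_bigcup => n; case: (unpickle n) => [i|] /=; last exact: negligible_set0.
  rewrite /G; case: (pselect _) => [iO|?] /=; last exact: negligible_set0.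
  rewrite box_ball; apply: main; apply: subset_trans iO.
  have r0 : 0 < i.2.+1%:R^-1 :> R by rewrite invr_gt0.
  move: r0; set r := i.2.+1%:R^-1 => r0; rewrite box_ball => x [[/=]]; rewrite !in_itv /= => /andP[? ?] /andP[? ?] /andP[? ?].
  by split; [split|] => /=; rewrite in_itv /=; apply/andP; split; lra.
apply: negligibleS nG => x /= /not_implyP[Ox /eqP dx].
have [i [xi iO]] := rat_ball oO Ox.
exists (pickle i); first exact: I.
by rewrite pickleK; exact: GP.
Unshelve. all: by end_near. Qed.
End boxes.

(** * Integration by parts and uniqueness of weak derivatives *)

Section parts.
Context {R : realType}.
Local Notation mu := (lebesgue3 R).
Local Notation leb := (@lebesgue_measure R).

Notation T3 := (measurableTypeR R * measurableTypeR R * measurableTypeR R)%type.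

(** The product measure is built on a copy of R with its own Borel
    sigma-algebra; both sigma-algebras on the product are convertible, and this
    lemma and the next one move between them. *)
Lemma meas3 (A : set (R3 R)) : measurable A -> @measurable _ T3 A.
Proof. by []. Qed.

Lemma mfun3 (D : set (R3 R)) (f : R3 R -> R) : measurable_fun D f ->
  @measurable_fun _ _ T3 _ D f.
Proof. by []. Qed.

Definition cube (L : R) : set (R3 R) := cbox (- L, - L, - L) (L, L, L).

Lemma cubeP (L : R) x : cube L x <-> [/\ `|x.1.1| <= L, `|x.1.2| <= L & `|x.2| <= L].
Proof.
rewrite /cube /cbox; split.
  by move=> [[/= + +] +]; rewrite !in_itv /= -!ler_norml.
by move=> [? ? ?]; split; [split|] => /=; rewrite in_itv /= -ler_norml.
Qed.

Lemma bounded_cube (K : set (R3 R)) : bounded_set K -> exists2 L : R, 0 < L & K `<=` cube L.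
Proof.
move=> [M [Mr KM]]; exists (`|M| + 1).
  by rewrite ltr_wpDl.
move=> x Kx; have hM : M < `|M| + 1 by have := ler_norm M; lra.
have := KM _ hM x Kx; rewrite /=.
rewrite prod_normE /= ge_max prod_normE ge_max => /andP[/andP[h1 h2] h3].
exact/cubeP.
Qed.

Lemma test_cube (A : set (R3 R)) phi : test_function A phi ->
  exists2 L : R, 0 < L & forall x, ~ cube L x -> phi x = 0.
Proof.
move=> [_ cphi _]; have [L L0 KL] := bounded_cube (compact_bounded cphi).
exists L => // x nx; apply: tsupport_out; exact: (contra_not (@KL x) nx).
Qed.

Lemma bounded_on_compact (V : topologicalType) (K : set V) (f : V -> R) :
  compact K -> continuous f -> exists M : R, forall x, K x -> `|f x| <= M.
Proof.
move=> cK cf.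
have [M [_ KM]] : bounded_set (f @` K).
  by apply: compact_bounded; apply: continuous_compact => //; exact: continuous_subspaceT.
by exists (M + 1) => x Kx; apply: KM; [rewrite ltrDl|exists x].
Qed.

Lemma integrable_bounded_support d (T : measurableType d) (m : {measure set T -> \bar R})
   (K : set T) (f : T -> R) (M : R) : measurable K -> (m K < +oo)%E ->
  measurable_fun setT f -> (forall x, K x -> `|f x| <= M) ->
  (forall x, ~ K x -> f x = 0) -> m.-integrable setT (EFin \o f).
Proof.
move=> mK fK mf fM f0.
have iK : m.-integrable K (EFin \o f).
  apply: measurable_bounded_integrable => //; first exact: measurable_funTS.
  exists M; split; first exact: num_real.
  by move=> M' MM' x Kx /=; apply: le_trans (fM _ Kx) (ltW MM').
rewrite (_ : EFin \o f = (EFin \o f) \_ K).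
  by apply/(integrable_mkcond _ mK).
apply/funext => x; rewrite /patch /=; case: ifPn => //; rewrite notin_setE => /f0 -> //.
Qed.

Lemma integrable3 (f : R3 R -> R) (L : R) : continuous f ->
  (forall x, ~ cube L x -> f x = 0) -> mu.-integrable setT (EFin \o f).
Proof.
move=> cf f0.
have [M fM] := bounded_on_compact (@compact_cbox R (- L, - L, - L) (L, L, L)) cf.
apply: (@integrable_bounded_support _ _ mu (cube L) f M) => //.
- exact: measurable_cbox.
- exact: cbox_fin.
- exact: continuous_measurable3.
Qed.

Lemma integrable2 (f : R3 R -> R) (L z : R) : continuous f ->
  (forall x, ~ cube L x -> f x = 0) ->
  (leb \x leb)%E.-integrable setT (fun p => (f (p, z))%:E).
Proof.
move=> cf f0.
have [M fM] := bounded_on_compact (@compact_cbox R (- L, - L, - L) (L, L, L)) cf.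
have M0 : 0 <= Num.max M 0 by rewrite le_max lexx orbT.
apply: (@integrable_bounded_support _ _ (leb \x leb)%E (`[- L, L] `*` `[- L, L]) (fun p => f (p, z)) (Num.max M 0)) => //.
- exact: measurableX.
- set X := (X in (X < _)%E).
  have -> : X = (leb `[(- L)%R, L] * leb `[(- L)%R, L])%E by exact: product_measure1E.
  rewrite !lebesgue_measure_itv.
  by case: ifP => _; rewrite ?mule0 ?ltry //= -?EFinD -?EFinM ltry.
- apply: (measurableT_comp (continuous_measurable3 cf)).
  by apply: measurable_fun_pair => //; exact: measurable_cst.
- move=> p pK; have [h|/f0 ->] := pselect (cube L (p, z)); last by rewrite normr0.
  by rewrite le_max fM.
- move=> p np; apply: f0 => -[h _]; exact: np.
Qed.

Lemma sigma_finite_leb2 : sigma_finite setT (leb \x leb)%E.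
Proof.
exists (fun n : nat => `[(- n%:R), n%:R] `*` `[(- n%:R), n%:R]).
  apply/esym; rewrite -subTset => -[x y] _; exists (Num.truncn (`|x| + `|y|)).+1 => //.
  have h := truncnS_gt (`|x| + `|y|).
  by split; rewrite /= in_itv /= -ler_norml; apply/ltW/(le_lt_trans _ h); rewrite ?lerDl ?lerDr.
move=> n; split; first exact: measurableX.
set X := (X in (X < _)%E).
have -> : X = (leb `[(- n%:R)%R, n%:R] * leb `[(- n%:R)%R, n%:R])%E by exact: product_measure1E.
rewrite !lebesgue_measure_itv.
by case: ifP => _; rewrite ?mule0 ?ltry //= -?EFinD -?EFinM ltry.
Qed.

(** A name for the plane Lebesgue measure that carries its sigma-finiteness,
    which Fubini's theorem in space needs. *)
Definition leb2 : set (measurableTypeR R * measurableTypeR R)%type -> \bar R :=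
  (leb \x leb)%E.
HB.instance Definition _ := Measure.copy leb2 (leb \x leb)%E.
HB.instance Definition _ := Measure_isSigmaFinite.Build _ _ _ leb2 sigma_finite_leb2.

Lemma fubini_z (f : R3 R -> R) : mu.-integrable setT (EFin \o f) ->
  (\int[mu]_x (f x)%:E = \int[leb]_z \int[leb \x leb]_p (f (p, z))%:E)%E.
Proof. by move=> fi; have /esym := @integral21_prod_meas1 _ _ _ _ R leb2 leb _ fi; apply. Qed.

Lemma fubini_xy (f : R3 R -> R) : mu.-integrable setT (EFin \o f) ->
  (\int[mu]_x (f x)%:E = \int[leb \x leb]_p \int[leb]_z (f (p, z))%:E)%E.
Proof. by move=> fi; have /esym := @integral12_prod_meas1 _ _ _ _ R leb2 leb _ fi; apply. Qed.

Lemma fubini_x (f : R * R -> R) : (leb \x leb)%E.-integrable setT (EFin \o f) ->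
  (\int[leb \x leb]_p (f p)%:E = \int[leb]_x \int[leb]_y (f (x, y))%:E)%E.
Proof. by move=> fi; have /esym := @integral12_prod_meas1 _ _ _ _ R leb leb _ fi; apply. Qed.

Lemma fubini_y (f : R * R -> R) : (leb \x leb)%E.-integrable setT (EFin \o f) ->
  (\int[leb \x leb]_p (f p)%:E = \int[leb]_y \int[leb]_x (f (x, y))%:E)%E.
Proof. by move=> fi; have /esym := @integral21_prod_meas1 _ _ _ _ R leb leb _ fi; apply. Qed.

Lemma line_integral0 (g : R -> R) (L : R) : smooth g -> (forall t, L < `|t| -> g t = 0) ->
  (\int[leb]_t ('D_1 g t)%:E = 0)%E.
Proof.
move=> sg g0; pose M : R := `|L| + 1.
have LM : L < M by rewrite /M; have := ler_norm L; lra.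
have M0 : 0 < M by rewrite /M; have := normr_ge0 L; lra.
have s : tsupport g `<=` `[- L, L].
  apply: tsupport_closed; first exact: itv_closed.
  by move=> t /negP; rewrite in_itv /= -ler_norml -ltNge => /g0.
have Dg0 t : ~ t \in `[- M, M] -> 'D_1 g t = 0.
  move=> tM; apply: derive_out => /s /=; rewrite in_itv /= => /andP[? ?]; apply: tM.
  by rewrite in_itv /=; apply/andP; split; lra.
transitivity (\int[leb]_(t in `[(- M)%R, M]) ('D_1 g t)%:E)%E.
  rewrite [RHS]integral_mkcond; apply: eq_integral => t _; rewrite /patch.
  case: ifPn => //; rewrite notin_setE => tM; by rewrite Dg0.
have cg := smooth_continuous sg.
rewrite (@continuous_FTC2 R ('D_1 g) g).
- by rewrite !g0 ?normrN ?gtr0_norm// -EFinB subrr.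
- lra.
- by apply: continuous_subspaceT; apply/smooth_continuous/smooth_derive.
- split=> [x _||]; first exact: smooth_derivable.
  + exact/cvg_at_right_filter/cg.
  + exact/cvg_at_left_filter/cg.
- by move=> x _; rewrite derive1E.
Qed.

Lemma smooth_slice (phi : R3 R -> R) (i : 'I_3) (p : R3 R) : smooth phi ->
  smooth (fun t : R => phi (t *: basis3 i + p)) /\
  forall t, 'D_1 (fun t : R => phi (t *: basis3 i + p)) t = 'D_(basis3 i) phi (t *: basis3 i + p).
Proof.
move=> sphi; pose L (t : R) := t *: basis3 i + p; pose M (t : R) := t *: basis3 i : R3 R.
have LM (h a b : R) : L (h *: a + b) = h *: M a + L b.
  by rewrite /L /M scalerDl addrA scalerA.
split.
  apply: (@smooth_comp_affine _ _ _ L M phi) => // t.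
  by apply: cvgD; [apply: cvgZl; exact: cvg_id|exact: cvg_cst].
move=> t; rewrite (_ : (fun t => _) = phi \o L)//.
apply: etrans (congr1 (fun g => g t) (derive_comp_affine phi _ LM)) _.
by rewrite /M /= scale1r.
Qed.

Lemma line_x (t : R) (p : R3 R) (i3 : (0 < 3)%N) :
  t *: basis3 (Ordinal i3) + p = (t + p.1.1, p.1.2, p.2).
Proof.
case: p => [[a b] c] /=; rewrite /basis3 /=.
transitivity (t * 1 + a, t * 0 + b, t * 0 + c); first by [].
by rewrite mulr1 mulr0 !add0r.
Qed.

Lemma line_y (t : R) (p : R3 R) (i3 : (1 < 3)%N) :
  t *: basis3 (Ordinal i3) + p = (p.1.1, t + p.1.2, p.2).
Proof.
case: p => [[a b] c] /=; rewrite /basis3 /=.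
transitivity (t * 0 + a, t * 1 + b, t * 0 + c); first by [].
by rewrite mulr1 mulr0 !add0r.
Qed.

Lemma line_z (t : R) (p : R3 R) (i3 : (2 < 3)%N) :
  t *: basis3 (Ordinal i3) + p = (p.1.1, p.1.2, t + p.2).
Proof.
case: p => [[a b] c] /=; rewrite /basis3 /=.
transitivity (t * 0 + a, t * 0 + b, t * 1 + c); first by [].
by rewrite mulr1 mulr0 !add0r.
Qed.

Lemma integral_cst0 d (T : measurableType d) (m : {measure set T -> \bar R}) (f : T -> \bar R) :
  (forall x, f x = 0%E) -> (\int[m]_x f x = 0)%E.
Proof. by move=> /funext ->; exact: integral0. Qed.

Lemma integral_slices0 (g : R3 R -> R) (i : 'I_3) (L : R) : continuous g ->
  (forall x, ~ cube L x -> g x = 0) ->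
  (forall p, (\int[leb]_t (g (t *: basis3 i + p))%:E = 0)%E) ->
  (\int[mu]_x (g x)%:E = 0)%E.
Proof.
move=> cg hg; have ig := integrable3 cg hg.
case: i => -[|[|[|//]]] i3 slice.
- rewrite (fubini_z ig); apply: integral_cst0 => z.
  rewrite (fubini_y (integrable2 z cg hg)).
  apply: integral_cst0 => y; rewrite -[RHS](slice (0, y, z)).
  by apply: eq_integral => x _; rewrite line_x /= addr0.
- rewrite (fubini_z ig); apply: integral_cst0 => z.
  rewrite (fubini_x (integrable2 z cg hg)).
  apply: integral_cst0 => x; rewrite -[RHS](slice (x, 0, z)).
  by apply: eq_integral => y _; rewrite line_y /= addr0.
- rewrite (fubini_xy ig); apply: integral_cst0 => -[x y].
  rewrite -[RHS](slice (x, y, 0)).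
  by apply: eq_integral => z _; rewrite line_z /= addr0.
Qed.

Lemma slice_out (phi : R3 R -> R) (L : R) (i : 'I_3) (p : R3 R) (t : R) :
  (forall x, ~ cube L x -> phi x = 0) -> L + `|p| < `|t| -> phi (t *: basis3 i + p) = 0.
Proof.
move=> hL Lt; apply: hL => /cubeP[]; case: i => -[|[|[|//]]] i3;
  rewrite ?line_x ?line_y ?line_z /= => h1 h2 h3.
- have := ler_normB (t + p.1.1) p.1.1; rewrite addrK; move: Lt; rewrite !prod_normE /=.
  have : `|p.1.1| <= Num.max (Num.max `|p.1.1| `|p.1.2|) `|p.2|; [by rewrite !le_max lexx|lra].
- have := ler_normB (t + p.1.2) p.1.2; rewrite addrK; move: Lt; rewrite !prod_normE /=.
  have : `|p.1.2| <= Num.max (Num.max `|p.1.1| `|p.1.2|) `|p.2|; [by rewrite !le_max lexx orbT|lra].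
- have := ler_normB (t + p.2) p.2; rewrite addrK; move: Lt; rewrite !prod_normE /=.
  have : `|p.2| <= Num.max (Num.max `|p.1.1| `|p.1.2|) `|p.2|; [by rewrite !le_max lexx orbT|lra].
Qed.

(** Integrating first along the i-th axis, each slice contributes the increment
    of a compactly supported function. *)
Lemma integral_derive0 (A : set (R3 R)) phi (i : 'I_3) : test_function A phi ->
  (\int[mu]_x ('D_(basis3 i) phi x)%:E = 0)%E.
Proof.
move=> tphi; have [sphi _ _] := tphi.
have tD := test_function_derive (basis3 i) tphi.
have [L L0 hL] := test_cube tphi; have [L' L'0 hL'] := test_cube tD.
have cD : continuous ('D_(basis3 i) phi) by apply: smooth_continuous; case: tD.
have slice p : (\int[leb]_t ('D_(basis3 i) phi (t *: basis3 i + p))%:E = 0)%E.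
  have [ss Ds] := smooth_slice i p sphi.
  under eq_integral => t _ do rewrite -Ds.
  apply: (@line_integral0 _ (L + `|p|)) => // t Lt.
  exact: slice_out Lt.
exact: (integral_slices0 cD hL' slice).
Qed.

Lemma test_integrable (A : set (R3 R)) phi D : measurable D -> test_function A phi ->
  mu.-integrable D (EFin \o phi).
Proof.
move=> mD tphi; have [L _ hL] := test_cube tphi.
apply: integrableS (integrable3 _ hL) => //.
by apply: smooth_continuous; case: tphi.
Qed.

Lemma test_parts (Omega : set (R3 R)) phi psi (i : 'I_3) : open Omega ->
  test_function Omega phi -> smooth psi ->
  \int[mu]_(x in Omega) (phi x * 'D_(basis3 i) psi x) =
  - \int[mu]_(x in Omega) ('D_(basis3 i) phi x * psi x).
Proof.
move=> oO tphi spsi; have mO := open_measurable3 oO.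
have [sphi _ _] := tphi.
have t1 := test_functionMl tphi spsi.
have t2 : test_function Omega (phi \* 'D_(basis3 i) psi).
  by apply: test_functionMl => //; exact: smooth_derive.
have t3 : test_function Omega ('D_(basis3 i) phi \* psi).
  by apply: test_functionMl => //; exact: test_function_derive.
apply/eqP; rewrite eq_sym eqr_oppLR -addr_eq0; apply/eqP.
rewrite addrC -RintegralD//; [|exact: test_integrable t2|exact: test_integrable t3].
rewrite -[RHS](_ : \int[mu]_(x in setT) 'D_(basis3 i) (phi \* psi) x = 0); last first.
  by rewrite /Rintegral (integral_derive0 i t1).
rewrite (@Rintegral_support _ _ _ mu setT Omega)//.
  apply: eq_Rintegral => x _; rewrite deriveM; [|exact: smooth_derivable|exact: smooth_derivable].
  by rewrite /GRing.scale /= [psi x * _]mulrC.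
move=> x _ nx; apply: derive_out => s; apply: nx.
by have [_ _] := t1; apply.
Qed.

Lemma compact_measurable3 (K : set (R3 R)) : compact K -> measurable K.
Proof.
move=> cK; rewrite -[K]setCK; apply: measurableC; apply: open_measurable3.
by apply: closed_openC; apply: compact_closed => //; exact: norm_hausdorff.
Qed.

Lemma ae_imply (P Q : R3 R -> Prop) : {ae mu, forall x, P x} -> (forall x, P x -> Q x) ->
  {ae mu, forall x, Q x}.
Proof. by move=> aP PQ; apply: negligibleS aP => x /= nQ /PQ. Qed.

Lemma loc_test_integrable (Omega : set (R3 R)) g phi : open Omega ->
  loc_integrable Omega g -> test_function Omega phi ->
  mu.-integrable Omega (fun x => (g x * phi x)%:E).
Proof.
move=> oO [mg ig] [sphi cphi phiO].
have mO := open_measurable3 oO; have mK := compact_measurable3 cphi.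
have [M hM] := bounded_on_compact cphi (smooth_continuous sphi).
have igK := ig _ cphi phiO.
have mphi := continuous_measurable3 (smooth_continuous sphi).
have iK : mu.-integrable (tsupport phi) (fun x => (g x * phi x)%:E).
  have iMK := integrableZl (meas3 mK) M igK.
  apply: (le_integrable (meas3 mK) _ _ iMK).
    apply: ((measurable_EFinP _ _).2 (measurable_funM _ _)); last exact: measurable_funTS.
    by apply: measurable_funS mg.
  move=> x Kx; rewrite /= lee_fin !normrM mulrC ler_wpM2r//.
  by apply: le_trans (hM _ Kx) (ler_norm _).
have {}iK := (integrable_mkcond _ (meas3 mK)).1 iK.
apply/(integrable_mkcond _ (meas3 mO)).
rewrite (_ : _ \_ Omega = (fun x => (g x * phi x)%:E) \_ (tsupport phi))//.
apply/funext => x; rewrite /patch; case: ifPn => xO.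
  case: ifPn => //; rewrite notin_setE => /tsupport_out ->.
  by rewrite mulr0.
by rewrite ifF//; apply/negbTE/negP => /set_mem /phiO /mem_set; exact/negP.
Qed.

Lemma test_loc_integrable (Omega : set (R3 R)) phi : open Omega ->
  test_function Omega phi -> loc_integrable Omega phi.
Proof.
move=> oO tphi; split.
  by apply: measurable_funTS; apply: continuous_measurable3; apply: smooth_continuous; case: tphi.
move=> K cK KO; apply: test_integrable tphi.
exact: compact_measurable3.
Qed.

(** The classical derivative of a test function is a weak one: phi times any
    smooth psi is again compactly supported in Omega, so its derivative has
    zero integral. *)
Lemma test_weak_deriv (Omega : set (R3 R)) phi (i : 'I_3) : open Omega ->
  test_function Omega phi -> is_weak_deriv Omega i phi ('D_(basis3 i) phi).
Proof.
move=> oO tphi; split; [exact: test_loc_integrable| |].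
  by apply: test_loc_integrable => //; exact: test_function_derive.
by move=> psi [spsi _ _]; exact: test_parts.
Qed.

(** The difference of two weak derivatives integrates to zero against all test
    functions. *)
Lemma weak_deriv_unique (Omega : set (R3 R)) (i : 'I_3) f g h : open Omega ->
  is_weak_deriv Omega i f g -> is_weak_deriv Omega i f h ->
  {ae mu, forall x, Omega x -> g x = h x}.
Proof.
move=> oO [_ [mg ig] Hg] [_ [mh ih] Hh].
have mO := open_measurable3 oO.
have lB : loc_integrable Omega (g \- h).
  split; first exact: measurable_funB.
  move=> K cK KO.
  have mK := compact_measurable3 cK.
  rewrite (_ : _ \o _ = (EFin \o g) \- (EFin \o h))%E//.
  by apply: integrableB => //; [exact: ig|exact: ih].
have : {ae mu, forall x, Omega x -> (g \- h) x = 0}.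
  apply: fundamental_lemma => // phi tphi.
  have [igp ihp] : mu.-integrable Omega (EFin \o (g \* phi)) /\ mu.-integrable Omega (EFin \o (h \* phi)).
    by split; exact: loc_test_integrable.
  rewrite (@eq_Rintegral _ _ _ mu _ (fun x => g x * phi x - h x * phi x)); last first.
    by move=> x _; rewrite /= mulrBl.
  rewrite RintegralB// -[X in X - _]opprK -[X in _ - X]opprK -Hg// -Hh//.
  by rewrite subrr.
move=> /ae_imply; apply => x /[apply] /= /eqP; rewrite subr_eq0 => /eqP.
exact.
Qed.
End parts.

(** * Gagliardo and Sobolev inequalities for test functions *)

Section cauchy_schwarz.
Local Open Scope ereal_scope.
Context d (T : measurableType d) (R : realType) (m : {measure set T -> \bar R}).

(** The discriminant argument, phrased over l > 0 so that it applies to the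
    pointwise inequality 2 h l <= l^2 f + g. *)
Lemma quadratic_bound (a b c : R) : (0 <= a)%R -> (0 <= b)%R -> (0 <= c)%R ->
  (forall l : R, 0 < l -> 2 * c * l <= l ^+ 2 * a + b)%R -> (c * c <= a * b)%R.
Proof.
move=> a0 b0 c0 H.
have [->|cn0] := eqVneq c 0%R; first by rewrite mulr0 mulr_ge0.
have {cn0}c0 : (0 < c)%R by rewrite lt_neqAle eq_sym cn0.
have [a00|an0] := eqVneq a 0%R.
  have l0 : (0 < (b + 1) / c)%R by rewrite divr_gt0//; lra.
  have := H _ l0; rewrite a00 mulr0 add0r.
  have -> : (2 * c * ((b + 1) / c) = 2 * (b + 1))%R by field; rewrite gt_eqF.
  lra.
have {an0}a0 : (0 < a)%R by rewrite lt_neqAle eq_sym an0.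
have := H _ (divr_gt0 c0 a0).
have -> : (2 * c * (c / a) = 2 * (c * c / a))%R by field; rewrite gt_eqF.
have -> : ((c / a) ^+ 2 * a = c * c / a)%R by field; rewrite gt_eqF.
move=> h; have : (c * c / a <= b)%R by lra.
by rewrite ler_pdivrMr// [(b * a)%R]mulrC.
Qed.

Lemma integral_ge0_eq0 (f : T -> \bar R) : measurable_fun setT f -> (forall x, 0 <= f x) ->
  \int[m]_x f x = 0 -> {ae m, forall x, f x = 0}.
Proof.
move=> mf f0 If.
have /(ae_eq_integral_abs m measurableT mf) : \int[m]_x `|f x| = 0.
  by rewrite -[RHS]If; apply: eq_integral => x _; rewrite gee0_abs.
by move=> h; apply: filterS h => x; apply.
Qed.

Lemma cauchy_schwarz0 (f g h : T -> \bar R) :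
  measurable_fun setT f -> measurable_fun setT g -> measurable_fun setT h ->
  (forall x, 0 <= f x) -> (forall x, 0 <= g x) -> (forall x, 0 <= h x) ->
  (forall x, h x * h x <= f x * g x) ->
  \int[m]_x g x = 0 -> \int[m]_x h x = 0.
Proof.
move=> mf mg mh f0 g0 h0 H Ig.
have g00 := integral_ge0_eq0 mg g0 Ig.
rewrite -[RHS](integral0 m setT); apply: ae_eq_integral => //.
apply: filterS g00 => x gx _ /=.
have := H x; rewrite gx mule0 => hh.
have : h x * h x == 0 by rewrite eq_le hh mule_ge0.
by rewrite mule_eq0 orbb => /eqP.
Qed.

(** Cauchy-Schwarz for h <= sqrt (f g), stated with h^2 <= f g to avoid square
    roots of extended reals. *)
Lemma cauchy_schwarz (f g h : T -> \bar R) :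
  measurable_fun setT f -> measurable_fun setT g -> measurable_fun setT h ->
  (forall x, 0 <= f x) -> (forall x, 0 <= g x) -> (forall x, 0 <= h x) ->
  (forall x, h x * h x <= f x * g x) ->
  (\int[m]_x h x) * (\int[m]_x h x) <= (\int[m]_x f x) * (\int[m]_x g x).
Proof.
move=> mf mg mh f0 g0 h0 H.
have If0 : 0 <= \int[m]_x f x by exact: integral_ge0.
have Ig0 : 0 <= \int[m]_x g x by exact: integral_ge0.
have Ih0 : 0 <= \int[m]_x h x by exact: integral_ge0.
have [Ig|Ign0] := eqVneq (\int[m]_x g x) 0.
  by rewrite (cauchy_schwarz0 mf mg mh)// mul0e mule_ge0.
have [If|Ifn0] := eqVneq (\int[m]_x f x) 0.
  rewrite (cauchy_schwarz0 mg mf mh)// ?mul0e ?mule_ge0//.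
  by move=> x; rewrite muleC.
have [Ify|Ifoo] := eqVneq (\int[m]_x f x) +oo.
  by rewrite Ify gt0_mulye ?leey// lt_neqAle eq_sym Ign0.
have [Igy|Igoo] := eqVneq (\int[m]_x g x) +oo.
  by rewrite Igy gt0_muley ?leey// lt_neqAle eq_sym Ifn0.
have ff : \int[m]_x f x \is a fin_num by rewrite ge0_fin_numE// lt_neqAle Ifoo leey.
have gf : \int[m]_x g x \is a fin_num by rewrite ge0_fin_numE// lt_neqAle Igoo leey.
have key (l : R) : (0 < l)%R ->
    (2 * l)%:E * \int[m]_x h x <= (l ^+ 2)%:E * \int[m]_x f x + \int[m]_x g x.
  move=> l0; rewrite -!ge0_integralZl//; last 2 first.
  - by rewrite lee_fin sqr_ge0.
  - by rewrite lee_fin mulr_ge0 ?ltW.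
  rewrite -ge0_integralD//; last 2 first.
  - by move=> x _; rewrite mule_ge0// lee_fin sqr_ge0.
  - exact: measurable_funeM.
  apply: ge0_le_integral => //.
  - by move=> x _; rewrite mule_ge0// lee_fin mulr_ge0 ?ltW.
  - exact: measurable_funeM.
  - by apply: emeasurable_funD => //; exact: measurable_funeM.
  move=> x _; have := H x; have := f0 x; have := g0 x; have := h0 x.
  have l2 : (0 < l ^+ 2)%R by rewrite exprn_gt0.
  case: (f x) => [a| |] //; last by move=> _ g00 _ _; rewrite gt0_muley ?lte_fin// addye ?leey// gt_eqF// (lt_le_trans _ g00)// ltNy0.
  case: (g x) => [b| |] //; last by move=> _ _ _ _; rewrite -EFinM addey ?leey.
  case: (h x) => [c| |] //; rewrite -?EFinM -?EFinD !lee_fin => c0 b0 a0 cab.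
  rewrite -ler_sqr ?nnegrE; [|nra|nra].
  rewrite -subr_ge0; apply: (@le_trans _ _ ((l ^+ 2 * a - b) ^+ 2)%R); first exact: sqr_ge0.
  rewrite -subr_ge0.
  have -> : ((l ^+ 2 * a + b) ^+ 2 - (2 * l * c) ^+ 2 - (l ^+ 2 * a - b) ^+ 2 =
    4 * l ^+ 2 * (a * b - c * c))%R by ring.
  by rewrite mulr_ge0 ?subr_ge0// mulr_ge0// ltW.
have hf : \int[m]_x h x \is a fin_num.
  rewrite ge0_fin_numE// ltNge leye_eq; apply/negP => /eqP Ih.
  have := key 1%R ltr01; rewrite Ih gt0_muley; last by rewrite lte_fin mulr1.
  rewrite expr1n mul1e leye_eq => /eqP fg.
  have : \int[m]_x f x + \int[m]_x g x \is a fin_num by rewrite fin_numD ff gf.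
  by rewrite fg.
move: If0 Ig0 Ih0 key; rewrite -(fineK ff) -(fineK gf) -(fineK hf).
rewrite !lee_fin => a0 b0 c0 key; apply: quadratic_bound => // l l0.
by have := key l l0; rewrite -!EFinM -EFinD lee_fin => ?; lra.
Qed.
End cauchy_schwarz.

Section gagliardo.
Context {R : realType}.
Local Notation mu := (lebesgue3 R).
Local Notation leb := (@lebesgue_measure R).
Local Notation T1 := (measurableTypeR R).
Local Notation T3 := (measurableTypeR R * measurableTypeR R * measurableTypeR R)%type.
Local Open Scope ereal_scope.

Lemma tonelli_z (f : T3 -> \bar R) : measurable_fun setT f -> (forall x, 0 <= f x) ->
  \int[mu]_x f x = \int[leb]_z \int[leb \x leb]_p f (p, z).
Proof. by move=> mf f0; have := @fubini_tonelli2 _ _ _ _ R (@leb2 R) leb f mf f0. Qed.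

Lemma tonelli_xy (f : T3 -> \bar R) : measurable_fun setT f -> (forall x, 0 <= f x) ->
  \int[mu]_x f x = \int[leb \x leb]_p \int[leb]_z f (p, z).
Proof. by move=> mf f0; have := @fubini_tonelli1 _ _ _ _ R (@leb2 R) leb f mf f0. Qed.

Lemma tonelli2_x (f : T1 * T1 -> \bar R) : measurable_fun setT f -> (forall x, 0 <= f x) ->
  \int[leb \x leb]_x f x = \int[leb]_x \int[leb]_y f (x, y).
Proof. by move=> mf f0; have := @fubini_tonelli1 _ _ _ _ R leb leb f mf f0. Qed.

Lemma tonelli2_y (f : T1 * T1 -> \bar R) : measurable_fun setT f -> (forall x, 0 <= f x) ->
  \int[leb \x leb]_x f x = \int[leb]_y \int[leb]_x f (x, y).
Proof. by move=> mf f0; have := @fubini_tonelli2 _ _ _ _ R leb leb f mf f0. Qed.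

Lemma prode3 (a : 'I_3 -> \bar R) : \prod_(i < 3) a i =
  a (Ordinal (isT : (0 < 3)%N)) * a (Ordinal (isT : (1 < 3)%N)) * a (Ordinal (isT : (2 < 3)%N)).
Proof.
rewrite !big_ord_recl big_ord0 mule1 muleA.
by congr (a _ * a _ * a _); exact/val_inj.
Qed.

Lemma lee_cube (p x y z : \bar R) : 0 <= p -> p <= x -> p <= y -> p <= z ->
  p * p * p <= x * y * z.
Proof. by move=> p0 px py pz; apply: lee_pmul => //; [exact: mule_ge0|exact: lee_pmul]. Qed.

(** Cauchy-Schwarz is used in x, then in y, then in z; each time the factor
    that does not depend on the variable is kept outside. *)
Lemma loomis_whitney (h : T3 -> \bar R) (f1 f2 f3 : T1 * T1 -> \bar R) :
  measurable_fun setT h -> measurable_fun setT f1 -> measurable_fun setT f2 ->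
  measurable_fun setT f3 ->
  (forall x, 0 <= h x) -> (forall x, 0 <= f1 x) -> (forall x, 0 <= f2 x) -> (forall x, 0 <= f3 x) ->
  (forall x y z, h (x, y, z) * h (x, y, z) <= f1 (y, z) * f2 (x, z) * f3 (x, y)) ->
  (\int[mu]_x h x) * (\int[mu]_x h x) <=
  (\int[leb \x leb]_p f1 p) * (\int[leb \x leb]_p f2 p) * (\int[leb \x leb]_p f3 p).
Proof.
move=> mh m1 m2 m3 h0 f10 f20 f30 H.
have sec1 (f : T1 * T1 -> \bar R) y : measurable_fun setT f -> measurable_fun setT (fun x => f (x, y)).
  by move=> mf; apply: (measurableT_comp mf); exact: measurable_fun_pair.
have mhz z : measurable_fun setT (fun p : T1 * T1 => h (p, z)).
  by apply: (measurableT_comp mh); exact: measurable_fun_pair.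
pose F2 z := \int[leb]_x f2 (x, z).
pose F3 y := \int[leb]_x f3 (x, y).
pose G1 z := \int[leb]_y f1 (y, z).
pose A3 := \int[leb]_y F3 y.
have mF2 : measurable_fun setT F2 by exact: measurable_fun_fubini_tonelli_G.
have mF3 : measurable_fun setT F3 by exact: measurable_fun_fubini_tonelli_G.
have mG1 : measurable_fun setT G1 by exact: measurable_fun_fubini_tonelli_G.
have F20 z : 0 <= F2 z by exact: integral_ge0.
have F30 z : 0 <= F3 z by exact: integral_ge0.
have G10 z : 0 <= G1 z by exact: integral_ge0.
have A30 : 0 <= A3 by exact: integral_ge0.
have stepx y z : (\int[leb]_x h (x, y, z)) * (\int[leb]_x h (x, y, z)) <= (f1 (y, z) * F2 z) * F3 y.
  rewrite [f1 _ * _]muleC -muleA [f1 _ * _]muleC.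
  have -> : F3 y * f1 (y, z) = \int[leb]_x (f3 (x, y) * f1 (y, z)).
    by rewrite ge0_integralZr//; exact: sec1.
  apply: cauchy_schwarz => //.
  - exact: sec1.
  - by apply: emeasurable_funM; [exact: sec1|exact: measurable_cst].
  - exact: (sec1 _ y (mhz z)).
  - by move=> x; rewrite mule_ge0.
  - move=> x; apply: (le_trans (H x y z)).
    by rewrite [f1 _ * f2 _]muleC -muleA [f3 _ * _]muleC.
have mHy z : measurable_fun setT (fun y => \int[leb]_x h (x, y, z)).
  by apply: (@measurable_fun_fubini_tonelli_G _ _ _ _ _ leb (fun p => h (p, z))).
have stepy z : (\int[leb]_y \int[leb]_x h (x, y, z)) * (\int[leb]_y \int[leb]_x h (x, y, z)) <= G1 z * (F2 z * A3).
  rewrite muleA.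
  have -> : G1 z * F2 z = \int[leb]_y (f1 (y, z) * F2 z).
    by rewrite ge0_integralZr//; exact: sec1.
  apply: cauchy_schwarz => //.
  - by apply: emeasurable_funM; [exact: sec1|exact: measurable_cst].
  - by move=> y; rewrite mule_ge0.
  - by move=> y; exact: integral_ge0.
rewrite (tonelli_z mh)//.
have -> : \int[leb]_z \int[leb \x leb]_p h (p, z) = \int[leb]_z \int[leb]_y \int[leb]_x h (x, y, z).
  by apply: eq_integral => z _; rewrite tonelli2_y.
rewrite (tonelli2_y m1)// (tonelli2_y m2)// (tonelli2_y m3)// -/A3 -muleA.
have -> : (\int[leb]_z \int[leb]_x f2 (x, z)) * A3 = \int[leb]_z (F2 z * A3).
  by rewrite ge0_integralZr.
apply: cauchy_schwarz => //.
- by apply: emeasurable_funM => //; exact: measurable_cst.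
- rewrite [X in measurable_fun _ X](_ : _ = fubini_G (@leb2 R) h).
    exact: measurable_fun_fubini_tonelli_G.
  by apply/funext => z; apply: (etrans (esym (tonelli2_y (mhz z) (fun p => h0 _)))).
- by move=> z; rewrite mule_ge0.
- by move=> z; apply: integral_ge0 => y _; exact: integral_ge0.
Qed.

(** g vanishes far to the left, so g t is the integral of its derivative. *)
Lemma line_bound (g : R -> R) (L : R) : smooth g -> (forall t, (L < `|t|)%R -> g t = 0%R) ->
  forall t, (`|g t|)%:E <= \int[leb]_s (`|'D_1 g s|)%:E.
Proof.
move=> sg g0 t.
have cD : continuous ('D_1%R g) by apply/smooth_continuous/smooth_derive.
have cg := smooth_continuous sg.
pose a : R := (- (`|L| + `|t| + 1))%R.
have ta : (a < t)%R by rewrite /a; have := ler_normr t (- t); have := normr_ge0 L;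
  have := ler_norm (- t); rewrite normrN; lra.
have ga : g a = 0%R.
  apply: g0; rewrite /a normrN ger0_norm; have := ler_norm L; have := normr_ge0 t;
  have := normr_ge0 L; lra.
have F := @continuous_FTC2 R ('D_1%R g) g a t ta.
have {}F : \int[leb]_(x in `[a, t]) ('D_1 g x)%:E = (g t)%:E.
  rewrite F ?ga ?sube0//.
  - by apply: continuous_subspaceT.
  - split=> [x _||]; first exact: smooth_derivable.
    + exact/cvg_at_right_filter/cg.
    + exact/cvg_at_left_filter/cg.
  - by move=> x _; rewrite derive1E.
have iD : leb.-integrable `[a, t] (EFin \o 'D_1%R g).
  by apply: cont_itv_integrable => x _; exact: cD.
rewrite -abse_EFin -F; apply: (le_trans (le_abse_integral _ _ _)) => //.
  by case/integrableP: iD.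
apply: ge0_subset_integral => //.
apply/measurable_EFinP; apply: measurableT_comp => //.
exact: continuous_measurable_fun.
Qed.

Lemma slice_bound (A : set (R3 R)) psi (i : 'I_3) (p : R3 R) (t : R) : test_function A psi ->
  (`|psi (t *: basis3 i + p)%R|)%:E <=
  \int[leb]_s (`|'D_(basis3 i) psi (s *: basis3 i + p)%R|)%:E.
Proof.
move=> tpsi; have [spsi _ _] := tpsi.
have [L L0 hL] := test_cube tpsi.
have [ss Ds] := smooth_slice i p spsi.
apply: (le_trans (@line_bound _ (L + `|p|)%R ss _ t)).
  by move=> s Ls; exact: slice_out Ls.
by under eq_integral => s _ do rewrite Ds.
Qed.

(** On each axis |psi| is bounded by the integral of |D_i psi| along the line,
    a function of the two other variables; so |psi|^3, and with it h^2, is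
    bounded by a product to which the Loomis-Whitney inequality applies. *)
Lemma gagliardo_test (A : set (R3 R)) psi (h : R3 R -> R) : test_function A psi ->
  measurable_fun setT h -> (forall x, 0 <= h x)%R -> (forall x, h x * h x <= `|psi x| ^+ 3)%R ->
  (\int[mu]_x (h x)%:E) * (\int[mu]_x (h x)%:E) <=
  \prod_(i < 3) \int[mu]_x (`|'D_(basis3 i) psi x|)%:E.
Proof.
move=> tpsi mh h0 hpsi.
pose F (i : 'I_3) (x : T3) : \bar R := (`|'D_(basis3 i) psi x|)%:E.
have F0 i x : 0 <= F i x by rewrite lee_fin.
have mF i : measurable_fun setT (F i).
  apply/measurable_EFinP; apply: measurableT_comp => //.
  apply: mfun3; apply: continuous_measurable3; apply: smooth_continuous.
  by apply: smooth_derive; case: tpsi.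
pose i0 : 'I_3 := Ordinal (isT : (0 < 3)%N).
pose i1 : 'I_3 := Ordinal (isT : (1 < 3)%N).
pose i2 : 'I_3 := Ordinal (isT : (2 < 3)%N).
pose f1 (p : T1 * T1) := \int[leb]_x F i0 (x, p.1, p.2).
pose f2 (p : T1 * T1) := \int[leb]_x F i1 (p.1, x, p.2).
pose f3 (p : T1 * T1) := \int[leb]_x F i2 (p, x).
have m1 : measurable_fun setT f1.
  apply: (@measurable_fun_fubini_tonelli_G _ _ _ _ _ leb (fun q : T1 * (T1 * T1) => F i0 (q.1, q.2.1, q.2.2))) => //.
  apply: (measurableT_comp (mF i0)); apply: measurable_fun_pair; first apply: measurable_fun_pair => //.
  - exact: (measurableT_comp measurable_fst measurable_snd).
  - exact: (measurableT_comp measurable_snd measurable_snd).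
have m2 : measurable_fun setT f2.
  apply: (@measurable_fun_fubini_tonelli_G _ _ _ _ _ leb (fun q : T1 * (T1 * T1) => F i1 (q.2.1, q.1, q.2.2))) => //.
  apply: (measurableT_comp (mF i1)); apply: measurable_fun_pair; first apply: measurable_fun_pair => //.
  - exact: (measurableT_comp measurable_fst measurable_snd).
  - exact: (measurableT_comp measurable_snd measurable_snd).
have m3 : measurable_fun setT f3.
  exact: (@measurable_fun_fubini_tonelli_F _ _ _ _ _ leb (F i2)).
have pos (f : T1 * T1 -> T1 -> \bar R) : (forall p x, 0 <= f p x) -> forall p, 0 <= \int[leb]_x f p x.
  by move=> f0 p; apply: integral_ge0 => x _.
have LW := @loomis_whitney (fun x => (h x)%:E) f1 f2 f3.
apply: (le_trans (LW _ m1 m2 m3 _ _ _ _ _)).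
- by apply/measurable_EFinP; exact: mfun3.
- by move=> x; rewrite lee_fin.
- exact: pos.
- exact: pos.
- exact: pos.
- move=> x y z.
  have b1 : (`|psi (x, y, z)|)%:E <= f1 (y, z).
    have := @slice_bound _ _ i0 (0, y, z)%R x tpsi; rewrite (line_x _ (0, y, z)%R isT) /= addr0 => /le_trans; apply.
    rewrite le_eqVlt; apply/orP; left; apply/eqP; apply: eq_integral => s _.
    by rewrite (line_x _ (0, y, z)%R isT) /= addr0.
  have b2 : (`|psi (x, y, z)|)%:E <= f2 (x, z).
    have := @slice_bound _ _ i1 (x, 0, z)%R y tpsi; rewrite (line_y _ (x, 0, z)%R isT) /= addr0 => /le_trans; apply.
    rewrite le_eqVlt; apply/orP; left; apply/eqP; apply: eq_integral => s _.
    by rewrite (line_y _ (x, 0, z)%R isT) /= addr0.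
  have b3 : (`|psi (x, y, z)|)%:E <= f3 (x, y).
    have := @slice_bound _ _ i2 (x, y, 0)%R z tpsi; rewrite (line_z _ (x, y, 0)%R isT) /= addr0 => /le_trans; apply.
    rewrite le_eqVlt; apply/orP; left; apply/eqP; apply: eq_integral => s _.
    by rewrite (line_z _ (x, y, 0)%R isT) /= addr0.
  apply: (@le_trans _ _ ((`|psi (x, y, z)|)%:E * (`|psi (x, y, z)|)%:E * (`|psi (x, y, z)|)%:E)).
    by rewrite -!EFinM lee_fin; apply: (le_trans (hpsi _)); rewrite !exprS expr0 mulr1 mulrA.
  by apply: lee_cube => //; rewrite lee_fin.
rewrite prode3.
have e1 : \int[leb \x leb]_p f1 p = \int[mu]_x F i0 x.
  rewrite (tonelli2_y m1); last exact: pos.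
  rewrite (tonelli_z (mF i0))//; apply: eq_integral => z _.
  by rewrite tonelli2_y//; apply: (measurableT_comp (mF i0)); exact: measurable_fun_pair.
have e2 : \int[leb \x leb]_p f2 p = \int[mu]_x F i1 x.
  rewrite (tonelli2_y m2); last exact: pos.
  rewrite (tonelli_z (mF i1))//; apply: eq_integral => z _.
  by rewrite tonelli2_x//; apply: (measurableT_comp (mF i1)); exact: measurable_fun_pair.
have e3 : \int[leb \x leb]_p f3 p = \int[mu]_x F i2 x by rewrite (tonelli_xy (mF i2)).
by rewrite le_eqVlt; apply/orP; left; apply/eqP; congr (_ * _ * _); [exact: e1|exact: e2|exact: e3].
Qed.

(** Gagliardo's inequality for psi = phi^4 and h = phi^6, followed by
    Cauchy-Schwarz on the integrals of 4 |phi|^3 |D_i phi|, gives J^4 <= 16^3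
    J^3 G_1 G_2 G_3, where J is the integral of phi^6 and G_i that of (D_i
    phi)^2. *)
Lemma sobolev_test (A : set (R3 R)) phi : test_function A phi ->
  (\int[mu]_x (phi x ^+ 6) <= 4096 * \prod_(i < 3) \int[mu]_x ('D_(basis3 i) phi x ^+ 2))%R.
Proof.
move=> tphi; have [sphi _ _] := tphi.
have t4 := test_functionX 3 tphi.
have t6 := test_functionX 5 tphi.
pose J : R := (\int[mu]_x (phi x ^+ 6))%R.
pose G i : R := (\int[mu]_x ('D_(basis3 i) phi x ^+ 2))%R.
pose a i : R := (\int[mu]_x (`|'D_(basis3 i) (fun x => phi x ^+ 4) x|))%R.
have tG i := test_functionX 1 (test_function_derive (basis3 i) tphi).
have ta i := test_function_derive (basis3 i) t4.
have EJ : \int[mu]_x (phi x ^+ 6)%:E = J%:E.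
  by rewrite /J /Rintegral fineK//; apply: integrable_fin_num => //; exact: test_integrable t6.
have EG i : \int[mu]_x ('D_(basis3 i) phi x ^+ 2)%:E = (G i)%:E.
  by rewrite /G /Rintegral fineK//; apply: integrable_fin_num => //; exact: test_integrable (tG i).
have Ea i : \int[mu]_x (`|'D_(basis3 i) (fun x => phi x ^+ 4)%R x|)%:E = (a i)%:E.
  rewrite /a /Rintegral fineK//; apply: integrable_fin_num => //.
  by have := integrable_abse (test_integrable measurableT (ta i)).
have J0 : (0 <= J)%R by apply: Rintegral_ge0 => x _; rewrite (exprM _ 3 2) sqr_ge0.
have G0 i : (0 <= G i)%R by apply: Rintegral_ge0 => x _; rewrite sqr_ge0.
have a0 i : (0 <= a i)%R by apply: Rintegral_ge0 => x _.
have H1 : (J * J <= \prod_(i < 3) a i)%R.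
  rewrite -lee_fin EFinM -EJ -prodEFin.
  under [X in _ <= X]eq_bigr => i _ do rewrite -Ea.
  apply: (gagliardo_test t4).
  - by apply: continuous_measurable3; apply: smooth_continuous; case: t6.
  - by move=> x; rewrite (exprM _ 3 2) sqr_ge0.
  - by move=> x; rewrite normrX -exprM -exprD -[(6 + 6)%N]/(4 * 3)%N !(exprM _ 2 6) real_normK// num_real.
have H2 i : (a i * a i <= 16 * J * G i)%R.
  (* The derivative of phi^4 splits as (4 phi^3) * D phi, with squares 16 phi^6
     and (D phi)^2. *)
  have D4 x : 'D_(basis3 i) (fun x => phi x ^+ 4)%R x = (4 * phi x ^+ 3 * 'D_(basis3 i) phi x)%R.
    have := @deriveX _ _ phi 4 x (basis3 i) (@smooth_derivable _ _ _ _ _ sphi).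
    by rewrite exprfctE.
  have CS := @cauchy_schwarz _ T3 R mu (fun x => (16 * phi x ^+ 6)%:E)
    (fun x => ('D_(basis3 i) phi x ^+ 2)%:E) (fun x => (`|'D_(basis3 i) (fun x => phi x ^+ 4)%R x|)%:E).
  have I16 : \int[mu]_x (16 * phi x ^+ 6)%:E = (16 * J)%:E.
    rewrite EFinM -EJ -ge0_integralZl//.
    - apply/measurable_EFinP; apply: mfun3; apply: continuous_measurable3; apply: smooth_continuous; by case: t6.
    - by move=> x _; rewrite lee_fin (exprM _ 3 2) sqr_ge0.
  rewrite -lee_fin (EFinM (a i)) (EFinM (16 * J)) -Ea -EG -I16; apply: CS.
  - apply/measurable_EFinP; apply: mfun3; apply: measurable_funM => //.
    by apply: continuous_measurable3; apply: smooth_continuous; case: t6.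
  - apply/measurable_EFinP; apply: mfun3; apply: continuous_measurable3; apply: smooth_continuous.
    by case: (tG i).
  - apply/measurable_EFinP; apply: measurableT_comp => //; apply: mfun3; apply: continuous_measurable3; apply: smooth_continuous.
    by case: (ta i).
  - by move=> x; rewrite lee_fin mulr_ge0// (exprM _ 3 2) sqr_ge0.
  - by move=> x; rewrite lee_fin sqr_ge0.
  - by move=> x; rewrite lee_fin.
  - move=> x; rewrite -!EFinM lee_fin -normrM ger0_norm -?expr2 ?sqr_ge0// D4 le_eqVlt.
    by apply/orP; left; apply/eqP; ring.
change (J <= 4096 * \prod_(i < 3) G i)%R.
clearbody J G a; clear - J0 G0 a0 H1 H2.
have [J00|Jn0] := eqVneq J 0%R.
  by rewrite J00; apply: (mulr_ge0 (ler0n _ _)); exact: prodr_ge0.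
have {Jn0}J0 : (0 < J)%R by rewrite lt_neqAle eq_sym Jn0.
(* 4096 = 16^3. *)
have H3 : (J ^+ 4 <= (4096 * \prod_(i < 3) G i) * J ^+ 3)%R.
  apply: (@le_trans _ _ (\prod_(i < 3) (a i * a i))%R).
    by rewrite big_split /= -expr2 (exprM _ 2 2) ler_sqr ?nnegrE ?sqr_ge0 ?prodr_ge0.
  apply: (@le_trans _ _ (\prod_(i < 3) (16 * J * G i))%R).
    by apply: ler_prod => i _; rewrite mulr_ge0//=.
  by rewrite !big_ord_recl !big_ord0; rewrite le_eqVlt; apply/orP; left; apply/eqP; ring.
by move: H3; rewrite exprS ler_pM2r ?exprn_gt0.
Qed.
End gagliardo.

(** * Integrals over Omega and the L^2 pairing *)

(** This functional and the forms built on it are sealed: they are only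
    compared by name and argument, never by unfolding integrals. *)
HB.lock Definition integral_over {R : realType} (Omega : set (R3 R)) (f : R3 R -> R) : R :=
  \int[lebesgue3 R]_(x in Omega) f x.

HB.lock Definition inner {R : realType} (Omega : set (R3 R)) (f g : R3 R -> R) : R :=
  integral_over Omega (fun x => f x * g x).

Lemma integral_overE {R : realType} (Omega : set (R3 R)) f :
  integral_over Omega f = \int[lebesgue3 R]_(x in Omega) f x.
Proof. by rewrite integral_over.unlock. Qed.

Lemma innerE {R : realType} (Omega : set (R3 R)) f g :
  inner Omega f g = integral_over Omega (fun x => f x * g x).
Proof. by rewrite inner.unlock. Qed.

Section hilbert.
Context {R : realType} (Omega : set (R3 R)).
Local Notation mu := (lebesgue3 R).
Local Notation T3 := (measurableTypeR R * measurableTypeR R * measurableTypeR R)%type.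
Hypothesis mO : measurable Omega.
Implicit Types f g h w : R3 R -> R.

Definition integrable_on f := mu.-integrable Omega (fun x => (f x)%:E).
Local Notation I := (integral_over Omega).
Local Notation ip := (inner Omega).

Lemma measurable_Omega3 : @measurable _ T3 Omega. Proof. exact: meas3. Qed.

Lemma dominated_integrable_on f g : measurable_fun Omega f -> (forall x, Omega x -> `|f x| <= g x) ->
  integrable_on g -> integrable_on f.
Proof.
move=> mf fg ig; apply: (le_integrable measurable_Omega3 _ _ ig).
  exact: ((measurable_EFinP _ _).2 (mfun3 mf)).
by move=> x Ox; rewrite /= lee_fin (le_trans (fg _ Ox))// ler_norm.
Qed.

Lemma eq_integrable_on f g : (forall x, Omega x -> f x = g x) -> integrable_on f -> integrable_on g.
Proof.
move=> fg; apply: (eq_integrable measurable_Omega3) => x /set_mem Ox /=.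
by rewrite fg.
Qed.

Lemma integrable_onD f g : integrable_on f -> integrable_on g -> integrable_on (fun x => f x + g x).
Proof.
move=> fi gi; have := integrableD measurable_Omega3 fi gi.
by apply: (eq_integrable measurable_Omega3) => x _; rewrite /= EFinD.
Qed.

Lemma integrable_onZ (c : R) f : integrable_on f -> integrable_on (fun x => c * f x).
Proof.
move=> fi; have := integrableZl measurable_Omega3 c fi.
by apply: (eq_integrable measurable_Omega3) => x _; rewrite /= EFinM.
Qed.

Lemma integrable_onN f : integrable_on f -> integrable_on (fun x => - f x).
Proof. by move=> /(integrable_onZ (-1)); apply: eq_integrable_on => x _; rewrite mulN1r. Qed.

Lemma integrable_onB f g : integrable_on f -> integrable_on g -> integrable_on (fun x => f x - g x).
Proof. by move=> fi /integrable_onN; exact: integrable_onD. Qed.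

Lemma eq_integral_over f g : (forall x, Omega x -> f x = g x) -> I f = I g.
Proof. by move=> fg; rewrite !integral_overE; apply: eq_Rintegral => x /set_mem; exact: fg. Qed.

Lemma integral_overD f g : integrable_on f -> integrable_on g -> I (fun x => f x + g x) = I f + I g.
Proof. rewrite !integral_overE; exact: RintegralD measurable_Omega3. Qed.

Lemma integral_overZ (c : R) f : integrable_on f -> I (fun x => c * f x) = c * I f.
Proof. rewrite !integral_overE; exact: RintegralZl measurable_Omega3. Qed.

Lemma integral_overN f : integrable_on f -> I (fun x => - f x) = - I f.
Proof. by move=> fi; rewrite -mulN1r -integral_overZ//; apply: eq_integral_over => x _; rewrite mulN1r. Qed.

Lemma integral_overB f g : integrable_on f -> integrable_on g -> I (fun x => f x - g x) = I f - I g.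
Proof. by move=> fi gi; rewrite integral_overD ?integral_overN//; exact: integrable_onN. Qed.

Lemma le_integral_over f g : integrable_on f -> integrable_on g -> (forall x, Omega x -> f x <= g x) -> I f <= I g.
Proof. rewrite !integral_overE; exact: le_Rintegral measurable_Omega3. Qed.

Lemma integral_over_ge0 f : (forall x, Omega x -> 0 <= f x) -> 0 <= I f.
Proof. by move=> f0; rewrite integral_overE; apply: Rintegral_ge0. Qed.

Lemma norm_integral_over_le f g : integrable_on f -> integrable_on g -> (forall x, Omega x -> `|f x| <= g x) -> `|I f| <= I g.
Proof.
move=> fi gi fg; rewrite ler_norml -integral_overN//; apply/andP; split; apply: le_integral_over => //.
- by rewrite -/(integrable_on _); exact: integrable_onN.
- by move=> x /fg; rewrite ler_norml => /andP[].
- by move=> x /fg; rewrite ler_norml => /andP[].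
Qed.

Lemma ae_eq_integral_over f g : integrable_on f -> integrable_on g -> {ae mu, forall x, Omega x -> f x = g x} -> I f = I g.
Proof.
move=> fi gi fg; rewrite !integral_overE /Rintegral; congr fine.
apply: (@ae_eq_integral _ T3 R mu Omega _ _ measurable_Omega3).
- by case/integrableP: fi.
- by case/integrableP: gi.
- by move: fg => /ae_imply; apply => x H /H ->.
Qed.

Lemma ae_integrable_on f g : measurable_fun Omega g -> {ae mu, forall x, Omega x -> f x = g x} ->
  integrable_on f -> integrable_on g.
Proof.
move=> mg fg /integrableP[mf fi]; apply/integrableP; split.
  exact: ((measurable_EFinP _ _).2 (mfun3 mg)).
rewrite (_ : (\int[_]_(_ in _) _)%E = (\int[mu]_(x in Omega) `|(f x)%:E|)%E)//.
apply: (@ae_eq_integral _ T3 R mu Omega _ _ measurable_Omega3).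
- by apply: measurableT_comp => //; exact: ((measurable_EFinP _ _).2 (mfun3 mg)).
- exact: measurableT_comp.
- by move: fg => /ae_imply; apply => x H /H ->.
Qed.

Definition sq_integrable f := measurable_fun Omega f /\ integrable_on (fun x => f x ^+ 2).
Definition p6_integrable f := measurable_fun Omega f /\ integrable_on (fun x => f x ^+ 6).

Lemma sq_integrableM f g : sq_integrable f -> sq_integrable g -> integrable_on (fun x => f x * g x).
Proof.
move=> [mf if2] [mg ig2]; apply: dominated_integrable_on (integrable_onD if2 ig2); first exact: measurable_funM.
move=> x _; rewrite normrM -[f x ^+ 2]real_normK ?num_real// -[g x ^+ 2]real_normK ?num_real//.
have := sqr_ge0 (`|f x| - `|g x|); have := normr_ge0 (f x); have := normr_ge0 (g x); nra.
Qed.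

Lemma sq_integrableZ (c : R) f : sq_integrable f -> sq_integrable (fun x => c * f x).
Proof.
move=> [mf if2]; split; first by apply: measurable_funM => //; exact: measurable_cst.
by apply: eq_integrable_on (integrable_onZ (c ^+ 2) if2) => x _; rewrite exprMn.
Qed.

Lemma sq_integrableD f g : sq_integrable f -> sq_integrable g -> sq_integrable (fun x => f x + g x).
Proof.
move=> Lf Lg; split; first by apply: measurable_funD; [case: Lf|case: Lg].
apply: eq_integrable_on (integrable_onD (integrable_onD Lf.2 Lg.2) (integrable_onZ 2 (sq_integrableM Lf Lg))) => x _; ring.
Qed.

Lemma ae_sq_integrable f g : measurable_fun Omega g -> {ae mu, forall x, Omega x -> f x = g x} -> sq_integrable f -> sq_integrable g.
Proof.
move=> mg fg [mf if2]; split=> //.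
apply: (ae_integrable_on _ _ if2).
  by apply: measurable_funX.
by move: fg => /ae_imply; apply => x H /H ->.
Qed.

(** Weak derivatives are only known almost everywhere; this makes the choice of
    representative harmless. *)
Lemma ae_inner f f' g g' : sq_integrable f -> sq_integrable f' -> sq_integrable g -> sq_integrable g' ->
  {ae mu, forall x, Omega x -> f x = f' x} -> {ae mu, forall x, Omega x -> g x = g' x} ->
  ip f g = ip f' g'.
Proof.
move=> Lf Lf' Lg Lg' ff' gg'; transitivity (ip f' g).
  by rewrite !innerE; apply: ae_eq_integral_over; [exact: sq_integrableM|exact: sq_integrableM|move: ff' => /ae_imply; apply => x H /H ->].
by rewrite !innerE; apply: ae_eq_integral_over; [exact: sq_integrableM|exact: sq_integrableM|move: gg' => /ae_imply; apply => x H /H ->].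
Qed.

Lemma innerC f g : ip f g = ip g f.
Proof. by rewrite !innerE; apply: eq_integral_over => x _; rewrite mulrC. Qed.

Lemma innerDl f g h : sq_integrable f -> sq_integrable g -> sq_integrable h -> ip (fun x => f x + g x) h = ip f h + ip g h.
Proof.
move=> Lf Lg Lh; rewrite !innerE -integral_overD; [|exact: sq_integrableM|exact: sq_integrableM].
by apply: eq_integral_over => x _; rewrite mulrDl.
Qed.

Lemma innerZl (c : R) f h : sq_integrable f -> sq_integrable h -> ip (fun x => c * f x) h = c * ip f h.
Proof.
move=> Lf Lh; rewrite !innerE -integral_overZ; last exact: sq_integrableM.
by apply: eq_integral_over => x _; rewrite mulrA.
Qed.

Lemma inner_ge0 f : 0 <= ip f f.
Proof. by rewrite innerE; apply: integral_over_ge0 => x _; rewrite -expr2 sqr_ge0. Qed.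

(** Weighted arithmetic-geometric means; with a free weight d this replaces
    Cauchy-Schwarz throughout. *)
Lemma inner_young f g (d : R) : 0 < d -> sq_integrable f -> sq_integrable g ->
  `|ip f g| <= d^-1 * ip f f + d * ip g g.
Proof.
move=> d0 Lf Lg; rewrite !innerE -(integral_overZ d^-1 (sq_integrableM Lf Lf)) -(integral_overZ d (sq_integrableM Lg Lg)).
have h1 := integrable_onZ d^-1 (sq_integrableM Lf Lf); have h2 := integrable_onZ d (sq_integrableM Lg Lg).
rewrite -integral_overD//; apply: norm_integral_over_le; [exact: sq_integrableM|exact: integrable_onD|] => x _.
rewrite normrM -!expr2 -[f x ^+ 2]real_normK ?num_real// -[g x ^+ 2]real_normK ?num_real//.
set a := `|f x|; set b := `|g x|; have a0 : 0 <= a := normr_ge0 _; have b0 : 0 <= b := normr_ge0 _.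
rewrite -(ler_pM2l d0) mulrDr [d * (d^-1 * _)]mulrA mulfV ?gt_eqF// mul1r.
have := sqr_ge0 (a - d * b); have : 0 <= d * (a * b) by rewrite !mulr_ge0// ltW.
nra.
Qed.

Lemma integrable_on_cst (c : R) : (mu Omega < +oo)%E -> integrable_on (fun=> c).
Proof.
move=> fO; apply: (@measurable_bounded_integrable _ T3 R mu (fun=> c) Omega measurable_Omega3 fO).
  exact: measurable_cst.
exists `|c|; split; first exact: num_real.
by move=> M cM x _ /=; exact: ltW.
Qed.

Lemma test_sq_integrable phi : test_function Omega phi -> sq_integrable phi.
Proof.
move=> tphi; have t2 := test_functionX 1 tphi.
split; last exact: test_integrable t2.
apply: measurable_funTS; apply: continuous_measurable3; apply: smooth_continuous; by case: tphi.
Qed.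

Lemma test_p6_integrable phi : test_function Omega phi -> p6_integrable phi.
Proof.
move=> tphi; have t2 := test_functionX 5 tphi.
split; last exact: test_integrable t2.
apply: measurable_funTS; apply: continuous_measurable3; apply: smooth_continuous; by case: tphi.
Qed.

Lemma Lnorm_pow (n : nat) f : (0 < n)%N -> measurable_fun Omega f ->
  ((eLpnorm Omega n%:R f) `^ n%:R = \int[mu]_(x in Omega) (`|f x| ^+ n)%:E)%E.
Proof.
move=> n0 mf; rewrite /eLpnorm poweR_Lnorm ?pnatr_eq0 -?lt0n//.
rewrite [RHS]integral_mkcond; apply: eq_integral => x _ /=.
rewrite /patch; case: ifPn => xO /=.
  by rewrite powR_mulrn.
by rewrite normr0 powR0// pnatr_eq0 -lt0n.
Qed.

Lemma Lp_integ (n : nat) f : (0 < n)%N -> Lp Omega n%:R f ->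
  measurable_fun Omega f /\ integrable_on (fun x => `|f x| ^+ n).
Proof.
move=> n0; rewrite /Lp /= inE => /andP[]; rewrite !inE => /= mf ff.
have {}mf : measurable_fun Omega f by apply/(measurable_restrictT _ _).2.
split => //; apply/integrableP; split.
  by apply: ((measurable_EFinP _ _).2 (mfun3 _)); apply: measurable_funX; exact: measurableT_comp.
under eq_integral => x _ do rewrite gee0_abs ?lee_fin ?exprn_ge0//.
rewrite -Lnorm_pow//; apply: poweR_lty.
exact: ff.
Qed.

Lemma Lpnorm_pow (n : nat) f : (0 < n)%N -> measurable_fun Omega f ->
  integrable_on (fun x => `|f x| ^+ n) -> Lpnorm Omega n%:R f ^+ n = I (fun x => `|f x| ^+ n).
Proof.
move=> n0 mf fi; have := Lnorm_pow n0 mf.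
rewrite /Lpnorm integral_overE /Rintegral => <-.
have N0 : (0 <= eLpnorm Omega n%:R f)%E by exact: Lnorm_ge0.
have : (eLpnorm Omega n%:R f `^ n%:R < +oo)%E.
  by rewrite Lnorm_pow// -ge0_fin_numE ?integral_ge0//; exact: (integrable_fin_num measurable_Omega3 fi).
case: (eLpnorm Omega n%:R f) N0 => [r| |] //= r0; first by move=> _; rewrite powR_mulrn.
by rewrite gt_eqF ?ltr0n//= ltxx.
Qed.

Lemma Lp_sq_integrable f : Lp Omega 2 f -> sq_integrable f.
Proof.
move=> /(@Lp_integ 2 _ isT)[mf fi]; split=> //; apply: eq_integrable_on fi => x _.
by rewrite real_normK ?num_real.
Qed.

Lemma Lpnorm2 f : sq_integrable f -> Lpnorm Omega 2 f ^+ 2 = ip f f.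
Proof.
move=> [mf fi]; rewrite (@Lpnorm_pow 2)//; last first.
  by apply: eq_integrable_on fi => x _; rewrite real_normK ?num_real.
by rewrite innerE; apply: eq_integral_over => x _; rewrite real_normK ?num_real.
Qed.

Lemma Lpnorm6 f : p6_integrable f -> Lpnorm Omega 6 f ^+ 6 = I (fun x => f x ^+ 6).
Proof.
move=> [mf fi]; have e x : `|f x| ^+ 6 = f x ^+ 6.
  by rewrite -normrX ger0_norm// (exprM _ 3 2) sqr_ge0.
rewrite (@Lpnorm_pow 6)//; last by apply: eq_integrable_on fi => x _; rewrite e.
by apply: eq_integral_over => x _; rewrite e.
Qed.
End hilbert.

(** * The Dirichlet form on H^1_0 *)

HB.lock Definition dirichlet {R : realType} (Omega : set (R3 R)) (f g : R3 R -> R) : R :=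
  \sum_(i < 3) inner Omega (wderiv Omega i f) (wderiv Omega i g).

Lemma dirichletE {R : realType} (Omega : set (R3 R)) f g :
  dirichlet Omega f g = \sum_(i < 3) inner Omega (wderiv Omega i f) (wderiv Omega i g).
Proof. by rewrite dirichlet.unlock. Qed.

Section H1.
Context {R : realType} (Omega : set (R3 R)).
Local Notation mu := (lebesgue3 R).
Hypothesis oO : open Omega.
Implicit Types f g h phi : R3 R -> R.
Local Notation sq_integrable := (sq_integrable Omega).
Local Notation ip := (inner Omega).
Local Notation gr := (dirichlet Omega).
Local Notation integrable_on := (integrable_on Omega).
Local Notation W i f := (wderiv Omega i f).

Let mO : measurable Omega := open_measurable3 oO.

Lemma test_functionZ (c : R) phi : test_function Omega phi -> test_function Omega (fun x => c * phi x).
Proof.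
move=> tphi; apply: (test_function_sub tphi).
  by apply: smoothM; [exact: smooth_cst|case: tphi].
by apply: tsupport_sub => x ->; rewrite mulr0.
Qed.

Lemma loc_integrable_lin (a b : R) f g : loc_integrable Omega f -> loc_integrable Omega g ->
  loc_integrable Omega (fun x => a * f x + b * g x).
Proof.
move=> [mf If] [mg Ig]; split.
  by apply: measurable_funD; apply: measurable_funM => //; exact: measurable_cst.
move=> K cK KO; have mK := compact_measurable3 cK.
exact: (integrable_onD mK (integrable_onZ mK a (If K cK KO)) (integrable_onZ mK b (Ig K cK KO))).
Qed.

Lemma weak_deriv_lin (i : 'I_3) (a b : R) f g f' g' :
  is_weak_deriv Omega i f f' -> is_weak_deriv Omega i g g' ->
  is_weak_deriv Omega i (fun x => a * f x + b * g x) (fun x => a * f' x + b * g' x).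
Proof.
move=> [lf lf' Hf] [lg lg' Hg]; split; [exact: loc_integrable_lin|exact: loc_integrable_lin|].
have key h1 h2 psi : loc_integrable Omega h1 -> loc_integrable Omega h2 -> test_function Omega psi ->
    \int[mu]_(x in Omega) ((a * h1 x + b * h2 x) * psi x) =
    a * \int[mu]_(x in Omega) (h1 x * psi x) + b * \int[mu]_(x in Omega) (h2 x * psi x).
  move=> l1 l2 tpsi.
  have i1 : integrable_on (fun x => h1 x * psi x) by exact: loc_test_integrable.
  have i2 : integrable_on (fun x => h2 x * psi x) by exact: loc_test_integrable.
  rewrite -!(integral_overE Omega).
  rewrite -(integral_overZ mO a i1) -(integral_overZ mO b i2) -(integral_overD mO (integrable_onZ mO a i1) (integrable_onZ mO b i2)).
  by apply: eq_integral_over => x _; ring.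
move=> phi tphi; rewrite !key//; last exact: test_function_derive.
by rewrite Hf// Hg//; ring.
Qed.

Lemma sq_integrable_lin (a b : R) f g : sq_integrable f -> sq_integrable g -> sq_integrable (fun x => a * f x + b * g x).
Proof. by move=> Lf Lg; apply: sq_integrableD => //; exact: sq_integrableZ. Qed.

Lemma H1_sq_integrable f : H1 Omega f -> sq_integrable f.
Proof. by move=> [/(Lp_sq_integrable mO)]. Qed.

Lemma H1_is_weak_deriv f i : H1 Omega f -> is_weak_deriv Omega i f (W i f).
Proof.
move=> [_ /(_ i) [g wg _]]; rewrite /wderiv.
exact: (xgetPex (fun=> 0) (ex_intro (is_weak_deriv Omega i f) g wg)).
Qed.

Lemma wderiv_sq_integrable f i : H1 Omega f -> sq_integrable (W i f).
Proof.
move=> Hf; have w := H1_is_weak_deriv i Hf; have [_ /(_ i) [g wg Lg]] := Hf.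
apply: (ae_sq_integrable mO _ (weak_deriv_unique oO wg w)); last exact: Lp_sq_integrable.
by case: w => _ [].
Qed.

Lemma sq_integrable_Lp f : sq_integrable f -> Lp Omega 2 f.
Proof.
move=> [mf fi]; rewrite /Lp /= inE; apply/andP; split; rewrite inE /=.
  by apply/(measurable_restrictT _ _).1.
rewrite /finite_norm.
apply: (@lty_poweRy _ _ 2) => //.
rewrite (@Lnorm_pow _ Omega 2 f isT mf) -ge0_fin_numE ?integral_ge0//.
have : integrable_on (fun x => `|f x| ^+ 2) by apply: eq_integrable_on fi => // x _; rewrite real_normK ?num_real.
exact: (integrable_fin_num (meas3 mO)).
Qed.

Lemma H1_intro f : sq_integrable f -> (forall i, exists2 g, is_weak_deriv Omega i f g & sq_integrable g) -> H1 Omega f.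
Proof.
move=> Lf Hg; split; first exact: sq_integrable_Lp.
by move=> i; have [g wg Lg] := Hg i; exists g => //; exact: sq_integrable_Lp.
Qed.

Lemma H1_lin (a b : R) f g : H1 Omega f -> H1 Omega g -> H1 Omega (fun x => a * f x + b * g x).
Proof.
move=> Hf Hg; apply: H1_intro; first by apply: sq_integrable_lin; exact: H1_sq_integrable.
move=> i; exists (fun x => a * W i f x + b * W i g x).
  by apply: weak_deriv_lin; exact: H1_is_weak_deriv.
by apply: sq_integrable_lin; exact: wderiv_sq_integrable.
Qed.

Lemma wderiv_lin (a b : R) f g i : H1 Omega f -> H1 Omega g ->
  {ae mu, forall x, Omega x -> W i (fun x => a * f x + b * g x) x = a * W i f x + b * W i g x}.
Proof.
move=> Hf Hg; apply: (weak_deriv_unique oO (H1_is_weak_deriv i (H1_lin a b Hf Hg))).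
by apply: weak_deriv_lin; exact: H1_is_weak_deriv.
Qed.

Lemma test_H1 phi : test_function Omega phi -> H1 Omega phi.
Proof.
move=> tphi; apply: H1_intro; first exact: test_sq_integrable.
move=> i; exists ('D_(basis3 i) phi); first exact: test_weak_deriv.
by apply: test_sq_integrable => //; exact: test_function_derive.
Qed.

Lemma wderiv_test phi i : test_function Omega phi ->
  {ae mu, forall x, Omega x -> W i phi x = 'D_(basis3 i) phi x}.
Proof.
move=> tphi; apply: (weak_deriv_unique oO (H1_is_weak_deriv i (test_H1 tphi))).
exact: test_weak_deriv.
Qed.

Definition H1sq f : R := ip f f + gr f f.

Lemma dirichletC f g : gr f g = gr g f.
Proof. by rewrite !dirichletE; apply: eq_bigr => i _; rewrite innerC. Qed.

Lemma dirichlet_ge0 f : 0 <= gr f f.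
Proof. by rewrite dirichletE; apply: sumr_ge0 => i _; exact: inner_ge0. Qed.

Lemma dirichlet_linl (a b : R) f g h : H1 Omega f -> H1 Omega g -> H1 Omega h ->
  gr (fun x => a * f x + b * g x) h = a * gr f h + b * gr g h.
Proof.
move=> Hf Hg Hh; rewrite !dirichletE !mulr_sumr -big_split; apply: eq_bigr => i _.
have Lf := wderiv_sq_integrable i Hf; have Lg := wderiv_sq_integrable i Hg; have Lh := wderiv_sq_integrable i Hh.
have Lfg := wderiv_sq_integrable i (H1_lin a b Hf Hg).
have aeh : {ae mu, forall x, Omega x -> W i h x = W i h x} by exact: aeW.
rewrite (ae_inner mO Lfg (sq_integrable_lin a b Lf Lg) Lh Lh (wderiv_lin a b i Hf Hg) aeh).
by rewrite (innerDl mO (sq_integrableZ mO a Lf) (sq_integrableZ mO b Lg) Lh) (innerZl mO a Lf Lh) (innerZl mO b Lg Lh).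
Qed.

Lemma inner_linl (a b : R) f g h : sq_integrable f -> sq_integrable g -> sq_integrable h ->
  ip (fun x => a * f x + b * g x) h = a * ip f h + b * ip g h.
Proof.
move=> Lf Lg Lh.
by rewrite (innerDl mO (sq_integrableZ mO a Lf) (sq_integrableZ mO b Lg) Lh) (innerZl mO a Lf Lh) (innerZl mO b Lg Lh).
Qed.

Lemma dirichlet_linr (a b : R) f g h : H1 Omega f -> H1 Omega g -> H1 Omega h ->
  gr h (fun x => a * f x + b * g x) = a * gr h f + b * gr h g.
Proof. by move=> Hf Hg Hh; rewrite dirichletC (dirichlet_linl a b Hf Hg Hh) (dirichletC f) (dirichletC g). Qed.

Lemma inner_linr (a b : R) f g h : sq_integrable f -> sq_integrable g -> sq_integrable h ->
  ip h (fun x => a * f x + b * g x) = a * ip h f + b * ip h g.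
Proof. by move=> Hf Hg Hh; rewrite innerC (inner_linl a b Hf Hg Hh) (innerC Omega f) (innerC Omega g). Qed.

Lemma dirichlet_young f g (d : R) : 0 < d -> H1 Omega f -> H1 Omega g ->
  `|gr f g| <= d^-1 * gr f f + d * gr g g.
Proof.
move=> d0 Hf Hg; rewrite !dirichletE !mulr_sumr -big_split; apply: (le_trans (ler_norm_sum _ _ _)).
by apply: ler_sum => i _; apply: inner_young => //; exact: wderiv_sq_integrable.
Qed.

Lemma H1sq_ge0 f : 0 <= H1sq f.
Proof. by rewrite addr_ge0 ?dirichlet_ge0 ?inner_ge0. Qed.

Lemma H1norm_sqr f : H1 Omega f -> H1norm Omega f ^+ 2 = H1sq f.
Proof.
move=> Hf; rewrite /H1norm sqr_sqrtr; last first.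
  by rewrite addr_ge0 ?sqr_ge0// sumr_ge0// => i _; rewrite sqr_ge0.
rewrite Lpnorm2//; last exact: H1_sq_integrable.
by rewrite /H1sq dirichletE; congr (_ + _); apply: eq_bigr => i _; rewrite Lpnorm2//; exact: wderiv_sq_integrable.
Qed.

Lemma grad_sqnormE f : H1 Omega f -> grad_sqnorm Omega f = gr f f.
Proof. by move=> Hf; rewrite dirichletE; apply: eq_bigr => i _; rewrite Lpnorm2//; exact: wderiv_sq_integrable. Qed.

Lemma dirichlet_sqr_lin (a b : R) f g : H1 Omega f -> H1 Omega g ->
  gr (fun x => a * f x + b * g x) (fun x => a * f x + b * g x) =
  a ^+ 2 * gr f f + 2 * a * b * gr f g + b ^+ 2 * gr g g.
Proof.
move=> Hf Hg; have Hfg := H1_lin a b Hf Hg.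
rewrite (dirichlet_linl a b Hf Hg Hfg) (dirichlet_linr a b Hf Hg Hf) (dirichlet_linr a b Hf Hg Hg) (dirichletC g f).
move: (gr f f) (gr f g) (gr g g) => A B C; ring.
Qed.

Lemma inner_sqr_lin (a b : R) f g : sq_integrable f -> sq_integrable g ->
  ip (fun x => a * f x + b * g x) (fun x => a * f x + b * g x) =
  a ^+ 2 * ip f f + 2 * a * b * ip f g + b ^+ 2 * ip g g.
Proof.
move=> Hf Hg; have Hfg := sq_integrable_lin a b Hf Hg.
rewrite (inner_linl a b Hf Hg Hfg) (inner_linr a b Hf Hg Hf) (inner_linr a b Hf Hg Hg) (innerC Omega g f).
move: (ip f f) (ip f g) (ip g g) => A B C; ring.
Qed.

Lemma dirichlet_lin_le (a b : R) f g : H1 Omega f -> H1 Omega g ->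
  gr (fun x => a * f x + b * g x) (fun x => a * f x + b * g x) <=
  2 * a ^+ 2 * gr f f + 2 * b ^+ 2 * gr g g.
Proof.
move=> Hf Hg; have := dirichlet_ge0 (fun x => a * f x + (- b) * g x).
rewrite !(dirichlet_sqr_lin _ _ Hf Hg).
move: (gr f f) (gr f g) (gr g g) => A B C; lra.
Qed.

Lemma inner_lin_le (a b : R) f g : sq_integrable f -> sq_integrable g ->
  ip (fun x => a * f x + b * g x) (fun x => a * f x + b * g x) <=
  2 * a ^+ 2 * ip f f + 2 * b ^+ 2 * ip g g.
Proof.
move=> Hf Hg; have := inner_ge0 Omega (fun x => a * f x + (- b) * g x).
rewrite !(inner_sqr_lin _ _ Hf Hg).
move: (ip f f) (ip f g) (ip g g) => A B C; lra.
Qed.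

Lemma H1sq_lin_le (a b : R) f g : H1 Omega f -> H1 Omega g ->
  H1sq (fun x => a * f x + b * g x) <= 2 * a ^+ 2 * H1sq f + 2 * b ^+ 2 * H1sq g.
Proof.
move=> Hf Hg; rewrite /H1sq.
have := dirichlet_lin_le a b Hf Hg; have := inner_lin_le a b (H1_sq_integrable Hf) (H1_sq_integrable Hg).
rewrite !mulrDr => h1 h2; apply: (le_trans (lerD h1 h2)).
by rewrite addrACA.
Qed.

Lemma H10_H1 f : H10 Omega f -> H1 Omega f. Proof. by case. Qed.

(** Differences are written as linear combinations with coefficients 1 and -1,
    the form in which the bilinearity lemmas apply. *)
Lemma H10_approx f (e : R) : 0 < e -> H10 Omega f ->
  exists2 phi, test_function Omega phi & H1sq (fun x => 1 * f x + (-1) * phi x) < e.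
Proof.
move=> e0 [Hf /(_ (Num.sqrt e))]; rewrite sqrtr_gt0 => /(_ e0) [phi tphi h].
exists phi => //.
have -> : (fun x => 1 * f x + -1 * phi x) = f \- phi.
  by apply/funext => x /=; rewrite mul1r mulN1r.
have Hd : H1 Omega (f \- phi).
  have := H1_lin 1 (-1) Hf (test_H1 tphi); congr (H1 _ _).
  by apply/funext => x /=; rewrite mul1r mulN1r.
rewrite -H1norm_sqr// -[e]sqr_sqrtr ?ltW// ltr_sqr// nnegrE ?sqrtr_ge0//.
Qed.

Lemma H10_lin (a b : R) f g : H10 Omega f -> H10 Omega g -> H10 Omega (fun x => a * f x + b * g x).
Proof.
move=> Vf Vg; have Hf := H10_H1 Vf; have Hg := H10_H1 Vg.
split; first exact: H1_lin.
move=> e e0.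
pose e' := e ^+ 2 / (4 * (a ^+ 2 + b ^+ 2 + 1)).
have D0 : 0 < 4 * (a ^+ 2 + b ^+ 2 + 1).
  by have := sqr_ge0 a; have := sqr_ge0 b; lra.
have e'0 : 0 < e' by rewrite divr_gt0// exprn_gt0.
have [phi tphi hphi] := H10_approx e'0 Vf.
have [psi tpsi hpsi] := H10_approx e'0 Vg.
have t1 := test_functionD (test_functionZ a tphi) (test_functionZ b tpsi).
exists (fun x => a * phi x + b * psi x) => //.
set k := (X in H1norm _ X).
have kE : k = (fun x => a * (1 * f x + -1 * phi x) + b * (1 * g x + -1 * psi x)).
  by apply/funext => x; rewrite /k /=; ring.
have H1d := H1_lin 1 (-1) Hf (test_H1 tphi); have H2d := H1_lin 1 (-1) Hg (test_H1 tpsi).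
have Hk : H1 Omega k by rewrite kE; exact: H1_lin.
rewrite -ltr_sqr ?nnegrE ?sqrtr_ge0// ?ltW// H1norm_sqr// kE.
apply: (le_lt_trans (H1sq_lin_le a b H1d H2d)).
have De : e' * (4 * (a ^+ 2 + b ^+ 2 + 1)) = e ^+ 2 by rewrite /e' divfK// gt_eqF.
have := sqr_ge0 a; have := sqr_ge0 b.
have := H1sq_ge0 (fun x => 1 * f x + -1 * phi x); have := H1sq_ge0 (fun x => 1 * g x + -1 * psi x).
move: (H1sq _) (H1sq _) hpsi hphi => q1 q2 hpsi hphi q10 q20 b0 a0.
have h1 : a ^+ 2 * q2 <= a ^+ 2 * e' by rewrite ler_wpM2l// ltW.
have h2 : b ^+ 2 * q1 <= b ^+ 2 * e' by rewrite ler_wpM2l// ltW.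
nra.
Qed.

Lemma test_H10 phi : test_function Omega phi -> H10 Omega phi.
Proof.
move=> tphi; split; first exact: test_H1.
move=> e e0; exists phi => //.
have Hp := test_H1 tphi.
have E : phi \- phi = (fun x => 0 * phi x + 0 * phi x).
  by apply/funext => x /=; rewrite subrr mul0r addr0.
rewrite -ltr_sqr ?nnegrE ?sqrtr_ge0// ?ltW// H1norm_sqr// E; last exact: H1_lin.
apply: (le_lt_trans (H1sq_lin_le 0 0 Hp Hp)).
by rewrite expr0n /= mulr0 !mul0r addr0 exprn_gt0.
Qed.
End H1.

(** * Pointwise inequalities for sixth powers *)

Section pointwise.
Context {R : realType}.
Implicit Types (x y k a m w : R).

Definition trunc (k x : R) := Num.min `|x| k.

Lemma trunc_ge0 k x : 0 <= k -> 0 <= trunc k x.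
Proof. by move=> k0; rewrite le_min normr_ge0. Qed.

Lemma pow6_norm x : `|x| ^+ 6 = x ^+ 6.
Proof. by rewrite -normrX ger0_norm// (exprM _ 3 2) sqr_ge0. Qed.

Lemma pow6_ge0 x : 0 <= x ^+ 6. Proof. by rewrite (exprM _ 3 2) sqr_ge0. Qed.

(** On [0, k] the sixth power is Lipschitz with constant 6 k^5, so truncated
    sixth powers pass to limits in L^1. *)
Lemma trunc_ineq k x y : 0 <= k -> trunc k x ^+ 6 <= y ^+ 6 + 6 * k ^+ 5 * `|x - y|.
Proof.
move=> k0; have a0 := trunc_ge0 x k0; set a := trunc k x in a0 *.
have ak : a <= k by rewrite ge_min lexx orbT.
have ax : a <= `|x| by rewrite ge_min lexx.
rewrite -(pow6_norm y); set b := `|y|; have b0 : 0 <= b := normr_ge0 _.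
have k5 : 0 <= 6 * k ^+ 5 by rewrite mulr_ge0// exprn_ge0.
have [ab|ba] := leP a b.
  by rewrite -[leLHS]addr0 lerD// ?mulr_ge0// ler_pXn2r.
have abxy : a - b <= `|x - y| by have := lerB_dist x y; rewrite -/b; lra.
rewrite -lerBlDl; apply: (@le_trans _ _ (6 * k ^+ 5 * (a - b))); last by rewrite ler_wpM2l.
(* Here b < a <= k, so each of the six products is at most k^5. *)
have -> : a ^+ 6 - b ^+ 6 = (a ^+ 5 * b ^+ 0 + a ^+ 4 * b ^+ 1 + a ^+ 3 * b ^+ 2 +
  a ^+ 2 * b ^+ 3 + a ^+ 1 * b ^+ 4 + a ^+ 0 * b ^+ 5) * (a - b) by ring.
have ab0 : 0 <= a - b by rewrite subr_ge0 ltW.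
apply: (ler_wpM2r ab0).
have bnd i j : (i + j = 5)%N -> a ^+ i * b ^+ j <= k ^+ 5.
  move=> <-; rewrite exprD ler_pM ?exprn_ge0// lerXn2r ?nnegrE//.
  by apply: (le_trans (ltW ba)).
move: (bnd 5%N 0%N erefl) (bnd 4%N 1%N erefl) (bnd 3%N 2%N erefl) (bnd 2%N 3%N erefl)
  (bnd 1%N 4%N erefl) (bnd 0%N 5%N erefl).
move: (a ^+ 5 * _) (a ^+ 4 * _) (a ^+ 3 * _) (a ^+ 2 * _) (a ^+ 1 * _) (a ^+ 0 * _) (k ^+ 5) => *.
lra.
Qed.

(** Every factor is at most the largest of the three. *)
Lemma young6 a m w : 0 <= a -> 0 <= m -> 0 <= w -> a * m ^+ 4 * w <= a ^+ 6 + m ^+ 6 + w ^+ 6.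
Proof.
move=> a0 m0 w0; pose M := Num.max a (Num.max m w).
have aM : a <= M by rewrite le_max lexx.
have mM : m <= M by rewrite !le_max lexx orbT.
have wM : w <= M by rewrite !le_max lexx !orbT.
have M0 : 0 <= M by exact: le_trans aM.
apply: (@le_trans _ _ (M ^+ 6)).
  have -> : M ^+ 6 = M * M ^+ 4 * M by ring.
  by rewrite !ler_pM ?mulr_ge0 ?exprn_ge0// lerXn2r ?nnegrE.
have := exprn_ge0 6 a0; have := exprn_ge0 6 m0; have := exprn_ge0 6 w0.
by rewrite /M /Num.max; case: ifP => _; [case: ifP => _|]; lra.
Qed.

Lemma max6 x y : Num.max `|x| `|y| ^+ 6 <= x ^+ 6 + y ^+ 6.
Proof.
have := pow6_ge0 x; have := pow6_ge0 y.
by rewrite /Num.max; case: ifP => _; rewrite pow6_norm; lra.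
Qed.

(** Compare |x| with |w| / d. *)
Lemma pow5_young x w (d : R) : 0 < d -> `|x ^+ 5 * w| <= d * x ^+ 6 + d^-1 ^+ 5 * w ^+ 6.
Proof.
move=> d0; have dV : 0 < d^-1 by rewrite invr_gt0.
rewrite normrM normrX -(pow6_norm x) -(pow6_norm w).
set a := `|x|; set b := `|w|; have a0 : 0 <= a := normr_ge0 _; have b0 : 0 <= b := normr_ge0 _.
pose c := d^-1 * b.
have c0 : 0 <= c by rewrite mulr_ge0// ltW.
have -> : b = d * c by rewrite /c mulrA mulfV ?mul1r// gt_eqF.
have -> : d^-1 ^+ 5 * (d * c) ^+ 6 = d * c ^+ 6.
  have e : d^-1 ^+ 5 * d ^+ 5 = 1 by rewrite -exprMn mulVf ?gt_eqF ?expr1n.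
  move: c {c0} => c; have -> : d^-1 ^+ 5 * (d * c) ^+ 6 = (d^-1 ^+ 5 * d ^+ 5) * (d * c ^+ 6) by ring.
  by rewrite e mul1r.
rewrite mulrCA -mulrDr ler_pM2l//.
have [ac|ca] := leP a c.
  rewrite -[leLHS]add0r lerD ?exprn_ge0// [c ^+ 6]exprSr ler_wpM2r//.
  by rewrite lerXn2r ?nnegrE.
by rewrite -[leLHS]addr0 lerD ?exprn_ge0// [a ^+ 6]exprSr ler_wpM2l ?exprn_ge0// ltW.
Qed.

(** The factorization gives |x^5 - y^5| <= 5 |x - y| max^4.  The weight d is
    meant to be small while |x - y| is much smaller than d. *)
Lemma pow5_diff x y w (d : R) : 0 < d -> `|(x ^+ 5 - y ^+ 5) * w| <=
  5 * d * (d^-1 ^+ 6 * (x - y) ^+ 6 + (x ^+ 6 + y ^+ 6) + w ^+ 6).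
Proof.
move=> d0; have dV : 0 < d^-1 by rewrite invr_gt0.
pose m := Num.max `|x| `|y|; pose a := d^-1 * `|x - y|.
have m0 : 0 <= m by rewrite le_max normr_ge0.
have a0 : 0 <= a by rewrite mulr_ge0// ltW.
have xm : `|x| <= m by rewrite le_max lexx.
have ym : `|y| <= m by rewrite le_max lexx orbT.
have E : `|x - y| = d * a by rewrite /a mulrA mulfV ?mul1r// gt_eqF.
have h : `|x ^+ 5 - y ^+ 5| <= d * a * (5 * m ^+ 4).
  rewrite subrXX normrM E; apply: (ler_wpM2l (mulr_ge0 (ltW d0) a0)).
  apply: (le_trans (ler_norm_sum _ _ _)).
  rewrite -[5]/(5%:R) mulr_natl -[X in _ *+ X]card_ord -sumr_const; apply: ler_sum => i _.
  have i5 : (i <= 4)%N by rewrite -ltnS.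
  have -> : m ^+ 4 = m ^+ (5.-1 - i) * m ^+ i by rewrite -exprD subnK.
  rewrite normrM !normrX ler_pM ?exprn_ge0 ?normr_ge0//.
    by rewrite lerXn2r ?nnegrE.
  by rewrite lerXn2r ?nnegrE.
rewrite normrM; apply: (le_trans (ler_wpM2r (normr_ge0 w) h)).
have -> : d * a * (5 * m ^+ 4) * `|w| = 5 * d * (a * m ^+ 4 * `|w|) by ring.
have d5 : 0 <= 5 * d by apply: mulr_ge0 => //; exact: ltW.
apply: (ler_wpM2l d5).
apply: (le_trans (young6 a0 m0 (normr_ge0 w))).
rewrite pow6_norm lerD2r /a exprMn pow6_norm lerD2l.
exact: max6.
Qed.

(** First order Taylor formula for the sixth power.  The remainder is (x - y)^2
    times a quartic form whose coefficients sum to 15. *)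
Lemma pow6_diff x y (d : R) : 0 < d -> `|x ^+ 6 - y ^+ 6 - 6 * (y ^+ 5 * (x - y))| <=
  15 * d ^+ 2 * (d^-1 ^+ 6 * (x - y) ^+ 6 + (x ^+ 6 + y ^+ 6)).
Proof.
move=> d0; have dV : 0 < d^-1 by rewrite invr_gt0.
pose m := Num.max `|x| `|y|; pose a := d^-1 * `|x - y|.
have m0 : 0 <= m by rewrite le_max normr_ge0.
have a0 : 0 <= a by rewrite mulr_ge0// ltW.
have xm : `|x| <= m by rewrite le_max lexx.
have ym : `|y| <= m by rewrite le_max lexx orbT.
have E : `|x - y| = d * a by rewrite /a mulrA mulfV ?mul1r// gt_eqF.
have -> : x ^+ 6 - y ^+ 6 - 6 * (y ^+ 5 * (x - y)) = (x - y) ^+ 2 *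
  (x ^+ 4 + 2 * (x ^+ 3 * y ^+ 1) + 3 * (x ^+ 2 * y ^+ 2) + 4 * (x ^+ 1 * y ^+ 3) + 5 * y ^+ 4) by ring.
rewrite normrM normrX E.
have bnd i j : (i + j = 4)%N -> `|x ^+ i * y ^+ j| <= m ^+ 4.
  by move=> <-; rewrite exprD normrM !normrX ler_pM ?exprn_ge0 ?normr_ge0// lerXn2r ?nnegrE.
have h : `|x ^+ 4 + 2 * (x ^+ 3 * y ^+ 1) + 3 * (x ^+ 2 * y ^+ 2) + 4 * (x ^+ 1 * y ^+ 3) + 5 * y ^+ 4|
   <= 15 * m ^+ 4.
  have := bnd 4%N 0%N erefl; have := bnd 3%N 1%N erefl; have := bnd 2%N 2%N erefl.
  have := bnd 1%N 3%N erefl; have := bnd 0%N 4%N erefl.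
  rewrite !expr0 mulr1 mul1r !ler_norml.
  move: (x ^+ 4) (x ^+ 3 * _) (x ^+ 2 * _) (x ^+ 1 * _) (y ^+ 4) (m ^+ 4) => A B C D F M.
  move=> /andP[? ?] /andP[? ?] /andP[? ?] /andP[? ?] /andP[? ?]; apply/andP; split; lra.
apply: (le_trans (ler_wpM2l (sqr_ge0 _) h)).
have -> : (d * a) ^+ 2 * (15 * m ^+ 4) = 15 * d ^+ 2 * (a ^+ 2 * m ^+ 4) by ring.
have d15 : 0 <= 15 * d ^+ 2 by apply: mulr_ge0 => //; exact: sqr_ge0.
apply: (ler_wpM2l d15).
have -> : a ^+ 2 * m ^+ 4 = a * m ^+ 4 * a by ring.
have am : a * m ^+ 4 * a <= a ^+ 6 + m ^+ 6.
  have [ac|ca] := leP a m.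
    apply: (@le_trans _ _ (m ^+ 6)); last by rewrite lerDr exprn_ge0.
    have -> : m ^+ 6 = m * m ^+ 4 * m by ring.
    apply: (ler_pM (mulr_ge0 a0 (exprn_ge0 4 m0)) a0 _ ac).
    exact: (ler_wpM2r (exprn_ge0 4 m0) ac).
  apply: (@le_trans _ _ (a ^+ 6)); last by rewrite lerDl exprn_ge0.
  have -> : a ^+ 6 = a * a ^+ 4 * a by ring.
  apply: (ler_wpM2r a0); apply: (ler_wpM2l a0).
  by rewrite lerXn2r ?nnegrE// ltW.
apply: (le_trans am); rewrite {1}/a exprMn pow6_norm lerD2l.
exact: max6.
Qed.

(** Below the level l the first term suffices, above it the second. *)
Lemma sqr_le_pow6 x (l : R) : 0 < l -> x * x <= l * 1 + l^-1 ^+ 2 * x ^+ 6.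
Proof.
move=> l0; have lV : 0 < l^-1 by rewrite invr_gt0.
rewrite mulr1; have t0 : 0 <= x * x by rewrite -expr2 sqr_ge0.
have -> : x ^+ 6 = (x * x) * (x * x) ^+ 2 by ring.
have [h|h] := leP (x * x) l.
  rewrite -[leLHS]addr0; apply: lerD => //; apply: mulr_ge0; first exact: sqr_ge0.
  by apply: mulr_ge0 => //; exact: sqr_ge0.
apply: (@le_trans _ _ (l^-1 ^+ 2 * (x * x * (x * x) ^+ 2))); last by rewrite lerDr ltW.
have y1 : 1 <= l^-1 * (x * x) by rewrite mulrC ler_pdivlMr// mul1r ltW.
by rewrite mulrCA -exprMn; apply: ler_peMr => //; exact: exprn_ege1.
Qed.
End pointwise.

(** * Sobolev and Poincare inequalities on H^1_0 and the quintic form *)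

HB.lock Definition int_pow6 {R : realType} (Omega : set (R3 R)) (f : R3 R -> R) : R :=
  integral_over Omega (fun x => f x ^+ 6).

HB.lock Definition int_quintic {R : realType} (Omega : set (R3 R)) (f w : R3 R -> R) : R :=
  integral_over Omega (fun x => f x ^+ 5 * w x).

Lemma int_pow6E {R : realType} (Omega : set (R3 R)) f :
  int_pow6 Omega f = integral_over Omega (fun x => f x ^+ 6).
Proof. by rewrite int_pow6.unlock. Qed.

Lemma int_quinticE {R : realType} (Omega : set (R3 R)) f w :
  int_quintic Omega f w = integral_over Omega (fun x => f x ^+ 5 * w x).
Proof. by rewrite int_quintic.unlock. Qed.

Lemma half_eq (R : realType) (d x e : R) : d * (2 * x) = e -> d * x = e / 2.
Proof. by move=> <-; field. Qed.

Section sobolev.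
Context {R : realType} (Omega : set (R3 R)).
Local Notation mu := (lebesgue3 R).
Hypothesis oO : open Omega.
Hypothesis fO : (mu Omega < +oo)%E.
Implicit Types f g h phi w : R3 R -> R.
Local Notation I := (integral_over Omega).
Local Notation J := (int_pow6 Omega).
Local Notation N := (int_quintic Omega).
Local Notation p6_integrable := (p6_integrable Omega).
Local Notation ip := (inner Omega).
Local Notation gr := (dirichlet Omega).
Local Notation H1sq := (H1sq Omega).
Local Notation integrable_on := (integrable_on Omega).
Local Notation W i f := (wderiv Omega i f).
Local Notation T3 := (measurableTypeR R * measurableTypeR R * measurableTypeR R)%type.

Let mO : measurable Omega := open_measurable3 oO.

Lemma int_pow6_ge0 f : 0 <= J f.
Proof. by rewrite int_pow6E; apply: integral_over_ge0 => x _; exact: pow6_ge0. Qed.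

Lemma sobolev_test_dirichlet : exists2 C : R, 0 < C &
  forall phi, test_function Omega phi -> J phi <= C * (gr phi phi) ^+ 3.
Proof.
exists (4096%:R); first exact: ltr0n.
move=> phi tphi; have S := sobolev_test tphi.
have sphi := let: And3 a _ _ := tphi in a.
have out x : [set: R3 R] x -> ~ Omega x -> phi x = 0.
  by move=> _ nx; apply: tsupport_out => s; apply: nx; case: tphi => _ _; apply.
have EJ : \int[mu]_x (phi x ^+ 6) = J phi.
  rewrite int_pow6E integral_overE; apply: Rintegral_support => // x xT nx.
  by rewrite (out _ xT nx) expr0n.
have EG i : \int[mu]_x ('D_(basis3 i) phi x ^+ 2) = ip (W i phi) (W i phi).
  have tD := test_function_derive (basis3 i) tphi.
  have LD := test_sq_integrable mO tD; have LW := wderiv_sq_integrable oO i (test_H1 oO tphi).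
  have ae := wderiv_test oO i tphi.
  rewrite (ae_inner mO LW LD LW LD ae ae).
  have -> : ip ('D_(basis3 i) phi) ('D_(basis3 i) phi) = I (fun x => 'D_(basis3 i) phi x ^+ 2).
    by rewrite innerE; apply: eq_integral_over => x _; rewrite expr2.
  rewrite integral_overE; apply: Rintegral_support => // x xT nx.
  rewrite derive_out ?expr0n// => s; apply: nx.
  by case: tphi => _ _; apply.
move: S; rewrite EJ; move=> /le_trans; apply.
apply: (ler_wpM2l (ler0n _ _)).
under eq_bigr => i _ do rewrite EG.
have Gle i : 0 <= ip (W i phi) (W i phi) <= gr phi phi.
  rewrite inner_ge0 /= dirichletE (bigD1 i) //= lerDl; apply: sumr_ge0 => j _; exact: inner_ge0.
apply: (@le_trans _ _ (\prod_(i < 3) gr phi phi)).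
  by apply: ler_prod => i _; exact: Gle.
by rewrite prodr_const card_ord.
Qed.

Lemma measurable_trunc k f : measurable_fun Omega f -> measurable_fun Omega (fun x => trunc k (f x) ^+ 6).
Proof.
move=> mf; apply: measurable_funX; apply: measurable_minr; last exact: measurable_cst.
exact: measurableT_comp.
Qed.

Lemma integrable_on_trunc k f : 0 <= k -> measurable_fun Omega f -> integrable_on (fun x => trunc k (f x) ^+ 6).
Proof.
move=> k0 mf; apply: (dominated_integrable_on mO (measurable_trunc k mf) _ (integrable_on_cst mO (k ^+ 6) fO)).
move=> x _; rewrite ger0_norm ?exprn_ge0 ?trunc_ge0// lerXn2r ?nnegrE ?trunc_ge0//.
by rewrite ge_min lexx orbT.
Qed.

(** Monotone convergence in the truncation level. *)
Lemma trunc_p6_integrable f (B : R) : measurable_fun Omega f ->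
  (forall n : nat, I (fun x => trunc n%:R (f x) ^+ 6) <= B) -> p6_integrable f /\ J f <= B.
Proof.
move=> mf HB.
pose g (n : nat) (x : R3 R) : \bar R := (trunc n%:R (f x) ^+ 6)%:E.
have mg n : measurable_fun Omega (g n).
  exact: ((measurable_EFinP _ _).2 (mfun3 (measurable_trunc n%:R mf))).
have cvg_g x : (g n x @[n --> \oo] --> (f x ^+ 6)%:E)%E.
  apply: cvg_near_cst; near=> n; rewrite /g /trunc min_l ?pow6_norm//.
  by near: n; exact: nbhs_infty_ger.
have Ig n : (\int[mu]_(x in Omega) g n x <= B%:E)%E.
  have it := @integrable_on_trunc n%:R f (ler0n _ _) mf.
  have := HB n; rewrite -lee_fin integral_overE /Rintegral fineK//.
  exact: (integrable_fin_num (meas3 mO) it).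
have If : (\int[mu]_(x in Omega) (f x ^+ 6)%:E <= B%:E)%E.
  have cv := @cvg_monotone_convergence _ T3 R mu Omega (meas3 mO) g mg _ _.
  have g0 n x : Omega x -> (0 <= g n x)%E.
    by move=> _; rewrite lee_fin exprn_ge0 ?trunc_ge0.
  have nd x : Omega x -> {homo g ^~ x : n m / (n <= m)%N >-> (n <= m)%E}.
    move=> _ n m nm; rewrite lee_fin lerXn2r ?nnegrE ?trunc_ge0//.
    by rewrite le_min !ge_min lexx /= ler_nat nm orbT.
  have {}cv := cv g0 nd.
  rewrite (_ : (\int[mu]_(x in Omega) (f x ^+ 6)%:E)%E =
    (\int[mu]_(x in Omega) limn (g^~ x))%E); last first.
    by apply: eq_integral => x _; apply/esym/cvg_lim => //; exact: cvg_g.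
  rewrite -(cvg_lim _ cv)//; apply: lime_le; first by apply/cvg_ex; eexists; exact: cv.
  by apply: nearW => n; exact: Ig.
have L : p6_integrable f.
  split=> //; apply/integrableP; split.
    exact: ((measurable_EFinP _ _).2 (mfun3 (measurable_funX _ mf))).
  apply: le_lt_trans (ltry B); rewrite (_ : (\int[mu]_(_ in _) _)%E = (\int[mu]_(x in Omega) (f x ^+ 6)%:E)%E)//.
  by apply: eq_integral => x _; rewrite gee0_abs// lee_fin pow6_ge0.
split=> //; rewrite !int_pow6E -lee_fin; rewrite integral_overE /Rintegral fineK//.
exact: (integrable_fin_num (meas3 mO) L.2).
Unshelve. all: by end_near. Qed.

(** The H^1 approximation of f also approximates it in L^1, as Omega has finite
    measure; the factor c absorbs the Lipschitz constant of the truncated sixth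
    power. *)
Lemma H10_approx_L1 (c e : R) f : 0 <= c -> 0 < e -> H10 Omega f ->
  exists phi, [/\ test_function Omega phi, integrable_on (fun x => c * `|f x - phi x|),
    I (fun x => c * `|f x - phi x|) <= e & gr (fun x => 1 * f x + -1 * phi x) (fun x => 1 * f x + -1 * phi x) <= e].
Proof.
move=> c0 e0 Vf; have i1 := integrable_on_cst mO 1 fO.
set M := I (fun=> 1); have M0 : 0 <= M by apply: integral_over_ge0.
(* Integrate t <= d + t^2 / d; d controls the constant part, then the H^1
   distance e' the quadratic part. *)
pose d := e / (2 * (c * M + 1)).
have cM0 : 0 < 2 * (c * M + 1) by rewrite mulr_gt0// ltr_wpDl// mulr_ge0.
have d0 : 0 < d by rewrite divr_gt0.
have dE : d * (2 * (c * M + 1)) = e by rewrite /d divfK// gt_eqF.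
pose e' := Num.min e (d * e / (2 * (c + 1))).
have c1 : 0 < 2 * (c + 1) by rewrite mulr_gt0// ltr_wpDl.
have e'0 : 0 < e' by rewrite lt_min e0 divr_gt0// mulr_gt0.
have [phi tphi hq] := H10_approx oO e'0 Vf; exists phi.
set z := (fun x => 1 * f x + -1 * phi x) in hq *.
have Hz : H1 Omega z := H1_lin oO 1 (-1) (H10_H1 Vf) (test_H1 oO tphi).
have Lz := H1_sq_integrable oO Hz.
have fz x : f x - phi x = z x by rewrite /z mul1r mulN1r.
have bnd x : c * `|f x - phi x| <= c * d * 1 + (c * d^-1) * (z x * z x).
  rewrite fz mulr1 -[c * d^-1 * _]mulrA -mulrDr; apply: (ler_wpM2l c0).
  rewrite -(ler_pM2l d0) mulrDr [d * (d^-1 * _)]mulrA mulfV ?gt_eqF// mul1r.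
  have := sqr_ge0 (d - `|z x|); rewrite -[z x * z x]expr2 -[z x ^+ 2]real_normK ?num_real//.
  have : 0 <= d * `|z x| by rewrite mulr_ge0// ltW.
  move: `|z x| => a; nra.
have mz : measurable_fun Omega (fun x => c * `|f x - phi x|).
  apply: measurable_funM; first exact: measurable_cst.
  apply: measurableT_comp => //; rewrite (_ : (fun x => f x - phi x) = z); first by case: Lz.
  by apply/funext => x; rewrite fz.
have i2 := integrable_on_cst mO (c * d * 1) fO; have i3 := integrable_onZ mO (c * d^-1) (sq_integrableM mO Lz Lz).
have ii := integrable_onD mO i2 i3.
have iz : integrable_on (fun x => c * `|f x - phi x|).
  apply: (dominated_integrable_on mO mz _ ii) => x _; rewrite ger0_norm; first exact: bnd.
  by rewrite mulr_ge0.
have q0 : ip z z <= e' /\ gr z z <= e'.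
  move: hq; have := dirichlet_ge0 Omega z; have := inner_ge0 Omega z; rewrite /H1sq.
  by move: (ip z z) (gr z z) => A B A0 B0 /ltW AB; split; lra.
have [qi qg] := q0.
split=> //; last by apply: (le_trans qg); rewrite ge_min lexx.
apply: (le_trans (le_integral_over mO iz ii (fun x _ => bnd x))).
rewrite (integral_overD mO i2 i3) (integral_overZ mO (c * d) i1) (integral_overZ mO (c * d^-1) (sq_integrableM mO Lz Lz)) -/M -innerE.
have h1 : c * d^-1 * ip z z <= e / 2.
  rewrite -mulrA mulrCA ler_pdivrMl//.
  apply: (@le_trans _ _ (c * e')); first exact: ler_wpM2l.
  have e'2 : e' * (2 * (c + 1)) <= d * e by rewrite -ler_pdivlMr// ge_min lexx orbT.
  by move: e' e'0 e'2 {qi qg q0 hq} => e'' h h'; clear -h h' c0; nra.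
have h2 : c * d * M <= e / 2.
  have -> : e / 2 = d * (c * M + 1).
    exact: (esym (half_eq dE)).
  by rewrite [c * d]mulrC -mulrA; apply: (ler_wpM2l (ltW d0)); rewrite lerDl.
by rewrite [leRHS]splitr; exact: lerD.
Qed.

(** Bounding truncations through nearby test functions gives an inhomogeneous
    bound, uniform in the truncation level.  Applied to f divided by its
    Dirichlet norm, regularized by e > 0, it becomes the homogeneous one. *)
Lemma sobolev_H10 : exists2 C : R, 0 < C &
  forall f, H10 Omega f -> p6_integrable f /\ J f <= C * (gr f f) ^+ 3.
Proof.
have [C C0 HC] := sobolev_test_dirichlet.
have bound f : H10 Omega f -> p6_integrable f /\ J f <= C * (2 * gr f f + 2) ^+ 3 + 1.
  move=> Vf; have Lf := H1_sq_integrable oO (H10_H1 Vf); have mf := Lf.1.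
  apply: (trunc_p6_integrable mf) => n.
  have k0 : 0 <= 6 * (n%:R : R) ^+ 5 by rewrite mulr_ge0// exprn_ge0.
  have [phi [tphi iz hz hg]] := H10_approx_L1 k0 ltr01 Vf.
  have it := integrable_on_trunc (ler0n R n) mf.
  have Lp := test_p6_integrable mO tphi.
  apply: (le_trans (le_integral_over mO it (integrable_onD mO Lp.2 iz) _)).
    by move=> x _; exact: trunc_ineq.
  rewrite (integral_overD mO Lp.2 iz); apply: lerD => //.
  rewrite -int_pow6E; apply: (le_trans (HC _ tphi)); apply: (ler_wpM2l (ltW C0)).
  have Hz : H1 Omega (fun x => 1 * f x + -1 * phi x) := H1_lin oO 1 (-1) (H10_H1 Vf) (test_H1 oO tphi).
  have E : phi = (fun x => 1 * f x + -1 * (1 * f x + -1 * phi x)).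
    by apply/funext => x; ring.
  have := dirichlet_lin_le oO 1 (-1) (H10_H1 Vf) Hz; rewrite -E => h.
  apply: lerXn2r; rewrite ?nnegrE; [exact: dirichlet_ge0| |].
    by apply: addr_ge0 => //; apply: mulr_ge0 => //; exact: dirichlet_ge0.
  move: h hg; move: (gr f f) (gr phi phi) (gr _ _) => A B D; clear => ? ?; lra.
pose C' := 64%:R * C + 1; have C'0 : 0 < C' by rewrite /C' ltr_wpDl// mulr_ge0// ltW.
have bound2 f (e : R) : 0 < e -> H10 Omega f -> J f <= C' * (gr f f + e) ^+ 3.
  move=> e0 Vf; have g0 := dirichlet_ge0 Omega f.
  have m0 : 0 < gr f f + e by rewrite ltr_wpDl.
  (* Divided by l, f has Dirichlet integral at most 1, and its inhomogeneous
     bound is C 4^3 + 1. *)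
  pose l := Num.sqrt (gr f f + e).
  have l0 : 0 < l by rewrite sqrtr_gt0.
  have l2 : l ^+ 2 = gr f f + e by rewrite sqr_sqrtr// ltW.
  have V' := H10_lin oO l^-1 0 Vf Vf.
  have [L' J'] := bound _ V'.
  have [Lf _] := bound _ Vf.
  have EJ : J (fun x => l^-1 * f x + 0 * f x) = (l^-1) ^+ 6 * J f.
    rewrite !int_pow6E -(integral_overZ mO _ Lf.2); apply: eq_integral_over => x _.
    by rewrite mul0r addr0 exprMn.
  have Eg : gr (fun x => l^-1 * f x + 0 * f x) (fun x => l^-1 * f x + 0 * f x) <= 1.
    rewrite (dirichlet_sqr_lin oO _ _ (H10_H1 Vf) (H10_H1 Vf)) exprVn l2 !mulr0 !mul0r !addr0 mulrC.
    rewrite expr0n mul0r addr0 ler_pdivrMr// mul1r.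
    by rewrite lerDl ltW.
  have J2 : J (fun x => l^-1 * f x + 0 * f x) <= C'.
    apply: (le_trans J'); rewrite lerD2r mulrC; apply: (ler_wpM2r (ltW C0)).
    have -> : (64%:R : R) = 4 ^+ 3 by rewrite -natrX.
    apply: lerXn2r; rewrite ?nnegrE //.
      exact: (addr_ge0 (mulr_ge0 (ler0n _ 2) (dirichlet_ge0 _ _)) (ler0n _ 2)).
    have <- : 2 * 1 + 2 = 4 :> R by rewrite mulr1 -natrD.
    by rewrite lerD2r; exact: (ler_wpM2l (ler0n _ 2) Eg).
  have -> : J f = l ^+ 6 * ((l^-1) ^+ 6 * J f).
    by rewrite mulrA -exprMn mulfV ?gt_eqF// expr1n mul1r.
  rewrite -EJ mulrC -l2 -exprM; apply: ler_wpM2r => //.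
  exact/exprn_ge0/ltW.
exists (8 * C') => [|f Vf]; first by rewrite mulr_gt0.
split; first by case: (bound f Vf).
have g0 := dirichlet_ge0 Omega f; have B0 e e0 := bound2 f e e0 Vf.
move: B0 g0; move: (gr f f) (J f) => g j B.
rewrite le_eqVlt => /predU1P[gz|g0].
  rewrite -gz expr0n /= mulr0 leNgt; apply/negP => j0.
  pose e := Num.min 1 (j / (2 * C')).
  have e0 : 0 < e by rewrite lt_min ltr01 divr_gt0// mulr_gt0.
  have e1 : e <= 1 by rewrite ge_min lexx.
  have e2 : e * (2 * C') <= j by rewrite -ler_pdivlMr ?mulr_gt0// ge_min lexx orbT.
  have := B _ e0; rewrite -gz add0r => h.
  have h3 : e ^+ 3 <= e by rewrite exprS ger_pMr// exprn_ile1// ltW.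
  have h4 : C' * e ^+ 3 <= C' * e by rewrite ler_wpM2l// ltW.
  by move: e2 h h4 j0; move: (e ^+ 3); clear; move: C' e => *; nra.
have h := B _ g0; apply: (le_trans h).
by have -> : C' * (g + g) ^+ 3 = 8 * C' * g ^+ 3 by clear; ring.
Qed.

(** Integrate t^2 <= l + t^6 / l^2 over Omega and use the Sobolev inequality; l
    of the size of the Dirichlet integral makes both terms linear in it. *)
Lemma poincare_H10 : exists2 K : R, 0 < K & forall f, H10 Omega f -> ip f f <= K * gr f f.
Proof.
have [C C0 HC] := sobolev_H10.
have i1 := integrable_on_cst mO 1 fO.
set M := I (fun=> 1); have M0 : 0 <= M by apply: integral_over_ge0.
exists (M + C) => [|f Vf]; first by rewrite ltr_wpDl.
have [Lf] := HC f Vf; have L2f := H1_sq_integrable oO (H10_H1 Vf).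
have g0 := dirichlet_ge0 Omega f.
have key (l : R) : 0 < l -> ip f f <= l * M + l^-1 ^+ 2 * J f.
  move=> l0; rewrite !int_pow6E -(integral_overZ mO l i1) -(integral_overZ mO _ Lf.2) -(integral_overD mO (integrable_onZ mO l i1) (integrable_onZ mO (l^-1 ^+ 2) Lf.2)) innerE.
  apply: (le_integral_over mO (sq_integrableM mO L2f L2f) (integrable_onD mO (integrable_onZ mO l i1) (integrable_onZ mO (l^-1 ^+ 2) Lf.2))) => x _.
  exact: sqr_le_pow6.
move: key g0; move: (ip f f) (gr f f) (J f) => p g j key g0 hj.
apply/ler_addgt0Pr => e e0.
pose d := e / (M + C); have MC : 0 < M + C by rewrite ltr_wpDl.
have d0 : 0 < d by rewrite divr_gt0.
(* The level l = g + d balances the two terms of t^2 <= l + t^6 / l^2. *)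
have l0 : 0 < g + d by rewrite ltr_wpDl.
have dE : (M + C) * (g + d) = (M + C) * g + e by rewrite mulrDr /d [(M + C) * (e / _)]mulrC divfK// gt_eqF.
rewrite -dE; apply: (le_trans (key _ l0)).
have h : (g + d)^-1 ^+ 2 * j <= C * (g + d).
  apply: (@le_trans _ _ ((g + d)^-1 ^+ 2 * (C * (g + d) ^+ 3))).
    apply: ler_wpM2l; first exact: sqr_ge0.
    apply: (le_trans hj); apply: (ler_wpM2l (ltW C0)).
    by apply: lerXn2r; rewrite ?nnegrE ?lerDl; move: g0 l0 d0; clear; lra.
  by rewrite exprVn mulrCA [_ ^+ 3]exprS [(g + d) * _]mulrC mulKf// gt_eqF// exprn_gt0.
by rewrite [(M + C) * _]mulrDl [(g + d) * M]mulrC lerD2l.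
Qed.

Lemma integrable_on_quintic f w : p6_integrable f -> p6_integrable w -> integrable_on (fun x => f x ^+ 5 * w x).
Proof.
move=> [mf Lf] [mw Lw].
apply: (dominated_integrable_on mO _ _ (integrable_onD mO (integrable_onZ mO 1 Lf) (integrable_onZ mO (1^-1 ^+ 5) Lw))).
  by apply: measurable_funM => //; exact: measurable_funX.
by move=> x _; exact: pow5_young.
Qed.

Lemma int_quintic_young (d : R) f w : 0 < d -> p6_integrable f -> p6_integrable w -> `|N f w| <= d * J f + d^-1 ^+ 5 * J w.
Proof.
move=> d0 Lf Lw; rewrite ?int_quinticE ?int_pow6E -(integral_overZ mO d Lf.2) -(integral_overZ mO (d^-1 ^+ 5) Lw.2).
have h1 := integrable_onZ mO d Lf.2; have h2 := integrable_onZ mO (d^-1 ^+ 5) Lw.2.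
rewrite -(integral_overD mO h1 h2); apply: (norm_integral_over_le mO (integrable_on_quintic Lf Lw) (integrable_onD mO h1 h2)) => x _.
exact: pow5_young.
Qed.

Lemma int_quintic_lin (a b : R) f w1 w2 : p6_integrable f -> p6_integrable w1 -> p6_integrable w2 ->
  N f (fun x => a * w1 x + b * w2 x) = a * N f w1 + b * N f w2.
Proof.
move=> Lf L1 L2'; have i1 := integrable_on_quintic Lf L1; have i2 := integrable_on_quintic Lf L2'.
rewrite !int_quinticE -(integral_overZ mO a i1) -(integral_overZ mO b i2) -(integral_overD mO (integrable_onZ mO a i1) (integrable_onZ mO b i2)).
by apply: eq_integral_over => x _; ring.
Qed.

Lemma int_quintic_self f : N f f = J f.
Proof. by rewrite int_quinticE int_pow6E; apply: eq_integral_over => x _; rewrite -exprSr. Qed.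

(** With d small, and then the difference f - g small with respect to d, the
    right-hand side is small on bounded sets. *)
Lemma int_quintic_diff (d : R) f g w : 0 < d -> p6_integrable f -> p6_integrable g -> p6_integrable w -> p6_integrable (fun x => 1 * f x + -1 * g x) ->
  `|N f w - N g w| <= 5 * d * (d^-1 ^+ 6 * J (fun x => 1 * f x + -1 * g x) + (J f + J g) + J w).
Proof.
move=> d0 Lf Lg Lw Lz; have i1 := integrable_on_quintic Lf Lw; have i2 := integrable_on_quintic Lg Lw.
have i3 := integrable_onZ mO (d^-1 ^+ 6) Lz.2; have i4 := integrable_onD mO Lf.2 Lg.2.
have i5 := integrable_onD mO i3 i4; have i6 := integrable_onD mO i5 Lw.2; have i7 := integrable_onZ mO (5 * d) i6.
rewrite ?int_quinticE ?int_pow6E -(integral_overB mO i1 i2) -(integral_overZ mO (d^-1 ^+ 6) Lz.2) -(integral_overD mO Lf.2 Lg.2).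
rewrite -(integral_overD mO i3 i4) -(integral_overD mO i5 Lw.2) -(integral_overZ mO (5 * d) i6).
apply: (norm_integral_over_le mO (integrable_onB mO i1 i2) i7) => x _.
by rewrite -mulrBl !mul1r mulN1r; exact: pow5_diff.
Qed.

(** First order expansion of the potential energy, whose differential at g is 6
    times the quintic form. *)
Lemma int_pow6_expansion (d : R) f g : 0 < d -> p6_integrable f -> p6_integrable g -> p6_integrable (fun x => 1 * f x + -1 * g x) ->
  `|J f - J g - 6 * N g (fun x => 1 * f x + -1 * g x)| <=
  15 * d ^+ 2 * (d^-1 ^+ 6 * J (fun x => 1 * f x + -1 * g x) + (J f + J g)).
Proof.
move=> d0 Lf Lg Lz; have i1 := integrable_on_quintic Lg Lz; have i2 := integrable_onB mO Lf.2 Lg.2.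
have i3 := integrable_onZ mO (d^-1 ^+ 6) Lz.2; have i4 := integrable_onD mO Lf.2 Lg.2.
have i5 := integrable_onD mO i3 i4; have i6 := integrable_onZ mO 6 i1; have i7 := integrable_onZ mO (15 * d ^+ 2) i5.
rewrite ?int_quinticE ?int_pow6E -(integral_overB mO Lf.2 Lg.2) -(integral_overZ mO 6 i1) -(integral_overB mO i2 i6) -(integral_overZ mO (d^-1 ^+ 6) Lz.2) -(integral_overD mO Lf.2 Lg.2).
rewrite -(integral_overD mO i3 i4) -(integral_overZ mO (15 * d ^+ 2) i5).
apply: (norm_integral_over_le mO (integrable_onB mO i2 i6) i7) => x _.
by rewrite !mul1r mulN1r; exact: pow6_diff.
Qed.
End sobolev.

(** * Uniform continuity of the forms on bounded sets *)

Section real_choice.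
Context {R : realType}.
Implicit Types M e r C d : R.

Lemma small_factor M e : 0 <= M -> 0 < e -> exists a : R, [/\ 0 < a, a <= 1 & a * M <= e].
Proof.
move=> M0 e0; have M1 : 0 < M + 1 by rewrite ltr_wpDl.
exists (Num.min 1 (e / (M + 1))); split.
- by rewrite lt_min ltr01 divr_gt0.
- by rewrite ge_min lexx.
- apply: (@le_trans _ _ (e / (M + 1) * M)); first by rewrite ler_wpM2r// ge_min lexx orbT.
  by rewrite mulrAC ler_pdivrMr// ler_wpM2l// ?lerDl// ltW.
Qed.

Lemma small_factor3 M1 M2 M3 e : 0 <= M1 -> 0 <= M2 -> 0 <= M3 -> 0 < e ->
  exists a : R, [/\ 0 < a, a <= 1, a * M1 <= e, a * M2 <= e & a * M3 <= e].
Proof.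
move=> h1 h2 h3 e0; have [a [a0 a1 ha]] := small_factor (addr_ge0 (addr_ge0 h1 h2) h3) e0.
have le M : M <= M1 + M2 + M3 -> a * M <= e.
  by move=> hM; apply: le_trans ha; apply: (ler_wpM2l (ltW a0)).
by exists a; split=> //; apply: le; lra.
Qed.

Lemma cube_le r : 0 <= r -> r <= 1 -> r ^+ 3 <= r.
Proof. by move=> r0 r1; rewrite exprS ler_piMr// exprn_ile1. Qed.

End real_choice.

Section forms.
Context {R : realType} (Omega : set (R3 R)).
Hypothesis oO : open Omega.
Implicit Types f g h phi w z : R3 R -> R.
Local Notation sq_integrable := (sq_integrable Omega).
Local Notation p6_integrable := (p6_integrable Omega).
Local Notation ip := (inner Omega).
Local Notation gr := (dirichlet Omega).
Local Notation J := (int_pow6 Omega).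
Local Notation N := (int_quintic Omega).
Local Notation H10 := (H10 Omega).
Local Notation sub f g := (fun x => 1 * f x + -1 * g x).
Variables K C : R.
Hypothesis K0 : 0 < K.
Hypothesis C0 : 0 < C.
Hypothesis poin : forall f, H10 f -> ip f f <= K * gr f f.
Hypothesis sob : forall f, H10 f -> p6_integrable f /\ J f <= C * (gr f f) ^+ 3.

Let mO : measurable Omega := open_measurable3 oO.

Lemma H10_sq_integrable f : H10 f -> sq_integrable f. Proof. by move=> /H10_H1; exact: H1_sq_integrable. Qed.

Lemma int_pow6_bound B f : gr f f <= B -> H10 f -> J f <= C * B ^+ 3.
Proof.
move=> fB Vf; have [_ h] := sob Vf; apply: (le_trans h); apply: (ler_wpM2l (ltW C0)).
have B0 : 0 <= B := le_trans (dirichlet_ge0 Omega f) fB.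
by apply: lerXn2r fB; rewrite nnegrE; first exact: dirichlet_ge0.
Qed.

Lemma inner_bound B f : gr f f <= B -> H10 f -> ip f f <= K * B.
Proof.
by move=> fB Vf; apply: (le_trans (poin Vf)); apply: (ler_wpM2l (ltW K0)).
Qed.

(** The radius r depends only on the bound B: this uniformity is what allows
    test functions that vary with t. *)
Lemma forms_small (B e : R) : 0 <= B -> 0 < e -> exists2 r : R, 0 < r & forall f z,
  H10 f -> H10 z -> gr f f <= B -> gr z z <= r ->
  [/\ `|gr f z| <= e, `|ip f z| <= e & `|N f z| <= e].
Proof.
move=> B0 e0; have e2 : 0 < e / 2 by rewrite divr_gt0.
have CB0 : 0 <= C * B ^+ 3 by apply: mulr_ge0; [exact: ltW|exact: exprn_ge0].
have KB0 : 0 <= K * B by apply: mulr_ge0; [exact: ltW|].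
have [a [a0 _ haB haK haC]] := small_factor3 B0 KB0 CB0 e2.
have aV : 0 < a^-1 by rewrite invr_gt0.
have D1 : 0 <= a^-1 * K by apply: mulr_ge0; exact: ltW.
have D2 : 0 <= a^-1 ^+ 5 * C by apply: mulr_ge0; [exact/exprn_ge0/ltW|exact: ltW].
have [r [r0 r1 hr hrK hrC]] := small_factor3 (ltW aV) D1 D2 e2.
exists r; first exact: r0.
move=> f z Vf Vz fB zr; rewrite [e]splitr.
have Hf := H10_H1 Vf; have Hz := H10_H1 Vz.
have aVV : a^-1^-1 = a by rewrite invrK.
split.
- have := dirichlet_young oO aV Hf Hz; rewrite aVV => h; apply: (le_trans h); apply: lerD.
    by apply: le_trans haB; apply: (ler_wpM2l (ltW a0)).
  by apply: le_trans hr; rewrite mulrC; apply: (ler_wpM2r (ltW aV)).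
- have := inner_young mO aV (H10_sq_integrable Vf) (H10_sq_integrable Vz); rewrite aVV => h.
  apply: (le_trans h); apply: lerD.
    by apply: le_trans haK; apply: (ler_wpM2l (ltW a0)); exact: inner_bound.
  apply: le_trans hrK; rewrite mulrCA [r * K]mulrC.
  by apply: (ler_wpM2l (ltW aV)); exact: inner_bound.
- have [Lf _] := sob Vf; have [Lz _] := sob Vz.
  apply: (le_trans (int_quintic_young oO a0 Lf Lz)); apply: lerD.
    by apply: le_trans haC; apply: (ler_wpM2l (ltW a0)); exact: int_pow6_bound.
  apply: le_trans hrC; rewrite mulrCA [r * C]mulrC.
  apply: ler_wpM2l; first exact/exprn_ge0/ltW.
  apply: (le_trans (int_pow6_bound zr Vz)); apply: (ler_wpM2l (ltW C0)).
  by apply: cube_le => //; exact: ltW.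
Qed.

Lemma forms_unif_cont (B e : R) : 0 <= B -> 0 < e -> exists2 r : R, 0 < r & forall f g,
  H10 f -> H10 g -> gr f f <= B -> gr g g <= B -> gr (sub f g) (sub f g) <= r ->
  forall w, H10 w -> gr w w <= B ->
  [/\ `|gr f w - gr g w| <= e, `|ip f w - ip g w| <= e & `|N f w - N g w| <= e].
Proof.
move=> B0 e0; have [r1 r10 H1] := forms_small B0 e0.
have e2 : 0 < e / 2 by rewrite divr_gt0.
pose M := 5 * (C * B ^+ 3 + C * B ^+ 3 + C * B ^+ 3).
have CB0 : 0 <= C * B ^+ 3 by apply: mulr_ge0; [exact: ltW|exact: exprn_ge0].
have M0 : 0 <= M by rewrite /M mulr_ge0// !addr_ge0.
have [d [d0 _ hd]] := small_factor M0 e2.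
pose D := 5 * (d * (d^-1 ^+ 6 * C)).
have D0 : 0 <= D.
  rewrite /D; apply: mulr_ge0 => //; apply: mulr_ge0; first exact: ltW.
  by apply: mulr_ge0; [apply/exprn_ge0; rewrite invr_ge0|]; exact: ltW.
have [r2 [r20 r21 hr]] := small_factor D0 e2.
exists (Num.min r1 r2); first by rewrite lt_min r10.
move=> f g Vf Vg fB gB zr w Vw wB.
have Vz := H10_lin oO 1 (-1) Vf Vg.
have zr1 : gr (sub f g) (sub f g) <= r1 by apply: (le_trans zr); rewrite ge_min lexx.
have zr2 : gr (sub f g) (sub f g) <= r2 by apply: (le_trans zr); rewrite ge_min lexx orbT.
have [a1 a2 _] := H1 _ _ Vw Vz wB zr1.
split.
- move: a1; rewrite (dirichlet_linr oO 1 (-1) (H10_H1 Vf) (H10_H1 Vg) (H10_H1 Vw)).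
  by rewrite mul1r mulN1r (dirichletC Omega w f) (dirichletC Omega w g).
- move: a2; rewrite (inner_linr oO 1 (-1) (H10_sq_integrable Vf) (H10_sq_integrable Vg) (H10_sq_integrable Vw)).
  by rewrite mul1r mulN1r (innerC Omega w f) (innerC Omega w g).
- have [Lf _] := sob Vf; have [Lg _] := sob Vg; have [Lw _] := sob Vw; have [Lz _] := sob Vz.
  apply: (le_trans (int_quintic_diff oO d0 Lf Lg Lw Lz)).
  have j1 := int_pow6_bound fB Vf; have j2 := int_pow6_bound gB Vg; have j3 := int_pow6_bound wB Vw.
  have j4 : J (sub f g) <= C * r2.
    apply: (le_trans (int_pow6_bound zr2 Vz)); apply: (ler_wpM2l (ltW C0)).
    by apply: cube_le => //; exact: ltW.
  move: (J (sub f g)) (J f) (J g) (J w) j1 j2 j3 j4 hd hr => Jz Jf Jg Jw j1 j2 j3 j4 hd hr.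
  have h1 : d^-1 ^+ 6 * Jz <= d^-1 ^+ 6 * (C * r2).
    by apply: ler_wpM2l => //; apply/exprn_ge0; rewrite invr_ge0 ltW.
  have h : d^-1 ^+ 6 * Jz + (Jf + Jg) + Jw <= d^-1 ^+ 6 * (C * r2) + (C * B ^+ 3 + C * B ^+ 3) + C * B ^+ 3.
    by rewrite !lerD.
  have d5 : 0 <= 5 * d by apply: mulr_ge0 => //; exact: ltW.
  apply: (le_trans (ler_wpM2l d5 h)).
  rewrite [e in X in _ <= X]splitr.
  apply: le_trans (lerD hr hd); rewrite /D /M.
  have -> : 5 * d * (d^-1 ^+ 6 * (C * r2) + (C * B ^+ 3 + C * B ^+ 3) + C * B ^+ 3) =
    r2 * (5 * (d * (d^-1 ^+ 6 * C))) + d * (5 * (C * B ^+ 3 + C * B ^+ 3 + C * B ^+ 3)) by clear; ring.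
  exact: lexx.
Qed.

(** Each diagonal term is polarized into two differences covered by
    forms_unif_cont and forms_small. *)
Lemma forms_diag_cont (B e : R) : 0 <= B -> 0 < e -> exists2 r : R, 0 < r & forall f g,
  H10 f -> H10 g -> gr f f <= B -> gr g g <= B -> gr (sub f g) (sub f g) <= r ->
  [/\ `|gr f f - gr g g| <= e, `|ip f f - ip g g| <= e & `|J f - J g| <= e].
Proof.
move=> B0 e0; have e2 : 0 < e / 2 by rewrite divr_gt0.
have [r1 r10 H1] := forms_unif_cont B0 e2; have [r2 r20 H2] := forms_small B0 e2.
exists (Num.min r1 r2); first by rewrite lt_min r10.
move=> f g Vf Vg fB gB zr.
have Vz := H10_lin oO 1 (-1) Vf Vg.
have zr1 : gr (sub f g) (sub f g) <= r1 by apply: (le_trans zr); rewrite ge_min lexx.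
have zr2 : gr (sub f g) (sub f g) <= r2 by apply: (le_trans zr); rewrite ge_min lexx orbT.
have [a1 a2 a3] := H1 _ _ Vf Vg fB gB zr1 _ Vf fB.
have [b1 b2 _] := H1 _ _ Vf Vg fB gB zr1 _ Vg gB.
have [_ _ c3] := H2 _ _ Vg Vz gB zr2.
have tri (x y z : R) : `|x - y| <= e / 2 -> `|y - z| <= e / 2 -> `|x - z| <= e.
  move=> h1 h2; rewrite [e]splitr; apply: le_trans (lerD h1 h2).
  by rewrite -[x - z](subrKA y) ler_normD.
split.
- by apply: (tri _ _ _ a1); rewrite (dirichletC Omega g f).
- by apply: (tri _ _ _ a2); rewrite (innerC Omega g f).
- have [Lf _] := sob Vf; have [Lg _] := sob Vg.
  rewrite -(int_quintic_self Omega f) -(int_quintic_self Omega g); apply: (tri _ _ _ a3).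
  by move: c3; rewrite (int_quintic_lin oO 1 (-1) Lg Lf Lg) mul1r mulN1r.
Qed.
End forms.

(** * Test functions of product type *)

Section tensor.
Context {R : realType}.
Implicit Types V W : normedModType R.

Lemma derive_dir0 V (f : V -> R) x : 'D_(0 : V) f x = 0.
Proof.
rewrite /derive (_ : (fun h : R => _) = (fun=> 0)); first exact: lim_cst.
by apply/funext => h /=; rewrite scaler0 add0r subrr scaler0.
Qed.

Lemma derive_tensor V W (a : V) (b : W) (f : V -> R) (g : W -> R) : smooth f -> smooth g ->
  'D_(a, b) (fun z : V * W => f z.1 * g z.2) =
  (fun z => 'D_a f z.1 * g z.2 + f z.1 * 'D_b g z.2).
Proof.
move=> sf sg; apply/funext => z.
have sF : smooth (f \o fst : V * W -> R).
  by apply: (@smooth_comp_affine _ _ _ fst fst) => //; move=> ?; exact: cvg_fst.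
have sG : smooth (g \o snd : V * W -> R).
  by apply: (@smooth_comp_affine _ _ _ snd snd) => //; move=> ?; exact: cvg_snd.
rewrite (_ : (fun z : V * W => f z.1 * g z.2) = (f \o fst) \* (g \o snd))//.
rewrite deriveM; [|exact: smooth_derivable..].
have E1 : 'D_(a, b) (f \o fst : V * W -> R) z = 'D_a f z.1.
  exact: (congr1 (fun h => h z) (@derive_comp_affine R V (V * W)%type fst fst f (a, b) (fun _ _ _ => erefl))).
have E2 : 'D_(a, b) (g \o snd : V * W -> R) z = 'D_b g z.2.
  exact: (congr1 (fun h => h z) (@derive_comp_affine R W (V * W)%type snd snd g (a, b) (fun _ _ _ => erefl))).
by rewrite E1 E2 /GRing.scale /= addrC [g z.2 * _]mulrC.
Qed.

Lemma dt_tensor (eta : R -> R) (phi : R3 R -> R) : smooth eta -> smooth phi ->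
  dt (fun z => eta z.1 * phi z.2) = (fun z => 'D_1 eta z.1 * phi z.2).
Proof.
move=> se sp; rewrite /dt derive_tensor//; apply/funext => z.
by rewrite derive_dir0 mulr0 addr0.
Qed.

Lemma derive_tensor_space (b : R3 R) (eta : R -> R) (phi : R3 R -> R) : smooth eta -> smooth phi ->
  'D_(0, b) (fun z : R * R3 R => eta z.1 * phi z.2) = (fun z => eta z.1 * 'D_b phi z.2).
Proof.
move=> se sp; rewrite derive_tensor//; apply/funext => z.
by rewrite derive_dir0 mul0r add0r.
Qed.

Lemma laplacian_tensor (eta : R -> R) (phi : R3 R -> R) z : smooth eta -> smooth phi ->
  laplacian (fun z => eta z.1 * phi z.2) z =
  eta z.1 * \sum_(i < 3) 'D_(basis3 i) ('D_(basis3 i) phi) z.2.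
Proof.
move=> se sp; rewrite /laplacian mulr_sumr; apply: eq_bigr => i _.
rewrite (derive_tensor_space _ se sp).
exact: (congr1 (fun h => h z) (derive_tensor_space (basis3 i) se (smooth_derive (basis3 i) sp))).
Qed.

Lemma itv_test_integrable (T : R) (f eta : R -> R) : 0 < T -> {in `]0, T[, continuous f} ->
  test_function (`]0, T[) eta ->
  (@lebesgue_measure R).-integrable `]0, T[ (fun t => (f t * eta t)%:E).
Proof.
move=> T0 cf teta; have [se ce sub] := teta.
have [a [b [a0 ab bT ksub]]] := compact_in_itv T0 ce sub.
have int1 : (@lebesgue_measure R).-integrable `[a, b] (fun t => (f t * eta t)%:E).
  apply: (@cont_itv_integrable _ a b (fun t => f t * eta t)) => t; rewrite in_itv /= => /andP[ta tb].
  apply: continuousM; last exact: smooth_continuous.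
  by apply: cf; rewrite in_itv /=; apply/andP; split; [exact: lt_le_trans ta|exact: le_lt_trans bT].
have mk D mD := @integrable_mkcond _ _ R (@lebesgue_measure R) D (fun t => (f t * eta t)%:E) mD.
apply: (mk _ (measurable_itv _)).2; have := (mk _ (measurable_itv _)).1 int1.
apply: eq_integrable => // t _; rewrite /patch.
case: ifPn => tab; case: ifPn => //.
  rewrite notin_setE /= in_itv /= => /negP; rewrite negb_and => h; exfalso.
  move: tab; rewrite inE /= in_itv /= => /andP[h1 h2].
  by move: h; rewrite -!leNgt => /orP[]; lra.
move=> _; have -> : eta t = 0; last by rewrite mulr0.
apply: tsupport_out => /ksub /=; rewrite in_itv /= => /andP[h1 h2].
by move: tab; rewrite notin_setE /= in_itv /= => /negP; rewrite !ltW.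
Qed.
End tensor.

(** * Time derivatives of the energy and of the virial *)

(** The derivative is assumed at the end points, so continuity on the closed
    interval is automatic. *)
Lemma mvt_closed (R : realType) (f df : R -> R) (a b : R) : a <= b ->
  (forall x, a <= x <= b -> is_derive x 1 f (df x)) ->
  exists2 c, a <= c <= b & f b - f a = df c * (b - a).
Proof.
move=> ab H; have [||c] := @MVT_segment _ f df a b ab.
- by move=> x; rewrite in_itv /= => /andP[ax xb]; apply: H; rewrite !ltW.
- apply: continuous_in_subspaceT => x; rewrite inE /= in_itv /= => /H[dx _].
  exact/differentiable_continuous/derivable1_diffP.
by rewrite in_itv /= => ? E; exists c.
Qed.

Lemma sum3 (R : realType) (F : 'I_3 -> R) :
  \sum_(i < 3) F i = F ord0 + F (inord 1) + F (inord 2).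
Proof.
rewrite !big_ord_recr /= big_ord0 add0r.
by congr (_ + _ + _); congr F; apply/val_inj; rewrite /= ?inordK.
Qed.

Lemma neg_sum3 (R : realType) (p q a b c a' b' c' g : R) : p = 1 * q + 1 * c -> q = 1 * a + 1 * b ->
  a = - a' -> b = - b' -> c = - c' -> g = a' + b' + c' -> p = - g.
Proof. by move=> -> -> -> -> -> ->; rewrite !mul1r !opprD. Qed.

Section evolution.
Context {R : realType} (Omega : set (R3 R)).
Local Notation mu := (lebesgue3 R).
Local Notation leb := (@lebesgue_measure R).
Hypothesis oO : open Omega.
Implicit Types (f g h phi w z : R3 R -> R) (s t T B e r : R).
Local Notation I := (integral_over Omega).
Local Notation p6_integrable := (p6_integrable Omega).
Local Notation ip := (inner Omega).
Local Notation gr := (dirichlet Omega).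
Local Notation J := (int_pow6 Omega).
Local Notation N := (int_quintic Omega).
Local Notation H10 := (H10 Omega).
Local Notation W i f := (wderiv Omega i f).
Local Notation sub f g := (fun x => 1 * f x + -1 * g x).
Variables K C : R.
Hypothesis K0 : 0 < K.
Hypothesis C0 : 0 < C.
Hypothesis poin : forall f, H10 f -> ip f f <= K * gr f f.
Hypothesis sob : forall f, H10 f -> p6_integrable f /\ J f <= C * (gr f f) ^+ 3.
Variables u v : R -> R3 R -> R.
Hypothesis Vu : forall t, 0 < t -> H10 (u t).
Hypothesis Vv : forall t, 0 < t -> H10 (v t).
Hypothesis cu : forall t r, 0 < t -> 0 < r ->
  \forall s \near t, gr (sub (u s) (u t)) (sub (u s) (u t)) <= r.
Hypothesis cv : forall t r, 0 < t -> 0 < r ->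
  \forall s \near t, gr (sub (v s) (v t)) (sub (v s) (v t)) <= r.
Hypothesis td : forall T, 0 < T -> is_time_derivative Omega T u v.
Hypothesis se : forall T, 0 < T -> solves_equation Omega T u v.

Let mO : measurable Omega := open_measurable3 oO.

(** The energy written with the forms; the two agree at positive times by
    energy_form. *)
Definition form_energy t : R := 2^-1 * (gr (u t) (u t) + ip (v t) (v t)) + 6^-1 * J (u t).

(** The distribution u_tt as the equation prescribes it, extended from test
    functions to H^1_0. *)
Definition accel t w : R := - gr (u t) w - N (u t) w - form_energy t * ip (v t) w.

Lemma dirichlet_near_bound f g : H10 f -> H10 g -> gr (sub f g) (sub f g) <= 1 ->
  gr f f <= 2 * gr g g + 2.
Proof.
move=> Vf Vg h; have Vz := H10_lin oO 1 (-1) Vf Vg.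
have E : f = (fun x => 1 * (1 * f x + -1 * g x) + 1 * g x) by apply/funext => x; ring.
have := dirichlet_lin_le oO 1 1 (H10_H1 Vz) (H10_H1 Vg); rewrite -E => h'.
apply: (le_trans h'); rewrite expr1n mulr1 addrC lerD2l.
by rewrite -[leRHS]mulr1; apply: (ler_wpM2l (ler0n _ 2)).
Qed.

Lemma dirichlet_subC f g : H10 f -> H10 g -> gr (sub f g) (sub f g) = gr (sub g f) (sub g f).
Proof.
move=> /H10_H1 Hf /H10_H1 Hg; rewrite (dirichlet_sqr_lin oO 1 (-1) Hf Hg) (dirichlet_sqr_lin oO 1 (-1) Hg Hf).
rewrite (dirichletC Omega g f); ring.
Qed.

Definition bounded_near (t B : R) :=
  \forall s \near t, [/\ 0 < s, gr (u s) (u s) <= B & gr (v s) (v s) <= B].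

Lemma near_bound t B0 : 0 < t -> exists B : R, [/\ 0 <= B, B0 <= B & bounded_near t B].
Proof.
move=> t0; have gu := dirichlet_ge0 Omega (u t); have gv := dirichlet_ge0 Omega (v t).
pose Bu := 2 * gr (u t) (u t) + 2; pose Bv := 2 * gr (v t) (v t) + 2.
exists (Num.max B0 (Num.max Bu Bv)).
split.
- by rewrite le_max; apply/orP; right; rewrite le_max; apply/orP; left; apply: addr_ge0 => //; apply: mulr_ge0.
- by rewrite le_max lexx.
- near=> s.
  have s0 : 0 < s by near: s; exact: lt_nbhsr.
  split; first exact: s0.
    apply: (@le_trans _ _ Bu); last by rewrite !le_max lexx orbT.
    by apply: dirichlet_near_bound; [exact: Vu|exact: Vu|near: s; exact: cu].
  apply: (@le_trans _ _ Bv); last by rewrite !le_max lexx !orbT.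
  by apply: dirichlet_near_bound; [exact: Vv|exact: Vv|near: s; exact: cv].
Unshelve. all: by end_near. Qed.

Lemma near_forms t B e : 0 <= B -> bounded_near t B -> 0 < t -> 0 < e ->
  \forall s \near t, [/\ 0 < s, `|form_energy s - form_energy t| <= e & forall w, H10 w -> gr w w <= B ->
    [/\ `|gr (u s) w - gr (u t) w| <= e, `|ip (u s) w - ip (u t) w| <= e,
        `|N (u s) w - N (u t) w| <= e, `|gr (v s) w - gr (v t) w| <= e
      & `|ip (v s) w - ip (v t) w| <= e]].
Proof.
move=> B0 bB t0 e0; have e2 : 0 < e / 2 by rewrite divr_gt0.
have [_ utB vtB] := nbhs_singleton bB.
have [r1 r10 H1] := forms_unif_cont oO K0 C0 poin sob B0 e0.
have [r2 r20 H2] := forms_diag_cont oO K0 C0 poin sob B0 e2.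
near=> s.
have [s0 usB vsB] : [/\ 0 < s, gr (u s) (u s) <= B & gr (v s) (v s) <= B] by near: s; exact: bB.
have zu1 : gr (sub (u s) (u t)) (sub (u s) (u t)) <= r1 by near: s; exact: cu.
have zu2 : gr (sub (u s) (u t)) (sub (u s) (u t)) <= r2 by near: s; exact: cu.
have zv1 : gr (sub (v s) (v t)) (sub (v s) (v t)) <= r1 by near: s; exact: cv.
have zv2 : gr (sub (v s) (v t)) (sub (v s) (v t)) <= r2 by near: s; exact: cv.
split; first exact: s0.
  have [h1 _ h3] := H2 _ _ (Vu s0) (Vu t0) usB utB zu2.
  have [_ h2 _] := H2 _ _ (Vv s0) (Vv t0) vsB vtB zv2.
  rewrite /form_energy; move: h1 h2 h3.
  move: (gr (u s) (u s)) (gr (u t) (u t)) (ip (v s) (v s)) (ip (v t) (v t)) (J (u s)) (J (u t)).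
  move=> a a' b b' c c'; rewrite !ler_norml => /andP[? ?] /andP[? ?] /andP[? ?].
  apply/andP; split; lra.
move=> w Vw wB.
have [h1 h2 h3] := H1 _ _ (Vu s0) (Vu t0) usB utB zu1 _ Vw wB.
by have [h4 h5 _] := H1 _ _ (Vv s0) (Vv t0) vsB vtB zv1 _ Vw wB.
Unshelve. all: by end_near. Qed.

Lemma inner_cross (f g : R3 R -> R) B : H10 f -> H10 g -> gr f f <= B -> gr g g <= B ->
  `|ip f g| <= 2 * (K * B).
Proof.
move=> Vf Vg fB gB.
have := inner_young mO ltr01 (H10_sq_integrable oO Vf) (H10_sq_integrable oO Vg); rewrite invr1 !mul1r => h.
apply: (le_trans h); have h1 := inner_bound K0 poin fB Vf; have h2 := inner_bound K0 poin gB Vg.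
by rewrite mulr_natl mulr2n; exact: lerD.
Qed.

(** Here E itself is a continuous function of t, being built from the same
    forms. *)
Lemma near_accel t B e : 0 <= B -> bounded_near t B -> 0 < t -> 0 < e ->
  \forall s \near t, 0 < s /\ forall w, H10 w -> gr w w <= B -> `|accel s w - accel t w| <= e.
Proof.
move=> B0 bB t0 e0; have [_ utB vtB] := nbhs_singleton bB.
(* One unit for each of the Dirichlet and quintic terms, the rest for the
   product of E and the kinetic pairing. *)
pose M := 2 + (`|form_energy t| + 1) + 2 * (K * B).
have KB : 0 <= 2 * (K * B) by rewrite mulr_ge0// mulr_ge0// ltW.
have M0 : 0 <= M by rewrite /M !addr_ge0.
have [a [a0 a1 ha]] := small_factor M0 e0.
have := near_forms B0 bB t0 a0; apply: filterS => s [s0 hE H]; split; first exact: s0.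
move=> w Vw wB; have [h1 _ h2 _ h3] := H w Vw wB.
have h4 := inner_cross (Vv t0) Vw vtB wB.
have hs : `|form_energy s| <= `|form_energy t| + 1.
  rewrite -[form_energy s](subrK (form_energy t)) addrC; apply: (le_trans (ler_normD _ _)).
  by rewrite lerD2l; exact: le_trans hE a1.
apply: le_trans ha; rewrite /M /accel.
have -> : - gr (u s) w - N (u s) w - form_energy s * ip (v s) w - (- gr (u t) w - N (u t) w - form_energy t * ip (v t) w)
  = - (gr (u s) w - gr (u t) w) - (N (u s) w - N (u t) w) - form_energy s * (ip (v s) w - ip (v t) w)
    - (form_energy s - form_energy t) * ip (v t) w.
  move: (gr (u s) w) (gr (u t) w) (ip (v s) w) (ip (v t) w) (N (u s) w) (N (u t) w) (form_energy s) (form_energy t).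
  clear => *; ring.
apply: (le_trans (ler_normB _ _)).
have -> : a * (2 + (`|form_energy t| + 1) + 2 * (K * B)) = a * 2 + a * (`|form_energy t| + 1) + a * (2 * (K * B)).
  by rewrite !mulrDr.
apply: lerD; last first.
  by rewrite normrM; apply: ler_pM => //; exact: normr_ge0.
apply: (le_trans (ler_normB _ _)); apply: lerD; last first.
  by rewrite normrM mulrC; apply: ler_pM => //; exact: normr_ge0.
apply: (le_trans (ler_normB _ _)); rewrite normrN mulr_natr mulr2n; exact: lerD.
Qed.

Lemma cont_at (f : R -> R) (t : R) :
  (forall e, 0 < e -> \forall s \near t, `|f s - f t| <= e) -> {for t, continuous f}.
Proof.
move=> H; apply/cvgrPdist_le => e e0; have := H _ e0.
by apply: filterS => s; rewrite distrC.
Qed.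

Lemma cont_inner_u t phi : test_function Omega phi -> 0 < t ->
  {for t, continuous (fun s => ip (u s) phi)}.
Proof.
move=> tphi t0; have [B [B0 pB bB]] := near_bound (gr phi phi) t0.
apply: cont_at => e e0; have := near_forms B0 bB t0 e0.
by apply: filterS => s [_ _ /(_ _ (test_H10 oO tphi) pB) []].
Qed.

Lemma cont_inner_v t phi : test_function Omega phi -> 0 < t ->
  {for t, continuous (fun s => ip (v s) phi)}.
Proof.
move=> tphi t0; have [B [B0 pB bB]] := near_bound (gr phi phi) t0.
apply: cont_at => e e0; have := near_forms B0 bB t0 e0.
by apply: filterS => s [_ _ /(_ _ (test_H10 oO tphi) pB) []].
Qed.

Lemma cont_accel t phi : test_function Omega phi -> 0 < t ->
  {for t, continuous (fun s => accel s phi)}.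
Proof.
move=> tphi t0; have [B [B0 pB bB]] := near_bound (gr phi phi) t0.
apply: cont_at => e e0; have := near_accel B0 bB t0 e0.
by apply: filterS => s [_ /(_ _ (test_H10 oO tphi) pB)].
Qed.

(** The definition of the time derivative, tested with eta(t) phi(x). *)
Lemma u_parts T eta phi : 0 < T -> test_function (`]0, T[) eta -> test_function Omega phi ->
  \int[leb]_(t in `]0, T[) (ip (u t) phi * 'D_1 eta t) =
  - \int[leb]_(t in `]0, T[) (ip (v t) phi * eta t).
Proof.
move=> T0 teta tphi; have := td T0 (test_function_tensor teta tphi).
have [seta _ _] := teta; have [sphi _ _] := tphi; have Lp := test_sq_integrable mO tphi.
have pos t : t \in [set` `]0, T[] -> 0 < t.
  by rewrite inE /= in_itv /= => /andP[].
rewrite (_ : \int[leb]_(t in `]0, T[) \int[mu]_(x in Omega) _ =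
  \int[leb]_(t in `]0, T[) (ip (u t) phi * 'D_1 eta t)); last first.
  apply: eq_Rintegral => t /pos t0; rewrite (dt_tensor seta sphi) -(integral_overE Omega) innerE mulrC.
  have Lu := H10_sq_integrable oO (Vu t0).
  rewrite -(integral_overZ mO ('D_1 eta t) (sq_integrableM mO Lu Lp)); apply: eq_integral_over => x _.
  by rewrite /= mulrCA.
rewrite (_ : \int[leb]_(t in `]0, T[) \int[mu]_(x in Omega) _ =
  \int[leb]_(t in `]0, T[) (ip (v t) phi * eta t))//.
apply: eq_Rintegral => t /pos t0; rewrite -(integral_overE Omega) innerE mulrC.
have Lu := H10_sq_integrable oO (Vv t0).
rewrite -(integral_overZ mO (eta t) (sq_integrableM mO Lu Lp)); apply: eq_integral_over => x _.
by rewrite /= mulrCA.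
Qed.

Lemma u_derive t phi : 0 < t -> test_function Omega phi ->
  is_derive t 1 (fun s => ip (u s) phi) (ip (v t) phi).
Proof.
move=> t0 tphi; pose T := t + 1; have T0 : 0 < T by rewrite addr_gt0.
have pos s : s \in `]0, T[ -> 0 < s by rewrite in_itv /= => /andP[].
apply: (@weak_is_derive _ T (fun s => ip (u s) phi) (fun s => ip (v s) phi)).
- by move=> s /pos s0; exact: cont_inner_u.
- by move=> s /pos s0; exact: cont_inner_v.
- by move=> eta teta; exact: u_parts.
- by rewrite in_itv /= t0 ltrDl ltr01.
Qed.

Definition space_laplacian phi := (fun x => \sum_(i < 3) 'D_(basis3 i) ('D_(basis3 i) phi) x).

Lemma space_laplacianE phi : space_laplacian phi = (fun x =>
  1 * (1 * 'D_(basis3 ord0) ('D_(basis3 ord0) phi) x +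
       1 * 'D_(basis3 (inord 1)) ('D_(basis3 (inord 1)) phi) x) +
  1 * 'D_(basis3 (inord 2)) ('D_(basis3 (inord 2)) phi) x).
Proof.
apply/funext => x; rewrite /space_laplacian sum3.
move: ('D_(basis3 ord0) _ x) ('D_(basis3 (inord 1)) _ x) ('D_(basis3 (inord 2)) _ x) => a b c.
clear; ring.
Qed.

Lemma test_space_laplacian phi : test_function Omega phi -> test_function Omega (space_laplacian phi).
Proof.
move=> tphi; rewrite space_laplacianE.
have tD i := test_function_derive (basis3 i) (test_function_derive (basis3 i) tphi).
apply: test_functionD; last exact: test_functionZ.
by apply: test_functionZ; apply: test_functionD; exact: test_functionZ.
Qed.

Lemma inner_laplacian f phi : H1 Omega f -> test_function Omega phi -> ip f (space_laplacian phi) = - gr f phi.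
Proof.
move=> Hf tphi; have Lf := H1_sq_integrable oO Hf.
have tD i := test_function_derive (basis3 i) tphi.
have LD i := test_sq_integrable mO (test_function_derive (basis3 i) (tD i)).
have key i : ip f ('D_(basis3 i) ('D_(basis3 i) phi)) = - ip (W i f) (W i phi).
  have [_ _ h] := H1_is_weak_deriv i Hf; have := h _ (tD i); rewrite -!(integral_overE Omega) -!innerE => ->.
  congr (- _); apply: (ae_inner mO (wderiv_sq_integrable oO i Hf) (wderiv_sq_integrable oO i Hf)).
  - exact: (test_sq_integrable mO (tD i)).
  - exact: (wderiv_sq_integrable oO i (test_H1 oO tphi)).
  - exact: aeW.
  - by have := wderiv_test oO i tphi; move/ae_imply; apply => x H /H ->.
rewrite space_laplacianE.
have e2 := inner_linr oO 1 1 (sq_integrable_lin oO 1 1 (LD ord0) (LD (inord 1))) (LD (inord 2)) Lf.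
have e1 := inner_linr oO 1 1 (LD ord0) (LD (inord 1)) Lf.
exact: (neg_sum3 e2 e1 (key _) (key _) (key _) (etrans (dirichletE _ _ _) (sum3 _))).
Qed.

(** The Dirichlet form with a test function is minus the pairing with its
    Laplacian, another test function. *)
Lemma dirichlet_u_derive t phi : 0 < t -> test_function Omega phi ->
  is_derive t 1 (fun s => gr (u s) phi) (gr (v t) phi).
Proof.
move=> t0 tphi; have d := u_derive t0 (test_space_laplacian tphi).
have := is_deriveN d; rewrite (inner_laplacian (H10_H1 (Vv t0)) tphi) opprK => -[dN eN].
have nE : \near t, (- (fun s => ip (u s) (space_laplacian phi))) t = gr (u t) phi.
  have := lt_nbhsr t0; apply: filterS => s s0 /=.
  by rewrite /= fctE (inner_laplacian (H10_H1 (Vu s0)) tphi) opprK.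
split; first by apply: near_eq_derivable nE dN.
by rewrite -(near_eq_derive _ nE).
Qed.

Lemma energy_form t : 0 < t -> energy Omega u v t = form_energy t.
Proof.
move=> t0; have [L6u _] := sob (Vu t0); rewrite /energy /form_energy (grad_sqnormE oO (H10_H1 (Vu t0))).
by rewrite (Lpnorm2 mO (H10_sq_integrable oO (Vv t0))) (Lpnorm6 mO L6u) int_pow6E.
Qed.

Lemma equation_inner t T eta phi : 0 < t -> test_function (`]0, T[) eta -> test_function Omega phi ->
  let psi := fun z : R * R3 R => eta z.1 * phi z.2 in
  \int[mu]_(x in Omega)
      (u t x * dt (dt psi) (t, x) - u t x * laplacian psi (t, x)
       + u t x ^+ 5 * psi (t, x) + energy Omega u v t * v t x * psi (t, x)) =
  ip (u t) phi * 'D_1 ('D_1 eta) t - accel t phi * eta t.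
Proof.
move=> t0 teta tphi psi; have [seta _ _] := teta; have [sphi _ _] := tphi.
have Lp := test_sq_integrable mO tphi; have Ll := test_sq_integrable mO (test_space_laplacian tphi).
have Lu := H10_sq_integrable oO (Vu t0); have Lv := H10_sq_integrable oO (Vv t0).
have [L6u _] := sob (Vu t0); have L6p := test_p6_integrable mO tphi.
have Een := energy_form t0.
rewrite -(integral_overE Omega).
pose a := 'D_1 ('D_1 eta) t; pose b := eta t; pose E := form_energy t.
have i1 := integrable_onZ mO a (sq_integrableM mO Lu Lp).
have i2 := integrable_onZ mO b (sq_integrableM mO Lu Ll).
have i3 := integrable_onZ mO b (integrable_on_quintic oO L6u L6p).
have i4 := integrable_onZ mO (b * E) (sq_integrableM mO Lv Lp).
transitivity (I (fun x => a * (u t x * phi x) - b * (u t x * space_laplacian phi x)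
   + b * (u t x ^+ 5 * phi x) + (b * E) * (v t x * phi x))).
  apply: eq_integral_over => x _; rewrite /psi Een (dt_tensor seta sphi).
  rewrite (dt_tensor (smooth_derive (1 : R) seta) sphi) (laplacian_tensor _ seta sphi) /= -/a -/b -/E.
  rewrite -/(space_laplacian phi x); move: (u t x) (phi x) (space_laplacian phi x) (v t x) a b E {i1 i2 i3 i4} => *.
  ring.
rewrite (integral_overD mO (integrable_onD mO (integrable_onB mO i1 i2) i3) i4) (integral_overD mO (integrable_onB mO i1 i2) i3) (integral_overB mO i1 i2).
rewrite (integral_overZ mO a (sq_integrableM mO Lu Lp)) (integral_overZ mO b (sq_integrableM mO Lu Ll)) (integral_overZ mO b (integrable_on_quintic oO L6u L6p)).
rewrite (integral_overZ mO (b * E) (sq_integrableM mO Lv Lp)) -(innerE Omega (u t) phi) -(innerE Omega (u t) (space_laplacian phi)) -(innerE Omega (v t) phi) (inner_laplacian (H10_H1 (Vu t0)) tphi) -(int_quinticE Omega (u t) phi) /accel -/b -/E -/a.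
move: (ip (u t) phi) (gr (u t) phi) (N (u t) phi) (ip (v t) phi) a b E {i1 i2 i3 i4} => *.
ring.
Qed.

(** The equation tested with eta(t) phi(x) reads: the integral of (u, phi)
    eta'' equals that of A_t(phi) eta.  By u_parts with eta' in place of eta,
    the left-hand side is minus the integral of (v, phi) eta'. *)
Lemma v_derive t phi : 0 < t -> test_function Omega phi ->
  is_derive t 1 (fun s => ip (v s) phi) (accel t phi).
Proof.
move=> t0 tphi; pose T := t + 1; have T0 : 0 < T by rewrite addr_gt0.
have pos s : s \in `]0, T[ -> 0 < s by rewrite in_itv /= => /andP[].
apply: (@weak_is_derive _ T (fun s => ip (v s) phi) (fun s => accel s phi)).
- by move=> s /pos s0; exact: cont_inner_v.
- by move=> s /pos s0; exact: cont_accel.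
- move=> eta teta; have tD := test_function_derive (1 : R) teta.
  have cU : {in `]0, T[, continuous (fun s => ip (u s) phi)} by move=> s /pos s0; exact: cont_inner_u.
  have cA : {in `]0, T[, continuous (fun s => accel s phi)} by move=> s /pos s0; exact: cont_accel.
  have iU := itv_test_integrable T0 cU (test_function_derive (1 : R) tD).
  have iA := itv_test_integrable T0 cA teta.
  have := se T0 (test_function_tensor teta tphi).
  rewrite (_ : \int[leb]_(t in `]0, T[) \int[mu]_(x in Omega) _ =
    \int[leb]_(t in `]0, T[) (ip (u t) phi * 'D_1 ('D_1 eta) t - accel t phi * eta t)); last first.
    apply: eq_Rintegral => s sT; apply: (equation_inner _ teta tphi).
    by move: sT; rewrite inE; exact: pos.
  rewrite (@RintegralB _ _ R leb `]0, T[ (fun s => ip (u s) phi * 'D_1 ('D_1 eta) s) (fun s => accel s phi * eta s)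
    (measurable_itv _) iU iA) => /eqP; rewrite subr_eq0 => /eqP <-.
  by rewrite (u_parts T0 tD tphi) opprK.
- by rewrite in_itv /= t0 ltrDl ltr01.
Qed.

Lemma accel_lin t (a b : R) w1 w2 : 0 < t -> H10 w1 -> H10 w2 ->
  accel t (fun x => a * w1 x + b * w2 x) = a * accel t w1 + b * accel t w2.
Proof.
move=> t0 V1 V2; have [Lu _] := sob (Vu t0); have [L1 _] := sob V1; have [L2' _] := sob V2.
rewrite /accel (dirichlet_linr oO a b (H10_H1 V1) (H10_H1 V2) (H10_H1 (Vu t0))) (int_quintic_lin oO a b Lu L1 L2').
rewrite (inner_linr oO a b (H10_sq_integrable oO V1) (H10_sq_integrable oO V2) (H10_sq_integrable oO (Vv t0))).
move: (gr _ _) (gr _ _) (N _ _) (N _ _) (ip _ _) (ip _ _) (form_energy t) => *; ring.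
Qed.

Lemma accel_small t e : 0 < t -> 0 < e -> exists2 r : R, 0 < r & forall z, H10 z -> gr z z <= r ->
  `|accel t z| <= e.
Proof.
move=> t0 e0; have gu := dirichlet_ge0 Omega (u t); have gv := dirichlet_ge0 Omega (v t).
have M0 : 0 <= 2 + `|form_energy t| by rewrite addr_ge0.
have [a [a0 _ ha]] := small_factor M0 e0.
have [r r0 H] := forms_small oO K0 C0 poin sob (addr_ge0 gu gv) a0.
exists r => // z Vz zr.
have [h1 _ h2] := H _ _ (Vu t0) Vz (ler_wpDr gv (lexx _)) zr.
have [_ h3 _] := H _ _ (Vv t0) Vz (ler_wpDl gu (lexx _)) zr.
apply: le_trans ha; rewrite /accel mulrDr; apply: (le_trans (ler_normB _ _)); apply: lerD.
  by apply: (le_trans (ler_normB _ _)); rewrite normrN mulr_natr mulr2n; exact: lerD.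
by rewrite normrM mulrC; apply: ler_pM.
Qed.

(** The form of the mean value theorem that does not ask on which side of t the
    point s lies. *)
Lemma mvt_around (f df : R -> R) t d s : (forall r, `|r - t| < d -> is_derive r 1 f (df r)) ->
  `|s - t| < d -> exists2 c, `|c - t| < d & f s - f t = df c * (s - t).
Proof.
move=> H sd.
have aux a b : a <= b -> (forall r, a <= r <= b -> `|r - t| < d) ->
    exists2 c, `|c - t| < d & f b - f a = df c * (b - a).
  move=> ab hr; have [|c cab E] := @mvt_closed _ f df a b ab; first by move=> x /hr; exact: H.
  by exists c => //; exact: hr.
move: sd; rewrite ltr_norml => /andP[s1 s2].
have [st|ts] := leP s t.
  have [|c cd E] := aux s t st.
    by move=> r /andP[r1 r2]; rewrite ltr_norml; apply/andP; split; lra.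
  by exists c => //; rewrite -opprB E -[s - t]opprB mulrN.
have [|c cd E] := aux t s (ltW ts); last by exists c.
by move=> r /andP[r1 r2]; rewrite ltr_norml; apply/andP; split; lra.
Qed.

Lemma dirichlet_le_H1sq f : gr f f <= H1sq Omega f.
Proof. by rewrite /H1sq lerDr inner_ge0. Qed.

(** For a test function the increment is (s - t) A_c(w) for some c between s
    and t, and A_c - A_t is small uniformly over bounded w.  Both sides are
    continuous in w for fixed s, so density extends this to H^1_0. *)
Lemma v_increment t B e : 0 <= B -> 0 < t -> 0 < e ->
  \forall s \near t, forall w, H10 w -> gr w w <= B ->
    `|ip (v s) w - ip (v t) w - (s - t) * accel t w| <= e * `|s - t|.
Proof.
move=> B0 t0 e0; have e2 : 0 < e / 2 by rewrite divr_gt0.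
(* Test functions close to w with Dirichlet integral at most B may reach 2 B +
   2. *)
have [B1 [B10 BB bB]] := near_bound (2 * B + 2) t0.
have [d [d0 Hd]] := near_radius (near_accel B10 bB t0 e2).
near=> s.
have sd : `|s - t| < d.
  rewrite distrC; near: s; exact: (@nbhsx_ballx _ R t d d0).
have [s0 _] := Hd s sd.
have test phi : test_function Omega phi -> gr phi phi <= B1 ->
    `|ip (v s) phi - ip (v t) phi - (s - t) * accel t phi| <= e / 2 * `|s - t|.
  move=> tphi pB.
  have [|c cd ->] := @mvt_around (fun r => ip (v r) phi) (fun r => accel r phi) t d s _ sd.
    by move=> r /Hd[r0 _]; exact: v_derive.
  have [_ Hc] := Hd c cd.
  rewrite [(s - t) * _]mulrC -mulrBl normrM; apply: ler_wpM2r => //.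
  exact: Hc (test_H10 oO tphi) pB.
move=> w Vw wB.
have [->|st] := eqVneq s t; first by rewrite !subrr mul0r subr0 normr0 mulr0.
have m0 : 0 < `|s - t| by rewrite normr_gt0 subr_eq0.
have eta0 : 0 < e / 2 * `|s - t| by rewrite mulr_gt0.
(* With s fixed, phi is chosen so close to w that the three pairings with w -
   phi cost at most e / 2 * |s - t|. *)
have M0 : 0 <= 2 + `|s - t| * (1 : R) by rewrite mulr1 addr_ge0.
have [a [a0 a1 ha]] := small_factor M0 eta0.
have gv := dirichlet_ge0 Omega (v t); have gs := dirichlet_ge0 Omega (v s).
have [r1 r10 H1] := forms_small oO K0 C0 poin sob (addr_ge0 gv gs) a0.
have [r2 r20 H2] := accel_small t0 a0.
pose r := Num.min 1 (Num.min r1 r2).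
have r0 : 0 < r by rewrite !lt_min ltr01 r10 r20.
have [phi tphi hq] := H10_approx oO r0 Vw.
have Vp := test_H10 oO tphi; have Vz := H10_lin oO 1 (-1) Vw Vp.
have zr : gr (sub w phi) (sub w phi) <= r by apply: (le_trans (dirichlet_le_H1sq _)); exact: ltW.
have [zr0 zr1 zr2] : [/\ gr (sub w phi) (sub w phi) <= 1, gr (sub w phi) (sub w phi) <= r1
    & gr (sub w phi) (sub w phi) <= r2].
  by move: zr; rewrite !le_min => /andP[? /andP[]].
have pB : gr phi phi <= B1.
  apply: le_trans BB; apply: (@le_trans _ _ (2 * gr w w + 2)).
    apply: dirichlet_near_bound => //.
    by rewrite (dirichlet_subC Vp Vw).
  by rewrite lerD2r; apply: (ler_wpM2l (ler0n _ 2)).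
have h := test _ tphi pB.
have [_ h1 _] := H1 _ _ (Vv t0) Vz (ler_wpDr gs (lexx _)) zr1.
have [_ h2 _] := H1 _ _ (Vv s0) Vz (ler_wpDl gv (lexx _)) zr1.
have h3 := H2 _ Vz zr2.
have Ev r' : 0 < r' -> ip (v r') w = ip (v r') phi + ip (v r') (sub w phi).
  move=> r'0; rewrite (inner_linr oO 1 (-1) (H10_sq_integrable oO Vw) (H10_sq_integrable oO Vp) (H10_sq_integrable oO (Vv r'0))).
  by rewrite mul1r mulN1r addrC subrK.
have EA : accel t w = accel t phi + accel t (sub w phi).
  by rewrite (accel_lin 1 (-1) t0 Vw Vp) mul1r mulN1r addrC subrK.
rewrite (Ev s s0) (Ev t t0) EA.
have -> : ip (v s) phi + ip (v s) (sub w phi) - (ip (v t) phi + ip (v t) (sub w phi)) -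
   (s - t) * (accel t phi + accel t (sub w phi)) = (ip (v s) phi - ip (v t) phi - (s - t) * accel t phi) +
   (ip (v s) (sub w phi) - ip (v t) (sub w phi) - (s - t) * accel t (sub w phi)).
  move: (ip (v s) phi) (ip (v t) phi) (accel t phi) (ip (v s) _) (ip (v t) _) (accel t _) => *; ring.
have -> : e * `|s - t| = e / 2 * `|s - t| + e / 2 * `|s - t| by rewrite -mulrDl -splitr.
apply: (le_trans (ler_normD _ _)); apply: lerD; first exact: h.
apply: le_trans ha; rewrite [a * (2 + _)]mulrDr mulr1.
apply: (le_trans (ler_normB _ _)); apply: lerD.
  by apply: (le_trans (ler_normB _ _)); rewrite mulr_natr mulr2n; exact: lerD.
by rewrite normrM mulrC; apply: ler_wpM2r.
Unshelve. all: by end_near. Qed.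

Local Notation rem t s := (fun x => 1 * (1 * u s x + -1 * u t x) + - (s - t) * v t x).

Lemma H10_rem s t : 0 < s -> 0 < t -> H10 (rem t s).
Proof. by move=> s0 t0; exact: (H10_lin oO _ _ (H10_lin oO _ _ (Vu s0) (Vu t0)) (Vv t0)). Qed.

(** The arithmetic closing u_increment: g is the Dirichlet integral of the
    remainder z, y that of z - phi, p that of phi, and A' the size of the
    Dirichlet form of z and phi. *)
Lemma remainder_bound (g y p m eta' A' : R) : 0 <= y -> y <= m ^+ 2 * eta' ->
  p <= 2 * g + 2 * y -> g <= A' + (4^-1 * g + 4 * y) ->
  A' <= 16 * m ^+ 2 * eta' + 16^-1 * p -> g <= 34 * (m ^+ 2 * eta').
Proof.
move=> y0 hy hp hg hA.
move: hA hy; rewrite -mulrA; move: (m ^+ 2 * eta') => q hA hy; lra.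
Qed.

(** Let z be the remainder u(s) - u(t) - (s - t) v(t).  For a test function phi
    the mean value theorem gives the Dirichlet form of z and phi as (s - t)
    times that of v(c) - v(t) and phi, which is o(s - t) times the norm of phi.
    Taking phi close to z bounds the norm of z by o(s - t). *)
Lemma u_increment t e : 0 < t -> 0 < e ->
  \forall s \near t, 0 < s /\ gr (rem t s) (rem t s) <= e * (s - t) ^+ 2.
Proof.
move=> t0 e0; pose eta' := e / 34%:R.
have eta0 : 0 < eta' by rewrite divr_gt0.
have eE : eta' * 34%:R = e by rewrite /eta' divfK.
clearbody eta'.
have Hn : \forall s \near t, 0 < s /\ gr (sub (v s) (v t)) (sub (v s) (v t)) <= eta'.
  by near=> s; split; [near: s; exact: lt_nbhsr|near: s; exact: cv].
have [d [d0 Hd]] := near_radius Hn.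
near=> s.
have sd : `|s - t| < d.
  rewrite distrC; near: s; exact: (@nbhsx_ballx _ R t d d0).
have [s0 _] := Hd s sd; split; first exact: s0.
have Vz := H10_rem s0 t0; have Hz := H10_H1 Vz.
have [st|st] := eqVneq s t.
  rewrite st subrr expr0n mulr0.
  have -> : (fun x => 1 * (1 * u t x + -1 * u t x) + - 0 * v t x) = (fun x => 0 * u t x + 0 * u t x).
    by apply/funext => x; ring.
  rewrite (dirichlet_sqr_lin oO 0 0 (H10_H1 (Vu t0)) (H10_H1 (Vu t0))).
  by move: (gr _ _) => a; rewrite (_ : _ + _ = 0) ?lexx//; ring.
have m0 : 0 < `|s - t| by rewrite normr_gt0 subr_eq0.
pose m := `|s - t|; rewrite -[(s - t) ^+ 2]real_normK ?num_real// -/m.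
have y0' : 0 < m ^+ 2 * eta' by rewrite mulr_gt0// exprn_gt0.
have [phi tphi hq] := H10_approx oO y0' Vz.
have Vp := test_H10 oO tphi; have Hp := H10_H1 Vp.
set z := (fun x => 1 * (1 * u s x + -1 * u t x) + - (s - t) * v t x) in Vz Hz hq *.
have Vy := H10_lin oO 1 (-1) Vz Vp; have Hy := H10_H1 Vy.
have hy := le_trans (dirichlet_le_H1sq _) (ltW hq).
have [c cd Ec] : exists2 c, `|c - t| < d & gr z phi = (s - t) * gr (sub (v c) (v t)) phi.
  have [|c cd E] := @mvt_around (fun r => gr (u r) phi) (fun r => gr (v r) phi) t d s _ sd.
    by move=> r /Hd[r0 _]; exact: dirichlet_u_derive.
  exists c => //; have [c0 _] := Hd c cd.
  rewrite /z (dirichlet_linl oO 1 (- (s - t)) (H10_H1 (H10_lin oO 1 (-1) (Vu s0) (Vu t0))) (H10_H1 (Vv t0)) Hp).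
  rewrite (dirichlet_linl oO 1 (-1) (H10_H1 (Vu s0)) (H10_H1 (Vu t0)) Hp).
  rewrite (dirichlet_linl oO 1 (-1) (H10_H1 (Vv c0)) (H10_H1 (Vv t0)) Hp).
  rewrite !mul1r !mulN1r E; ring.
have [c0 hc] := Hd c cd.
have -> : e * m ^+ 2 = 34 * (m ^+ 2 * eta').
  by rewrite -[e in LHS]eE; ring.
have d4 : 0 < 4 :> R by [].
(* Weights for the two Young inequalities: 4 for (z, z - phi), 1/(16 m) for the
   increment of v against phi. *)
have dm : 0 < (16 * m)^-1 by rewrite invr_gt0 mulr_gt0.
apply: (@remainder_bound _ (gr (sub z phi) (sub z phi)) (gr phi phi) m eta' `|gr z phi|).
- exact: dirichlet_ge0.
- exact: hy.
- have E : phi = (fun x => 1 * z x + -1 * (1 * z x + -1 * phi x)) by apply/funext => x; ring.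
  have := dirichlet_lin_le oO 1 (-1) Hz Hy; rewrite -E => h; apply: (le_trans h).
  by rewrite expr1n sqrrN expr1n !mulr1.
- have E : gr z z = gr z phi + gr z (sub z phi).
    rewrite (dirichlet_linr oO 1 (-1) Hz Hp Hz) mul1r mulN1r; ring.
  rewrite {1}E; apply: lerD; first exact: ler_norm.
  exact: le_trans (ler_norm _) (dirichlet_young oO d4 Hz Hy).
- rewrite Ec normrM -/m.
  have h := dirichlet_young oO dm (H10_H1 (H10_lin oO 1 (-1) (Vv c0) (Vv t0))) Hp.
  apply: (le_trans (ler_wpM2l (ltW m0) h)); rewrite invrK mulrDr; apply: lerD.
    have -> : 16 * m ^+ 2 * eta' = m * (16 * m * eta') by ring.
    apply: (ler_wpM2l (ltW m0)); apply: ler_wpM2l hc.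
    by apply: mulr_ge0 => //; exact: ltW.
  by rewrite mulrA invfM mulrCA mulfV ?mulr1 ?gt_eqF.
Unshelve. all: by end_near. Qed.

Definition small_remainder t e s :=
  [/\ 0 < s, gr (rem t s) (rem t s) <= e * (s - t) ^+ 2, `|gr (u t) (rem t s)| <= e * `|s - t|,
      `|ip (v t) (rem t s)| <= e * `|s - t| & `|N (u t) (rem t s)| <= e * `|s - t|].

(** The three forms are linear in the remainder z, so the smallness of z / |s -
    t| in H^1_0 suffices. *)
Lemma u_increment_forms t e : 0 < t -> 0 < e -> \forall s \near t, small_remainder t e s.
Proof.
move=> t0 e0; have gu := dirichlet_ge0 Omega (u t); have gv := dirichlet_ge0 Omega (v t).
have [r0 r00 H] := forms_small oO K0 C0 poin sob (addr_ge0 gu gv) e0.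
have rr : 0 < Num.min r0 e by rewrite lt_min r00.
have := u_increment t0 rr; apply: filterS => s [s0 hz]; rewrite /small_remainder.
have Vz := H10_rem s0 t0; have Hz := H10_H1 Vz.
have hz2 : gr (rem t s) (rem t s) <= e * (s - t) ^+ 2.
  by apply: (le_trans hz); apply: ler_wpM2r; [exact: sqr_ge0|rewrite ge_min lexx orbT].
have hz1 : gr (rem t s) (rem t s) <= r0 * (s - t) ^+ 2.
  by apply: (le_trans hz); apply: ler_wpM2r; [exact: sqr_ge0|rewrite ge_min lexx].
have [st|st] := eqVneq s t.
  have Hu := H10_H1 (Vu t0); have Lu := H10_sq_integrable oO (Vu t0); have [L6u _] := sob (Vu t0).
  rewrite st subrr expr0n !mulr0 normr0 mulr0.
  have -> : (fun x => 1 * (1 * u t x + -1 * u t x) + - 0 * v t x) = (fun x => 0 * u t x + 0 * u t x).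
    by apply/funext => x; ring.
  rewrite (dirichlet_sqr_lin oO 0 0 Hu Hu) (dirichlet_linr oO 0 0 Hu Hu Hu) (int_quintic_lin oO 0 0 L6u L6u L6u).
  rewrite (inner_linr oO 0 0 Lu Lu (H10_sq_integrable oO (Vv t0))) expr0n /= !mulr0 !mul0r !addr0 normr0.
  by split.
move: Vz Hz hz1 hz2; move: (rem t s) => z Vz Hz hz1 hz2.
pose m := `|s - t|.
have m0 : 0 < m by rewrite normr_gt0 subr_eq0.
have Vz' := H10_lin oO m^-1 0 Vz Vz.
have gz' : gr (fun x => m^-1 * z x + 0 * z x) (fun x => m^-1 * z x + 0 * z x) <= r0.
  rewrite (dirichlet_sqr_lin oO _ _ Hz Hz) !mulr0 !mul0r addr0 expr0n mul0r addr0.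
  by rewrite exprVn mulrC ler_pdivrMr ?exprn_gt0// /m real_normK ?num_real.
have [a1 _ a3] := H _ _ (Vu t0) Vz' (ler_wpDr gv (lexx _)) gz'.
have [_ a2 _] := H _ _ (Vv t0) Vz' (ler_wpDl gu (lexx _)) gz'.
have [Lu _] := sob (Vu t0); have [Lz _] := sob Vz.
have fin (a : R) : `|m^-1 * a + 0 * a| <= e -> `|a| <= e * m.
  by rewrite mul0r addr0 normrM gtr0_norm ?invr_gt0// mulrC ler_pdivrMr.
split; [exact: s0|exact: hz2|apply: fin..].
- by move: a1; rewrite (dirichlet_linr oO _ _ Hz Hz (H10_H1 (Vu t0))).
- by move: a2; rewrite (inner_linr oO _ _ (H10_sq_integrable oO Vz) (H10_sq_integrable oO Vz) (H10_sq_integrable oO (Vv t0))).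
- by move: a3; rewrite (int_quintic_lin oO _ _ Lu Lz Lz).
Qed.

Lemma u_step t s : u s = (fun x => 1 * u t x + 1 * (1 * u s x + -1 * u t x)).
Proof. by apply/funext => x; ring. Qed.

Lemma u_step_rem t s : (fun x => 1 * u s x + -1 * u t x) =
  (fun x => 1 * (1 * (1 * u s x + -1 * u t x) + - (s - t) * v t x) + (s - t) * v t x).
Proof. by apply/funext => x; ring. Qed.

Lemma u_lipschitz t : 0 < t -> exists2 c : R, 0 < c & \forall s \near t, 0 < s /\
  gr (sub (u s) (u t)) (sub (u s) (u t)) <= c * (s - t) ^+ 2.
Proof.
move=> t0; have gv := dirichlet_ge0 Omega (v t); exists (2 + 2 * gr (v t) (v t)).
  by apply: ltr_wpDr => //; apply: mulr_ge0.
have := u_increment t0 ltr01; apply: filterS => s [s0 hz]; split; first exact: s0.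
have Vz := H10_rem s0 t0; rewrite u_step_rem.
apply: (le_trans (dirichlet_lin_le oO 1 (s - t) (H10_H1 Vz) (H10_H1 (Vv t0)))).
move: hz; move: (gr (rem t s) (rem t s)) (gr (v t) (v t)) ((s - t) ^+ 2) => a b c; rewrite mul1r => h.
by rewrite expr1n mulr1 [leRHS]mulrDl; apply: lerD; [apply: ler_wpM2l|rewrite mulrAC].
Qed.

Lemma near_step t a : 0 < a -> \forall s \near t, `|s - t| <= a.
Proof.
move=> a0; near=> s; apply: ltW; rewrite distrC; near: s; exact: (@nbhsx_ballx _ R t a a0).
Unshelve. all: by end_near. Qed.

Lemma dirichlet_derive t : 0 < t -> is_derive t 1 (fun s => gr (u s) (u s)) (2 * gr (u t) (v t)).
Proof.
move=> t0; apply: is_derive_eps => e e0; have e4 : 0 < e / 4 by rewrite divr_gt0.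
have [c c0 Hc] := u_lipschitz t0.
have a0 : 0 < e / 2 / c by rewrite !divr_gt0.
near=> s.
have [s0 hy] : 0 < s /\ gr (sub (u s) (u t)) (sub (u s) (u t)) <= c * (s - t) ^+ 2 by near: s.
have [_ _ hz _ _] : small_remainder t (e / 4) s by near: s; exact: u_increment_forms.
have hs : `|s - t| <= e / 2 / c by near: s; exact: near_step.
have Vy := H10_lin oO 1 (-1) (Vu s0) (Vu t0); have Vz := H10_rem s0 t0.
have E1 : gr (u s) (u s) = gr (u t) (u t) + 2 * gr (u t) (sub (u s) (u t)) + gr (sub (u s) (u t)) (sub (u s) (u t)).
  rewrite {1 2}(u_step t s) (dirichlet_sqr_lin oO 1 1 (H10_H1 (Vu t0)) (H10_H1 Vy)).
  by rewrite expr1n !mulr1 !mul1r.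
have E2 : gr (u t) (sub (u s) (u t)) = gr (u t) (rem t s) + (s - t) * gr (u t) (v t).
  rewrite {1}u_step_rem (dirichlet_linr oO 1 (s - t) (H10_H1 Vz) (H10_H1 (Vv t0)) (H10_H1 (Vu t0))).
  by rewrite mul1r.
rewrite E1 E2.
have gy := dirichlet_ge0 Omega (sub (u s) (u t)).
move: hz hy gy; move: (gr (u t) (rem t s)) (gr (sub _ _) (sub _ _)) (gr (u t) (u t)) (gr (u t) (v t)).
move=> p q g k hp hq q0.
have -> : g + 2 * (p + (s - t) * k) + q - g - (s - t) * (2 * k) = 2 * p + q by ring.
have hq2 : q <= e / 2 * `|s - t|.
  apply: (le_trans hq); rewrite -[(s - t) ^+ 2]real_normK ?num_real// expr2 mulrA.
  by apply: ler_wpM2r => //; rewrite mulrC -ler_pdivlMr.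
have -> : e * `|s - t| = 2 * (e / 4 * `|s - t|) + e / 2 * `|s - t| by field.
apply: (le_trans (ler_normD _ _)); apply: lerD; last by rewrite ger0_norm.
by rewrite normrM ger0_norm//; apply: ler_wpM2l.
Unshelve. all: by end_near. Qed.

Lemma int_pow6_derive t : 0 < t -> is_derive t 1 (fun s => J (u s)) (6 * N (u t) (v t)).
Proof.
move=> t0; apply: is_derive_eps => e e0; have e12 : 0 < e / 12%:R by rewrite divr_gt0.
have [c c0 Hc] := u_lipschitz t0.
have [B [B0 _ bB]] := near_bound 0 t0; have [_ utB _] := nbhs_singleton bB.
pose M := 15 * (C * c ^+ 3 + (C * B ^+ 3 + C * B ^+ 3)).
have M0 : 0 <= M.
  by rewrite /M; apply: mulr_ge0 => //; apply: addr_ge0; [|apply: addr_ge0];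
    apply: mulr_ge0; try exact: ltW; apply: exprn_ge0 => //; exact: ltW.
have e2 : 0 < e / 2 by rewrite divr_gt0.
have [a [a0 _ ha]] := small_factor M0 e2.
near=> s.
have [s0 hy] : 0 < s /\ gr (sub (u s) (u t)) (sub (u s) (u t)) <= c * (s - t) ^+ 2 by near: s.
have [_ _ _ _ hz] : small_remainder t (e / 12%:R) s by near: s; exact: u_increment_forms.
have hs : `|s - t| <= a by near: s; exact: near_step.
have [_ usB _] : [/\ 0 < s, gr (u s) (u s) <= B & gr (v s) (v s) <= B] by near: s; exact: bB.
have [st|st] := eqVneq s t.
  by rewrite st !subrr mul0r subr0 normr0 mulr0.
have m0 : 0 < `|s - t| by rewrite normr_gt0 subr_eq0.
have Vy := H10_lin oO 1 (-1) (Vu s0) (Vu t0); have Vz := H10_rem s0 t0.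
have [Lus _] := sob (Vu s0); have [Lut _] := sob (Vu t0); have [Ly _] := sob Vy.
have [Lz _] := sob Vz; have [Lv _] := sob (Vv t0).
(* With weight |s - t| the Taylor error is O((s - t)^2), since J of the
   increment is O(|s - t|^6). *)
have hd := int_pow6_expansion oO m0 Lus Lut Ly.
have E2 : N (u t) (sub (u s) (u t)) = N (u t) (rem t s) + (s - t) * N (u t) (v t).
  by rewrite {1}u_step_rem (int_quintic_lin oO 1 (s - t) Lut Lz Lv) mul1r.
have j1 := int_pow6_bound C0 sob usB (Vu s0); have j2 := int_pow6_bound C0 sob utB (Vu t0).
have j3 := int_pow6_bound C0 sob hy Vy.
move: hd; rewrite E2; move: hz j1 j2 j3.
move: (N (u t) (rem t s)) (N (u t) (v t)) (J (u s)) (J (u t)) (J (sub _ _)) => p n js jt jy hp j1 j2 j3 hd.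
have -> : js - jt - (s - t) * (6 * n) = (js - jt - 6 * (p + (s - t) * n)) + 6 * p by ring.
have -> : e * `|s - t| = e / 2 * `|s - t| + 6 * (e / 12%:R * `|s - t|) by field.
apply: (le_trans (ler_normD _ _)); apply: lerD; last first.
  by rewrite normrM ger0_norm//; apply: ler_wpM2l.
apply: (le_trans hd).
have h1 : `|s - t|^-1 ^+ 6 * jy <= C * c ^+ 3.
  rewrite exprVn mulrC ler_pdivrMr ?exprn_gt0//.
  apply: (le_trans j3); rewrite exprMn -exprM -[(s - t) ^+ (2 * 3)]/((s - t) ^+ 6) pow6_norm mulrA.
  exact: lexx.
have h2 : `|s - t|^-1 ^+ 6 * jy + (js + jt) <= C * c ^+ 3 + (C * B ^+ 3 + C * B ^+ 3) by rewrite !lerD.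
have h15 : 0 <= 15 * `|s - t| ^+ 2 by apply: mulr_ge0 => //; exact: sqr_ge0.
apply: (le_trans (ler_wpM2l h15 h2)).
have -> : 15 * `|s - t| ^+ 2 * (C * c ^+ 3 + (C * B ^+ 3 + C * B ^+ 3)) = `|s - t| * M * `|s - t|.
  by rewrite /M; ring.
apply: ler_wpM2r => //; apply: le_trans ha; exact: ler_wpM2r.
Unshelve. all: by end_near. Qed.

Lemma near_accel_small t e : 0 < t -> 0 < e -> \forall s \near t, 0 < s /\
  `|accel t (sub (u s) (u t))| <= e /\ `|accel t (sub (v s) (v t))| <= e.
Proof.
move=> t0 e0; have [r r0 H] := accel_small t0 e0.
near=> s.
have s0 : 0 < s by near: s; exact: lt_nbhsr.
split; [exact: s0|split].
  apply: (H _ (H10_lin oO 1 (-1) (Vu s0) (Vu t0))); near: s; exact: cu.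
by apply: (H _ (H10_lin oO 1 (-1) (Vv s0) (Vv t0))); near: s; exact: cv.
Unshelve. all: by end_near. Qed.

Lemma kinetic_derive t : 0 < t -> is_derive t 1 (fun s => ip (v s) (v s)) (2 * accel t (v t)).
Proof.
move=> t0; apply: is_derive_eps => e e0; have e2 : 0 < e / 2 by rewrite divr_gt0.
have [B [B0 _ bB]] := near_bound 0 t0; have [_ _ vtB] := nbhs_singleton bB.
have B40 : 0 <= 2 * B + 2 * B by apply: addr_ge0; apply: mulr_ge0.
near=> s.
have [s0 _ vsB] : [/\ 0 < s, gr (u s) (u s) <= B & gr (v s) (v s) <= B] by near: s; exact: bB.
have [_ [_ hA]] : 0 < s /\ `|accel t (sub (u s) (u t))| <= e / 2 /\ `|accel t (sub (v s) (v t))| <= e / 2.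
  by near: s; exact: near_accel_small.
(* The difference of squares is the pairing of v s - v t with v s + v t. *)
have hF : forall w, H10 w -> gr w w <= 2 * B + 2 * B ->
    `|ip (v s) w - ip (v t) w - (s - t) * accel t w| <= e / 2 * `|s - t|.
  by near: s; exact: v_increment.
have Vw := H10_lin oO 1 1 (Vv s0) (Vv t0).
have gw : gr (fun x => 1 * v s x + 1 * v t x) (fun x => 1 * v s x + 1 * v t x) <= 2 * B + 2 * B.
  apply: (le_trans (dirichlet_lin_le oO 1 1 (H10_H1 (Vv s0)) (H10_H1 (Vv t0)))).
  by rewrite expr1n !mulr1; apply: lerD; apply: ler_wpM2l.
have := hF _ Vw gw.
have Ls := H10_sq_integrable oO (Vv s0); have Lt := H10_sq_integrable oO (Vv t0).
rewrite (inner_linr oO 1 1 Ls Lt Ls) (inner_linr oO 1 1 Ls Lt Lt) (accel_lin 1 1 t0 (Vv s0) (Vv t0)) !mul1r.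
move: hA; rewrite (accel_lin 1 (-1) t0 (Vv s0) (Vv t0)) (innerC Omega (v t) (v s)) mul1r mulN1r.
move: (ip (v s) (v s)) (ip (v s) (v t)) (ip (v t) (v t)) (accel t (v s)) (accel t (v t)) => p q r x y hA h.
have -> : p - r - (s - t) * (2 * y) = (p + q - (q + r) - (s - t) * (x + y)) + (s - t) * (x - y) by ring.
have -> : e * `|s - t| = e / 2 * `|s - t| + e / 2 * `|s - t| by field.
apply: (le_trans (ler_normD _ _)); apply: lerD; first exact: h.
by rewrite normrM mulrC; apply: ler_wpM2r.
Unshelve. all: by end_near. Qed.

(** The increment of v is paired with u(s), that of u with v(t). *)
Lemma cross_derive t : 0 < t ->
  is_derive t 1 (fun s => ip (u s) (v s)) (ip (v t) (v t) + accel t (u t)).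
Proof.
move=> t0; apply: is_derive_eps => e e0; have e3 : 0 < e / 3 by rewrite divr_gt0.
have [B [B0 _ bB]] := near_bound 0 t0.
near=> s.
have [s0 usB _] : [/\ 0 < s, gr (u s) (u s) <= B & gr (v s) (v s) <= B] by near: s; exact: bB.
have [_ [hA _]] : 0 < s /\ `|accel t (sub (u s) (u t))| <= e / 3 /\ `|accel t (sub (v s) (v t))| <= e / 3.
  by near: s; exact: near_accel_small.
have hF : forall w, H10 w -> gr w w <= B ->
    `|ip (v s) w - ip (v t) w - (s - t) * accel t w| <= e / 3 * `|s - t|.
  by near: s; exact: v_increment.
have [_ _ _ hz _] : small_remainder t (e / 3) s by near: s; exact: u_increment_forms.
have h := hF _ (Vu s0) usB.
have Lus := H10_sq_integrable oO (Vu s0); have Lut := H10_sq_integrable oO (Vu t0); have Lv := H10_sq_integrable oO (Vv t0).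
move: hz hA; rewrite (inner_linr oO 1 (- (s - t)) (sq_integrable_lin oO 1 (-1) Lus Lut) Lv Lv).
rewrite (inner_linr oO 1 (-1) Lus Lut Lv) (accel_lin 1 (-1) t0 (Vu s0) (Vu t0)).
rewrite (innerC Omega (u s) (v s)) (innerC Omega (u t) (v t)) !mul1r !mulN1r.
move: h; move: (ip (v s) (u s)) (ip (v t) (u s)) (ip (v t) (u t)) (ip (v t) (v t)) (accel t (u s)) (accel t (u t)).
move=> p q r k x y h hz hA.
have -> : p - r - (s - t) * (k + y) = (p - q - (s - t) * x) + (q - r + - (s - t) * k) + (s - t) * (x - y) by ring.
have -> : e * `|s - t| = e / 3 * `|s - t| + e / 3 * `|s - t| + e / 3 * `|s - t| by field.
apply: (le_trans (ler_normD _ _)); apply: lerD.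
  by apply: (le_trans (ler_normD _ _)); exact: lerD.
by rewrite normrM mulrC; apply: ler_wpM2r.
Unshelve. all: by end_near. Qed.

Lemma energy_derive t : 0 < t -> is_derive t 1 form_energy (- (form_energy t * ip (v t) (v t))).
Proof.
move=> t0; have d1 := dirichlet_derive t0; have d2 := kinetic_derive t0; have d3 := int_pow6_derive t0.
have d12 := is_deriveD d1 d2.
have := is_deriveD (is_deriveZ 2^-1 d12) (is_deriveZ 6^-1 d3).
rewrite (_ : _ + _ = - (form_energy t * ip (v t) (v t))).
  by move=> H; exact: H.
rewrite /GRing.scale /= /accel; move: (gr (u t) (v t)) (N _ _) (ip _ _) (form_energy t) => a b c d; by field.
Qed.

Lemma virial_derive t : 0 < t -> is_derive t 1 (fun s => ip (u s) (v s))
  (ip (v t) (v t) - gr (u t) (u t) - J (u t) - form_energy t * ip (u t) (v t)).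
Proof.
move=> t0; have := cross_derive t0; rewrite /accel (int_quintic_self Omega) (innerC Omega (v t) (u t)).
by rewrite !addrA.
Qed.

End evolution.

(** * The differential inequality *)

Section decay.
Context {R : realType}.
Implicit Types s t d x : R.
Variables E P a V j : R -> R.
Variable K : R.
Hypothesis K0 : 0 < K.
Hypothesis EE : forall t, 0 < t -> E t = 2^-1 * (a t + V t) + 6^-1 * j t.
Hypothesis a0 : forall t, 0 <= a t.
Hypothesis V0 : forall t, 0 <= V t.
Hypothesis j0 : forall t, 0 <= j t.
Hypothesis dE : forall t, 0 < t -> is_derive t 1 E (- (E t * V t)).
Hypothesis dP : forall t, 0 < t -> is_derive t 1 P (V t - a t - j t - E t * P t).
Hypothesis hP : forall t d, 0 < t -> 0 < d -> `|P t| <= d^-1 * (K * a t) + d * V t.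

Let t1 (t : R) : 1 <= t -> 0 < t. Proof. by apply: lt_le_trans. Qed.

Let E_ge0 t : 0 < t -> 0 <= E t.
Proof. by move=> t0; rewrite EE//; have := a0 t; have := V0 t; have := j0 t; lra. Qed.

Let E_nincr s t : 1 <= s -> s <= t -> E t <= E s.
Proof.
move=> s1 st; have [x /andP[sx _]|c /andP[sc _] h] := @mvt_closed _ E (fun x => - (E x * V x)) s t st.
  by apply: dE; exact: (t1 (le_trans s1 sx)).
have c0 := t1 (le_trans s1 sc).
rewrite -subr_le0 h mulNr oppr_le0; apply: mulr_ge0; last by rewrite subr_ge0.
by apply: mulr_ge0; [exact: E_ge0|exact: V0].
Qed.

Let p := 2 * (K + 1) * E 1.
(** Collects the coefficients of V produced by the derivative of eps E P, in
    terms of E 1, which bounds E t for t >= 1. *)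
Let M := p + 2 + 2 * K * E 1 ^+ 2 + E 1.
Let eps := (2 * M)^-1.
Let G t := E t + eps * (E t * P t).

Let E1_ge0 : 0 <= E 1. Proof. exact: E_ge0. Qed.

Let M_ge2 : [/\ 0 <= p, p <= M & 2 <= M].
Proof.
have h1 : 0 <= p by rewrite /p mulr_ge0// mulr_ge0// addr_ge0// ltW.
have h2 : 0 <= 2 * K * E 1 ^+ 2 by rewrite mulr_ge0// ?sqr_ge0// mulr_ge0// ltW.
by have := E1_ge0; split => //; rewrite /M; lra.
Qed.

Let M_gt0 : 0 < M. Proof. by have [_ _] := M_ge2; lra. Qed.
Let eps_gt0 : 0 < eps. Proof. by rewrite invr_gt0 mulr_gt0. Qed.
Let epsM : eps * M = 2^-1.
Proof. by rewrite /eps invfM -mulrA mulVf ?mulr1 ?gt_eqF. Qed.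

Let P_le t : 1 <= t -> eps * `|P t| <= 2^-1.
Proof.
move=> h1; have t0 := t1 h1; have := hP t0 ltr01; rewrite invr1 !mul1r => h.
rewrite -epsM; apply: (ler_wpM2l (ltW eps_gt0)); have [_ pM _] := M_ge2; apply: le_trans pM.
apply: (le_trans h); have e1 := E_nincr (lexx 1) h1.
apply: (@le_trans _ _ (2 * (K + 1) * E t)); last first.
  by rewrite /p; apply: ler_wpM2l e1; rewrite mulr_ge0// addr_ge0// ltW.
have aE : a t <= 2 * E t by rewrite EE//; have := V0 t; have := j0 t; lra.
have VE : V t <= 2 * E t by rewrite EE//; have := a0 t; have := j0 t; lra.
have KaE : K * a t <= K * (2 * E t) by rewrite ler_wpM2l// ltW.
lra.
Qed.

Let G_bounds t : 1 <= t -> 2^-1 * E t <= G t <= 3 / 2 * E t.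
Proof.
move=> h1; have e0 := E_ge0 (t1 h1); have hp := P_le h1.
have : `|eps * P t| <= 2^-1 by rewrite normrM gtr0_norm.
rewrite ler_norml => /andP[l u].
have -> : G t = E t + (eps * P t) * E t by rewrite /G; ring.
have h2 := ler_wpM2r e0 l; have h3 := ler_wpM2r e0 u.
apply/andP; split; lra.
Qed.

Let dG t := - (E t * V t) + eps * (E t * (V t - a t - j t - E t * P t) + P t * - (E t * V t)).

Let G_derive t : 0 < t -> is_derive t 1 G (dG t).
Proof.
move=> t0; have d1 := dE t0; have d2 := dP t0.
by have := is_deriveD d1 (is_deriveZ eps (is_deriveM d1 d2)) => H; exact: H.
Qed.

(** By a + j >= 2 E - V the derivative is at most - 2 eps E^2 plus multiples of
    E V and eps E^2 |P|.  The choice of eps makes the multiples of E V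
    nonpositive in total, and half of the negative term absorbs what is left of
    eps E^2 |P|. *)
Let dG_le t : 1 <= t -> dG t <= - (eps * E t ^+ 2).
Proof.
move=> h1; have t0 := t1 h1; have e0 := E_ge0 t0; have hp := P_le h1.
have Ent := E_nincr (lexx 1) h1.
(* With this weight the Dirichlet part of E |P| is at most half of a, hence at
   most E. *)
pose d := 2 * K * E 1 + 1.
have KE0 : 0 <= 2 * K * E 1 by rewrite mulr_ge0// mulr_ge0// ltW.
have d0 : 0 < d by rewrite ltr_wpDl.
have hEP : E t * `|P t| <= 2^-1 * a t + (2 * K * E 1 ^+ 2 + E 1) * V t.
  apply: (le_trans (ler_wpM2r (normr_ge0 _) Ent)).
  apply: (le_trans (ler_wpM2l E1_ge0 (hP t0 d0))); rewrite mulrDr; apply: lerD.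
    rewrite !mulrA; apply: ler_wpM2r; first exact: a0.
    by rewrite mulrAC ler_pdivrMr// /d; lra.
  by rewrite /d (_ : E 1 * _ = (2 * K * E 1 ^+ 2 + E 1) * V t)//; ring.
have -> : dG t = - (E t * (V t + eps * (V t * P t - V t + a t + j t + E t * P t))).
  by rewrite /dG; ring.
rewrite lerN2 expr2 mulrCA; apply: (ler_wpM2l e0).
have v0 := V0 t.
have hVP : - (eps * (V t * P t)) <= 2^-1 * V t.
  have : `|eps * P t| <= 2^-1 by rewrite normrM gtr0_norm.
  rewrite ler_norml => /andP[l _]; have := ler_wpM2l v0 l; lra.
have hEP' : - (eps * (E t * P t)) <= eps * (2^-1 * a t + (2 * K * E 1 ^+ 2 + E 1) * V t).
  rewrite -mulrN; apply: (ler_wpM2l (ltW eps_gt0)); apply: le_trans hEP.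
  by rewrite -mulrN; apply: (ler_wpM2l e0); rewrite -normrN; exact: ler_norm.
have hM : eps * (2 + (2 * K * E 1 ^+ 2 + E 1)) <= 2^-1.
  rewrite -epsM; apply: (ler_wpM2l (ltW eps_gt0)); have [p0 _ _] := M_ge2; rewrite /M; lra.
have hMV := ler_wpM2r v0 hM.
have hE := EE t0.
have k1 : 0 <= eps * a t by rewrite mulr_ge0// ltW.
have k2 : 0 <= eps * V t by rewrite mulr_ge0// ltW.
have k3 : 0 <= eps * j t by rewrite mulr_ge0// ltW.
have hE' : eps * E t = 2^-1 * (eps * a t + eps * V t) + 6^-1 * (eps * j t) by rewrite hE; ring.
move: hVP hEP' hMV hE' k1 k2 k3; rewrite !(mulrDl, mulrDr, mulrN, mulrA).
lra.
Qed.

(** On [1, t] with E t > 0 the derivative of 1/G is at least 4/9 eps, because G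
    <= 3/2 E. *)
Lemma decay_rate : exists C0 t0 : R, [/\ 0 < C0, 0 < t0 & forall t, t0 <= t -> E t <= C0 / t].
Proof.
exists (9 / eps), 2; split=> // [|t t2]; first exact: divr_gt0.
have h1 : 1 <= t by apply: le_trans t2; rewrite ler1n.
have t0 := t1 h1; have := E_ge0 t0; rewrite le_eqVlt => /predU1P[<-|Et].
  by rewrite divr_ge0// ?ltW// divr_gt0.
have Gpos s : 1 <= s <= t -> 0 < E s /\ 0 < G s.
  move=> /andP[s1 st]; have es := lt_le_trans Et (E_nincr s1 st).
  by have /andP[g _] := G_bounds s1; split => //; apply: lt_le_trans g; rewrite mulr_gt0.
have [x|c /[dup] /Gpos [Ec Gc] /andP[c1 ct] h] :=
    @mvt_closed _ (fun s => (G s)^-1) (fun s => - (G s) ^- 2 *: dG s) 1 t h1.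
  move=> x1t; have [Ex Gx] := Gpos _ x1t; move/andP: x1t => [x1 _].
  have dGx := G_derive (t1 x1).
  by apply: is_deriveV; rewrite gt_eqF.
have /andP[_ gu] := G_bounds c1; have hd := dG_le c1.
have slope : 4 / 9 * eps <= - (G c) ^- 2 *: dG c.
  rewrite /GRing.scale /= mulNr -mulrN ler_pdivlMl ?exprn_gt0//.
  apply: (@le_trans _ _ (eps * E c ^+ 2)); last by rewrite lerNr.
  have e32 : 0 <= 3 / 2 * E c by rewrite mulr_ge0 ?ltW// divr_ge0.
  have G2 : G c ^+ 2 <= (3 / 2 * E c) ^+ 2 by have Gc' := ltW Gc; rewrite lerXn2r ?nnegrE.
  have k0 : 0 <= 4 / 9 * eps by rewrite mulr_ge0 ?ltW// divr_ge0.
  apply: (le_trans (ler_wpM2r k0 G2)); rewrite (_ : (3 / 2 * E c) ^+ 2 * (4 / 9 * eps) = eps * E c ^+ 2) ?lexx//.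
  by move: eps (E c) => x y; field.
have g1 : 0 < (G 1)^-1 by rewrite invr_gt0; have [] := Gpos 1; rewrite ?lexx.
have gt : 2 / 9 * eps * t <= (G t)^-1.
  have s2 := ler_wpM2r (_ : 0 <= t - 1) slope.
  move: s2; rewrite subr_ge0 -h => /(_ h1) s2.
  have e2 : 0 <= eps * (t - 2) by rewrite mulr_ge0 ?subr_ge0// ltW.
  by move: s2 g1 e2; lra.
have [_ Gt] := Gpos t (introT andP (conj h1 (lexx t))).
have : G t <= (2 / 9 * eps * t)^-1.
  by rewrite -[leLHS]invrK lef_pV2// ?posrE ?invr_gt0// !mulr_gt0.
have /andP[gl _] := G_bounds h1.
have -> : 9 / eps / t = 2 * (2 / 9 * eps * t)^-1.
  by field; rewrite !gt_eqF.
lra.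
Qed.
End decay.

(** * The decay theorem *)

Section assembly.
Context {R : realType}.
Local Notation T3 := (measurableTypeR R * measurableTypeR R * measurableTypeR R)%type.

Lemma bounded_finite (Omega : set (R3 R)) : open Omega -> bounded_set Omega ->
  (lebesgue3 R Omega < +oo)%E.
Proof.
move=> oO /bounded_cube[L _ OL].
apply: (@le_lt_trans _ _ (lebesgue3 R (cube L))); last exact: cbox_fin.
by apply: (@le_measure _ _ T3 (lebesgue3 R)) => //; rewrite inE; apply: meas3;
  [exact: open_measurable3|exact: measurable_cbox].
Qed.

Lemma cont_into_dirichlet (Omega : set (R3 R)) (w : R -> R3 R -> R) (t r : R) : open Omega ->
  (forall T, 0 < T -> cont_into T (H10 Omega) (H1norm Omega) w) -> 0 < t -> 0 < r ->
  \forall s \near t, dirichlet Omega (fun x => 1 * w s x + -1 * w t x)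
    (fun x => 1 * w s x + -1 * w t x) <= r.
Proof.
move=> oO cw t0 r0; pose T := t + 1; have T0 : 0 < T by rewrite addr_gt0.
have tT : t \in `[0, T] by rewrite in_itv /= ltW// lerDl ler01.
have [Vt /cvgrPdist_lt cN] := cw T T0 t tT.
have sr0 : 0 < Num.sqrt r by rewrite sqrtr_gt0.
have H := cN _ sr0.
near=> s.
have s0 : 0 < s by near: s; exact: lt_nbhsr.
have sT : s < T by near: s; apply: lt_nbhsl; rewrite ltrDl.
have sI : s \in `[0, T] by rewrite in_itv /= !ltW.
have [Vs _] := cw T T0 s sI.
have hs : `|0 - H1norm Omega (w s \- w t)| < Num.sqrt r.
  by move: sI; near: s; exact: H.
have E : w s \- w t = (fun x => 1 * w s x + -1 * w t x).
  by apply/funext => x /=; rewrite mul1r mulN1r.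
have Vd := H10_lin oO 1 (-1) Vs Vt.
apply: (le_trans (dirichlet_le_H1sq Omega _)).
rewrite -(H1norm_sqr oO (H10_H1 Vd)) -E -[leRHS]sqr_sqrtr; last exact: ltW.
move: hs; rewrite sub0r normrN ger0_norm ?sqrtr_ge0// => hs.
by apply: lerXn2r; rewrite ?nnegrE ?sqrtr_ge0 ?ltW.
Unshelve. all: by end_near. Qed.

End assembly.

Theorem theorem4p1 (R : realType) (Omega : set (R3 R))
    (u ut : R -> R3 R -> R) (u0 u1 : R3 R -> R)
    (hOmega : smooth_bounded_domain Omega)
    (hu : global_strong_solution Omega u ut u0 u1)
    (hE0 : 0 < energy Omega u ut 0) :
  exists C0 t0 : R, [/\ 0 < C0, 0 < t0 &
    forall t : R, t0 <= t -> energy Omega u ut t <= C0 / t].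
Proof.
have [oO _ _ bO _] := hOmega; have fO := bounded_finite oO bO.
have [K K0 poin] := poincare_H10 oO fO.
have [C C0 sob] := sobolev_H10 oO fO.
have cu T : 0 < T -> cont_into T (H10 Omega) (H1norm Omega) u.
  by move=> /hu [[_ [cu _] _ _ _] _ _].
have cv T : 0 < T -> cont_into T (H10 Omega) (H1norm Omega) ut.
  by move=> /hu [_ _].
have td T : 0 < T -> is_time_derivative Omega T u ut.
  by move=> /hu [[h _ _ _ _] _ _].
have se T : 0 < T -> solves_equation Omega T u ut.
  by move=> /hu [[_ _ _ h _] _ _].
have member (w : R -> R3 R -> R) : (forall T, 0 < T -> cont_into T (H10 Omega) (H1norm Omega) w) ->
    forall t, 0 < t -> H10 Omega (w t).
  by move=> cw t t0; have [] := cw t t0 t; rewrite ?in_itv /= ?lexx ?ltW.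
have Vu := member u cu; have Vv := member ut cv.
have ncu t r := @cont_into_dirichlet R Omega u t r oO cu.
have ncv t r := @cont_into_dirichlet R Omega ut t r oO cv.
have dE := energy_derive oO K0 C0 poin sob Vu Vv ncu ncv td se.
have dP := virial_derive oO K0 C0 poin sob Vu Vv ncu ncv td se.
have hP t d : 0 < t -> 0 < d -> `|inner Omega (u t) (ut t)| <=
    d^-1 * (K * dirichlet Omega (u t) (u t)) + d * inner Omega (ut t) (ut t).
  move=> t0 d0; have mO := open_measurable3 oO.
  apply: (le_trans (inner_young mO d0 (H10_sq_integrable oO (Vu t t0)) (H10_sq_integrable oO (Vv t t0)))).
  rewrite lerD2r; apply: ler_wpM2l; first by rewrite invr_ge0 ltW.
  exact: poin (Vu t t0).
have [C1 [t1 [C10 t10 H]]] := @decay_rate R (form_energy Omega u ut) _ (fun t => dirichlet Omega (u t) (u t))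
  (fun t => inner Omega (ut t) (ut t)) (fun t => int_pow6 Omega (u t)) K K0 (fun t _ => erefl)
  (fun t => dirichlet_ge0 Omega (u t)) (fun t => inner_ge0 Omega (ut t)) (fun t => int_pow6_ge0 Omega (u t)) dE dP hP.
exists C1, t1; split=> // t ht.
by rewrite (energy_form oO sob Vu Vv (lt_le_trans t10 ht)); exact: H.
Qed.
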